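(* Let $A_j(z)$ $(j=0,1,\dots,k)$ be meromorphic functions. If there exists an $A_m(z)$ $(0\le m\le k)$ such that $$\lambda_{\frac{1}{A_m}}(p,q)<\rho_{A_m}(p,q)<\infty$$ and $$\max\{\rho_{A_j}(p,q): j=0,1,\dots,k,\ j\ne m\}<\rho_{A_m}(p,q),$$ then every nonzero meromorphic solution $f(z)$ of $$A_k(z)f(z+c_k)+A_{k-1}(z)f(z+c_{k-1})+\cdots+A_1(z)f(z+c_1)+A_0(z)f(z)=0$$ satisfies $\rho_f(p,q)\ge\rho_{A_m}(p,q)$.
   Context: Here $p,q$ are integers with $p\ge q\ge1$ or $2\le q=p+1$. Meromorphic means meromorphic in $\mathbb{C}$; $T(r,f)$ is the Nevanlinna characteristic, $N(r,f)$ the integrated counting function of poles, $M(r,f)$ the maximum modulus. Iterated logarithms: $\log_0 r=r$, $\log_1 r=\log r$, $\log_{n+1}r=\log(\log_n r)$ for large $r$. The $(p,q)$-order of a transcendental meromorphic function $f$ is $\rho_f(p,q)=\limsup_{r\to\infty}\frac{\log_p T(r,f)}{\log_q r}$; if $f$ is transcendental entire, $\rho_f(p,q)=\limsup_{r\to\infty}\frac{\log_{p+1}M(r,f)}{\log_q r}$. For a rational function $\rho_f(p,q)=0$. The $(p,q)$-exponent of convergence of the sequence of poles of a meromorphic function $f$ is $\lambda_{\frac1f}(p,q)=\limsup_{r\to\infty}\frac{\log_p N(r,f)}{\log_q r}$. Standing assumptions on the equation: $k\ge2$, the coefficients $A_0,\dots,A_k$ are not identically zero, and $c_1,\dots,c_k$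 are distinct nonzero complex numbers. *)

(* Defs.v *)
(* MathComp / MathComp-Analysis; complex numbers are [R[i]] over [R : realType]. *)
From HB Require Import structures.
From mathcomp Require Import all_boot all_order all_algebra.
From mathcomp Require Import all_classical all_reals all_analysis.
From mathcomp Require Import complex.

Set Implicit Arguments.
Unset Strict Implicit.
Unset Printing Implicit Defensive.

Import Order.TTheory GRing.Theory Num.Theory.
Import numFieldNormedType.Exports.

Local Open Scope classical_set_scope.
Local Open Scope ring_scope.

(* [R[i]] is canonically a [numFieldType]; these instances equip it with the
   topology and normed space structure (over itself) given by the modulus, as
   [numFieldNormedType] does for abstract numerical fields. *)
#[export, non_forgetful_inheritance]
HB.instance Definition _ (R : realType) := PseudoPointedMetric.copy R[i] R[i]^o.
#[export, non_forgetful_inheritance]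
HB.instance Definition _ (R : realType) := NormedModule.copy R[i] R[i]^o.

(* The modulus as an element of [R]; the norm [`|z|] of [R[i]] lives in [R[i]]. *)
Definition cmod (R : realType) (z : R[i]) : R := complex.Re `|z|.

Definition pole_of_order (R : realType) (f : R[i] -> R[i]) (a : R[i]) (n : nat)
    : Prop :=
  (0 < n)%N /\
  exists2 l : R[i], l != 0 & (fun z => (z - a) ^+ n * f z) @ a^' --> l.

Definition is_pole (R : realType) (f : R[i] -> R[i]) (a : R[i]) : Prop :=
  exists n, pole_of_order f a n.

(* A meromorphic function is a total function on [R[i]] whose value at a pole is
   irrelevant: holomorphic on a punctured neighbourhood of every point, and at
   the point itself either complex differentiable (so that the function takes
   there its true, continuous, value) or having a pole. *)
Definition meromorphic (R : realType) (f : R[i] -> R[i]) : Prop :=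
  forall a : R[i],
    (\forall z \near a^', derivable f z 1) /\
    (derivable f a 1 \/ is_pole f a).

Definition not_identically_zero (R : realType) (f : R[i] -> R[i]) : Prop :=
  exists2 z, ~ is_pole f z & f z != 0.

Definition rational_function (R : realType) (f : R[i] -> R[i]) : Prop :=
  exists P Q : {poly R[i]}, Q != 0 /\
    forall z, Q.[z] != 0 -> f z = P.[z] / Q.[z].

(* Multiplicity of [a] as a pole of [f], and 0 if [a] is not a pole. *)
Definition pole_mult (R : realType) (f : R[i] -> R[i]) (a : R[i]) : nat :=
  xget 0%N [set n | pole_of_order f a n].

(* n(t, f): the finite-support sum is a genuine sum for meromorphic [f], whose
   poles in a closed disc are finitely many. *)
Definition pole_count (R : realType) (f : R[i] -> R[i]) (t : R) : R :=
  \sum_(a \in [set a : R[i] | cmod a <= t]) ((pole_mult f a)%:R : R).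

(* N(r, f) = int_0^r (n(t, f) - n(0, f)) / t dt + n(0, f) log r. *)
Definition Nevanlinna_N (R : realType) (f : R[i] -> R[i]) (r : R) : R :=
  \int[lebesgue_measure]_(t in `[0, r])
    ((pole_count f t - pole_count f 0) / t)
  + pole_count f 0 * ln r.

Definition logplus (R : realType) (x : R) : R := Num.max 0 (ln x).

(* m(r, f) = 1/(2 pi) int_0^(2 pi) log^+ |f(r e^(i theta))| d theta. *)
Definition Nevanlinna_m (R : realType) (f : R[i] -> R[i]) (r : R) : R :=
  (2 * pi)^-1 *
  \int[lebesgue_measure]_(theta in `[0, 2 * pi])
    logplus (cmod (f (Complex (r * cos theta) (r * sin theta)))).

Definition Nevanlinna_T (R : realType) (f : R[i] -> R[i]) (r : R) : R :=
  Nevanlinna_m f r + Nevanlinna_N f r.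

(* log_n; as [ln x = 0] for [x <= 0], it is meaningful for large arguments. *)
Definition iter_ln (R : realType) (n : nat) (x : R) : R := iter n (@ln R) x.

(* limsup_(r -> oo) log_p (g r) / log_q r.  For [g = 0] it is 0 because
   [ln 0 = 0]: a function without poles has exponent of convergence 0. *)
Definition pq_growth (R : realType) (p q : nat) (g : R -> R) : \bar R :=
  limf_esup (fun r : R => (iter_ln p (g r) / iter_ln q r)%:E) (pinfty_nbhs R).

(* The (p,q)-order. *)
Definition pq_order (R : realType) (p q : nat) (f : R[i] -> R[i]) : \bar R :=
  if `[< rational_function f >] then 0%E else pq_growth p q (Nevanlinna_T f).

(* The (p,q)-exponent of convergence of the poles of [f], lambda_(1/f)(p,q). *)
Definition pq_pole_exponent (R : realType) (p q : nat) (f : R[i] -> R[i])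
    : \bar R :=
  pq_growth p q (Nevanlinna_N f).

(* A_k(z) f(z+c_k) + ... + A_1(z) f(z+c_1) + A_0(z) f(z) = 0, with [c j] standing
   for c_(j+1).  As an identity between meromorphic functions, it is required at
   the points where no factor has a pole, i.e. off a closed discrete set. *)
Definition solves_difference_equation (R : realType) (k : nat)
    (A : 'I_k.+1 -> R[i] -> R[i]) (c : 'I_k -> R[i]) (f : R[i] -> R[i]) : Prop :=
  forall z : R[i],
    (forall j, ~ is_pole (A j) z) ->
    ~ is_pole f z ->
    (forall j, ~ is_pole f (z + c j)) ->
    \sum_(j < k) A (lift ord0 j) z * f (z + c j) + A ord0 z * f z = 0.

(* Main.v *)
Require Import Defs.
From mathcomp Require Import all_boot all_order all_algebra.
From mathcomp Require Import all_classical all_reals all_analysis.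
From mathcomp Require Import complex ring lra.

(** The theorem holds because the equation, solved for the dominant coefficient,
      A_m(z) = - (sum of A_j(z) f(z + c_j) for j <> m) / f(z + c_m),
    where c_0 = 0, bounds m(r, A_m) by N(s, A_m) and by the characteristics of f and of
    the A_j with j <> m at radii s comparable to r.  If f had smaller order than A_m, all
    of these would grow at a rate b below the order of A_m, in the case of N(s, A_m) by
    the hypothesis on the poles of A_m; then so would T(r, A_m) = m(r, A_m) + N(r, A_m).
    Constant factors, both of T and of r, are invisible at the (p,q)-scale, so that crude
    inequalities suffice.

    The bound is [core_estimate].  On the circle of radius rho,
    log^+ |A_m| is at most the sum of log^+ |A_j| + log^+ |f(z + c_j)|, j <> m, and of
    log^+ |1 / f(z + c_m)|, up to constants.  Poles are cleared by multiplying a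
    function by a polynomial of modulus at most 1 ([pole_prod], [clear_poles]).  For a
    function g holomorphic on a disc, Poisson's inequality gives two bounds: log^+ |g|
    in the half disc is at most 3 times its mean on the circle ([log_upper]), and the
    mean of log^- |g| is controlled by the mean of log^+ |g| and by one value of g
    ([log_lower]).  The first bounds the numerators pointwise; the second bounds the
    means of log^- of the cleared f(z + c_m) and of the pole products
    ([pole_prod_lower]), the number of poles being at most N(2 r) / ln 2.

    Poisson's inequality comes from Goursat's theorem on rectangles: in logarithmic
    polar coordinates it gives the mean value property ([mean_value]), hence the
    maximum principle, hence the subharmonicity of ln |g| at the centre ([sub_mean]),
    which a disc automorphism transports to the other points ([sub_mean_at]).

    The rate b has to exceed the growth rate of ln r, namely 0 for q <= p and 1 for
    q = p + 1, since the order of a rational function is 0 by convention although its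
    characteristic may grow like ln r.  For q <= p the order of A_m is positive
    because it exceeds the nonnegative order of another coefficient.  For q = p + 1,
    functions of order less than 1 are rational ([order_lt1_rational]); if the order of
    A_m were at most 1, the equation would make A_m itself rational
    ([coefficient_rational]), of order 0, a contradiction ([floor_lt_order]). *)

Set Implicit Arguments.
Unset Strict Implicit.
Unset Printing Implicit Defensive.

Import Order.TTheory GRing.Theory Num.Theory.
Import numFieldNormedType.Exports.

Local Open Scope classical_set_scope.
Local Open Scope ring_scope.

(** * Modulus and polar form *)

Section Modulus.
Variable R : realType.
Implicit Types (z w a : R[i]) (x y t : R).

Lemma normCE z : `|z| = (cmod z)%:C%C.
Proof. by rewrite /cmod normc_def. Qed.

Lemma cmodE z : cmod z = Num.sqrt (complex.Re z ^+ 2 + complex.Im z ^+ 2).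
Proof. by rewrite /cmod normc_def. Qed.

Lemma cmod_ge0 z : 0 <= cmod z.
Proof. by rewrite cmodE sqrtr_ge0. Qed.

Lemma cmod_eq0 z : (cmod z == 0) = (z == 0).
Proof. by rewrite -(inj_eq (@complexI R)) -normCE normr_eq0. Qed.

Lemma cmod_gt0 z : (0 < cmod z) = (z != 0).
Proof. by rewrite lt_def cmod_ge0 andbT cmod_eq0. Qed.

Lemma cmod0 : cmod (0 : R[i]) = 0.
Proof. by apply/eqP; rewrite cmod_eq0. Qed.

Lemma cmodM z w : cmod (z * w) = cmod z * cmod w.
Proof. by apply: (@complexI R); rewrite rmorphM -!normCE normrM. Qed.

Lemma cmodD z w : cmod (z + w) <= cmod z + cmod w.
Proof. by rewrite -lecR rmorphD -!normCE ler_normD. Qed.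

Lemma cmodN z : cmod (- z) = cmod z.
Proof. by rewrite /cmod normrN. Qed.

Lemma cmodB z w : cmod (z - w) <= cmod z + cmod w.
Proof. by rewrite -[cmod w]cmodN; exact: cmodD. Qed.

Lemma cmod_distC z w : cmod (z - w) = cmod (w - z).
Proof. by rewrite -cmodN opprB. Qed.

Lemma cmodB_ge z w : cmod z - cmod w <= cmod (z - w).
Proof. by rewrite lerBlDr; apply: le_trans (cmodD _ _); rewrite subrK. Qed.

Lemma cmodC x : cmod (x%:C%C) = `|x|.
Proof. by rewrite cmodE /= expr0n addr0 sqrtr_sqr. Qed.

Lemma cmod1 : cmod (1 : R[i]) = 1.
Proof. by rewrite -[1]/(1%:C%C) cmodC normr1. Qed.

Lemma cmodV z : cmod z^-1 = (cmod z)^-1.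
Proof. by apply: (@complexI R); rewrite -normCE normfV normCE fmorphV. Qed.

Lemma cmodX z n : cmod (z ^+ n) = cmod z ^+ n.
Proof. by elim: n => [|n IH]; rewrite ?expr0 ?cmod1// !exprS cmodM IH. Qed.

Lemma cmod_prod I (r : seq I) (P : pred I) (F : I -> R[i]) :
  cmod (\prod_(i <- r | P i) F i) = \prod_(i <- r | P i) cmod (F i).
Proof. by apply: (big_morph (@cmod R) cmodM cmod1). Qed.

Lemma cmod_sum I (r : seq I) (P : pred I) (F : I -> R[i]) :
  cmod (\sum_(i <- r | P i) F i) <= \sum_(i <- r | P i) cmod (F i).
Proof.
elim/big_rec2: _ => [|i x z _ IH]; first by rewrite cmod0.
by apply: le_trans (cmodD _ _) _; rewrite lerD2l.
Qed.

Lemma cmod_conj z : cmod (z^*%C) = cmod z.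
Proof. by rewrite /cmod normcJ. Qed.

Lemma cReD z w : complex.Re (z + w) = complex.Re z + complex.Re w.
Proof. by case: z w => [? ?] [? ?]. Qed.
Lemma cImD z w : complex.Im (z + w) = complex.Im z + complex.Im w.
Proof. by case: z w => [? ?] [? ?]. Qed.
Lemma cReN z : complex.Re (- z) = - complex.Re z.
Proof. by case: z. Qed.
Lemma cImN z : complex.Im (- z) = - complex.Im z.
Proof. by case: z. Qed.
Lemma cReM z w : complex.Re (z * w) =
  complex.Re z * complex.Re w - complex.Im z * complex.Im w.
Proof. by case: z w => [? ?] [? ?]. Qed.
Lemma cImM z w : complex.Im (z * w) =
  complex.Re z * complex.Im w + complex.Im z * complex.Re w.
Proof. by case: z w => [? ?] [? ?]. Qed.

Lemma Re_le_cmod z : `|complex.Re z| <= cmod z.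
Proof. by rewrite -lecR -normCE; exact: normc_ge_Re. Qed.

Lemma Im_le_cmod z : `|complex.Im z| <= cmod z.
Proof.
rewrite cmodE -sqrtr_sqr ler_wsqrtr// lerDr sqr_ge0 //.
Qed.

Lemma cmod_le_ReIm z : cmod z <= `|complex.Re z| + `|complex.Im z|.
Proof.
have -> : z = (complex.Re z)%:C%C + Complex 0 1 * (complex.Im z)%:C%C.
  by case: z => x y; rewrite [in RHS]/=; simpc.
apply: le_trans (cmodD _ _) _; rewrite cmodM !cmodC.
rewrite (_ : cmod (Complex 0 1) = 1); last first.
  by rewrite cmodE /= expr0n add0r expr1n sqrtr1.
by rewrite mul1r !cReD !cImD !cReM !cImM /= !(mul0r,mul1r,subr0,addr0,add0r,mulr0,oppr0).
Qed.

Lemma eqC_ReIm z w : complex.Re z = complex.Re w -> complex.Im z = complex.Im w ->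
  z = w.
Proof. by case: z w => [? ?] [? ?] /= -> ->. Qed.

Definition cis t : R[i] := Complex (cos t) (sin t).

Lemma cisD x y : cis (x + y) = cis x * cis y.
Proof. by rewrite /cis cosD sinD; simpc; congr Complex; ring. Qed.

Lemma cmod_cis t : cmod (cis t) = 1.
Proof. by rewrite cmodE /= cos2Dsin2 sqrtr1. Qed.

Lemma cis0 : cis 0 = 1.
Proof. by rewrite /cis cos0 sin0. Qed.

Lemma cis_neq0 t : cis t != 0.
Proof. by rewrite -cmod_gt0 cmod_cis. Qed.

Lemma cis2pi : cis (2 * pi) = 1.
Proof. by rewrite /cis mulr_natl cos2pi sin2pi. Qed.

Lemma cisD2pi t : cis (t + 2 * pi) = cis t.
Proof. by rewrite cisD cis2pi mulr1. Qed.

Lemma polar_form z : exists2 t, 0 <= t <= 2 * pi & z = (cmod z)%:C%C * cis t.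
Proof.
have [->|z0] := eqVneq z 0.
  by exists 0; rewrite ?cmod0 ?mul0r// lexx mulr_ge0// pi_ge0.
pose r := cmod z; have r0 : 0 < r by rewrite cmod_gt0.
pose u := complex.Re z / r; pose v := complex.Im z / r.
have zE : z = r%:C%C * Complex u v.
  apply: eqC_ReIm; rewrite ?cReM ?cImM /= mul0r ?subr0 ?addr0 /u /v mulrC divfK// gt_eqF//.
have uv : u ^+ 2 + v ^+ 2 = 1.
  have : cmod (Complex u v) = 1.
    by apply: (mulfI (lt0r_neq0 r0)); rewrite mulr1 -{1}(ger0_norm (ltW r0)) -cmodC -cmodM -zE.
  by rewrite cmodE /= => /(congr1 (fun x => x ^+ 2)); rewrite sqr_sqrtr ?expr1n// addr_ge0 ?sqr_ge0.
have u1 : -1 <= u <= 1.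
  have v2 := sqr_ge0 v; apply/andP; split; nra.
have pi0 := @pi_ge0 R.
have [t t01 [ct st]] : exists2 t, 0 <= t <= 2 * pi & cos t = u /\ sin t = v.
  have s2 : Num.sqrt (1 - u ^+ 2) = `|v| by rewrite -uv addrC addKr sqrtr_sqr.
  have [v0|v0] := leP 0 v.
    exists (acos u).
      by rewrite acos_ge0//=; apply: le_trans (acos_lepi u1) _; rewrite ler_peMl// ler1n.
    split; first by rewrite acosK.
    by rewrite sin_acos// s2 ger0_norm.
  exists (2 * pi - acos u).
    rewrite gerBl acos_ge0// andbT subr_ge0.
    by apply: le_trans (acos_lepi u1) _; rewrite ler_peMl// ler1n.
  split.
    by rewrite cosB mulr_natl cos2pi sin2pi mul1r mul0r addr0 acosK.
  rewrite sinB mulr_natl sin2pi cos2pi mul0r sub0r mul1r sin_acos// s2 ltr0_norm ?opprK//.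
by exists t => //; rewrite /cis ct st.
Qed.

End Modulus.

(** * Limits and complex differentiability *)

Section Topology.
Variable R : realType.
Implicit Types (z w a l : R[i]) (x y t : R).

Lemma nbhsCP a (P : R[i] -> Prop) :
  (\forall z \near a, P z) <->
  exists2 d : R, 0 < d & forall z, cmod (z - a) < d -> P z.
Proof.
split.
  move=> /nbhs_ballP[e /= e0 He].
  have eE : e = (complex.Re e)%:C%C by rewrite RRe_real// gtr0_real.
  exists (complex.Re e); first by rewrite -ltcR -eE.
  move=> z zd; apply: He; rewrite -ball_normE /= eE -normrN opprB normCE ltcR//.
move=> [d d0 H]; apply/nbhs_ballP; exists (d%:C)%C; first by rewrite /= ltcR.
by move=> z; rewrite -ball_normE /= -normrN opprB normCE ltcR; exact: H.
Qed.

Lemma dnbhsCP a (P : R[i] -> Prop) :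
  (\forall z \near a^', P z) <->
  exists2 d : R, 0 < d & forall z, 0 < cmod (z - a) < d -> P z.
Proof.
split.
  move=> /nbhsCP[d d0 H]; exists d => // z /andP[z0 zd].
  by apply: H => //; rewrite -subr_eq0 -cmod_gt0.
move=> [d d0 H]; apply/nbhsCP; exists d => // z zd za; apply: H.
by rewrite cmod_gt0 subr_eq0 za.
Qed.

Lemma cvgCP (T : Type) (F : set_system T) {FF : Filter F} (f : T -> R[i]) l :
  f @ F --> l <->
  forall e : R, 0 < e -> \forall t \near F, cmod (f t - l) < e.
Proof.
split.
  move=> fl e e0; have := fl [set z | cmod (z - l) < e]; apply.
  by apply/nbhsCP; exists e.
move=> H A /nbhsCP[d d0 dA]; have := H _ d0; apply: filterS => t; exact: dA.
Qed.

Lemma cvgC_comp_real (T : Type) (F : set_system T) {FF : Filter F}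
    (f : T -> R[i]) l (h : R[i] -> R) :
  (forall z w, `|h z - h w| <= cmod (z - w)) ->
  f @ F --> l -> (h \o f) @ F --> h l.
Proof.
move=> lip /cvgCP fl; apply/cvgrPdist_lt => e e0.
have := fl _ e0; apply: filterS => t /= ft; apply: le_lt_trans ft.
by rewrite distrC.
Qed.

Lemma cmod_lip z w : `|cmod z - cmod w| <= cmod (z - w).
Proof.
by rewrite ler_norml cmodB_ge andbT lerNl opprB cmod_distC cmodB_ge.
Qed.

Lemma Re_lip z w : `|complex.Re z - complex.Re w| <= cmod (z - w).
Proof. by rewrite -cReN -cReD Re_le_cmod. Qed.

Lemma cvg_cmod (T : Type) (F : set_system T) {FF : Filter F} (f : T -> R[i]) l :
  f @ F --> l -> cmod (f x) @[x --> F] --> cmod l.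
Proof. exact: cvgC_comp_real cmod_lip. Qed.

Lemma cvg_Re (T : Type) (F : set_system T) {FF : Filter F} (f : T -> R[i]) l :
  f @ F --> l -> complex.Re (f x) @[x --> F] --> complex.Re l.
Proof. exact: cvgC_comp_real Re_lip. Qed.

Lemma cvg_Complex (T : Type) (F : set_system T) {FF : Filter F} (f g : T -> R) x y :
  f @ F --> x -> g @ F --> y -> Complex (f t) (g t) @[t --> F] --> Complex x y.
Proof.
move=> /cvgrPdist_lt fx /cvgrPdist_lt gy; apply/cvgCP => e e0.
have e2 : 0 < e / 2 by rewrite divr_gt0.
near=> t.
apply: le_lt_trans (cmod_le_ReIm _) _ => /=.
rewrite [e]splitr; apply: ltrD.
  by rewrite distrC; near: t; exact: fx.
by rewrite distrC; near: t; exact: gy.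
Unshelve. all: by end_near.
Qed.

Lemma continuous_cis : continuous (@cis R).
Proof.
move=> t; apply: (@cvg_Complex R (nbhs t) _ (@cos R) (@sin R)).
  exact: continuous_cos.
exact: continuous_sin.
Qed.

Lemma cvgCM (T : Type) (F : set_system T) {FF : Filter F} (f g : T -> R[i]) a b :
  f @ F --> a -> g @ F --> b -> f x * g x @[x --> F] --> a * b.
Proof. by move=> fa gb; apply: (@cvgM _ _ F FF f g a b fa gb). Qed.

Lemma cvgCD (T : Type) (F : set_system T) {FF : Filter F} (f g : T -> R[i]) a b :
  f @ F --> a -> g @ F --> b -> f x + g x @[x --> F] --> a + b.
Proof. by move=> fa gb; apply: (@cvgD _ _ _ F FF f g a b fa gb). Qed.

Lemma cvgCN (T : Type) (F : set_system T) {FF : Filter F} (f : T -> R[i]) a :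
  f @ F --> a -> - f x @[x --> F] --> - a.
Proof. by move=> fa; apply: (@cvgN _ _ _ F FF f a fa). Qed.

Lemma cvgCV (T : Type) (F : set_system T) {FF : Filter F} (f : T -> R[i]) a :
  a != 0 -> f @ F --> a -> (f x)^-1 @[x --> F] --> a^-1.
Proof. by move=> a0 fa; apply: (@cvgV _ _ F FF f a a0 fa). Qed.

Lemma cvgC_cst (T : Type) (F : set_system T) {FF : Filter F} a :
  (fun _ : T => a) @ F --> a.
Proof. by apply: (@cvg_cst _ _ _ F). Qed.

Definition ccont (f : R[i] -> R[i]) a : Prop := forall e : R, 0 < e ->
    exists2 d : R, 0 < d & forall z, cmod (z - a) < d -> cmod (f z - f a) < e.

Lemma ccontE (f : R[i] -> R[i]) a : ccont f a <-> {for a, continuous f}.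
Proof.
split.
  move=> H; apply: (@cvgCP _ (nbhs a) _ f (f a)).2 => e e0.
  exact/nbhsCP/H.
by move=> cf e e0; apply/nbhsCP; exact: ((@cvgCP _ (nbhs a) _ f (f a)).1 cf e e0).
Qed.

Lemma ccont_cst l a : ccont (fun=> l) a.
Proof. by move=> e e0; exists 1 => // z _; rewrite subrr cmod0. Qed.

Lemma ccont_id a : ccont id a.
Proof. by move=> e e0; exists e. Qed.

Lemma ccontD (f g : R[i] -> R[i]) a : ccont f a -> ccont g a ->
  ccont (fun z => f z + g z) a.
Proof. by move=> /ccontE cf /ccontE cg; apply/ccontE; exact: (@cvgCD _ (nbhs a) _ f g _ _ cf cg). Qed.

Lemma ccontM (f g : R[i] -> R[i]) a : ccont f a -> ccont g a ->
  ccont (fun z => f z * g z) a.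
Proof. by move=> /ccontE cf /ccontE cg; apply/ccontE; exact: (@cvgCM _ (nbhs a) _ f g _ _ cf cg). Qed.

Lemma ccontN (f : R[i] -> R[i]) a : ccont f a -> ccont (fun z => - f z) a.
Proof. by move=> /ccontE cf; apply/ccontE; exact: (@cvgCN _ (nbhs a) _ f _ cf). Qed.

Lemma ccontV (f : R[i] -> R[i]) a : f a != 0 -> ccont f a ->
  ccont (fun z => (f z)^-1) a.
Proof. by move=> fa /ccontE cf; apply/ccontE; exact: (@cvgCV _ (nbhs a) _ f _ fa cf). Qed.

Lemma ccont_comp (f g : R[i] -> R[i]) a : ccont g a -> ccont f (g a) ->
  ccont (fun z => f (g z)) a.
Proof.
move=> cg cf e /cf[d /cg[d' d'0 H] H'].
by exists d' => // z /H /H'.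
Qed.

Lemma ccont_near (f g : R[i] -> R[i]) a :
  (exists2 d : R, 0 < d & forall z, cmod (z - a) < d -> f z = g z) ->
  ccont f a -> ccont g a.
Proof.
move=> [d d0 H] cf e /cf[d' d'0 H'].
exists (Num.min d d'); first by rewrite lt_min d0.
by move=> z; rewrite lt_min => /andP[zd zd']; rewrite -!H ?subrr ?cmod0//; exact: H'.
Qed.

End Topology.

Section Derivable.
Variable R : realType.
Implicit Types (z w a l : R[i]) (x y t : R) (f g : R[i] -> R[i]).

(** Caratheodory's form of derivability makes the chain and product rules consequences
    of the continuity of composites and products. *)
Lemma derivableCP f a : derivable f a 1 <->
  exists2 phi : R[i] -> R[i], ccont phi a &
    forall z, f z = f a + phi z * (z - a).
Proof.
split.
  move=> /cvg_ex[l /= /cvgCP fl].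
  exists (fun z => if z == a then l else (f z - f a) / (z - a)).
    move=> e e0 /=; rewrite eqxx.
    have /dnbhsCP[d d0 H] := fl _ e0.
    exists d => // z zd; have [_|za] := eqVneq z a.
      by rewrite subrr cmod0.
    have := H (z - a); rewrite subr0 zd cmod_gt0 subr_eq0 za => /(_ isT).
    by rewrite /GRing.scale /= mulr1 subrK mulrC.
  move=> z; case: eqVneq => [->|za]; first by rewrite subrr mulr0 addr0.
  by rewrite divfK ?subr_eq0// addrC subrK.
move=> [phi cphi E]; apply/cvg_ex; exists (phi a); apply/cvgCP => e e0.
have [d d0 H] := cphi _ e0.
apply/dnbhsCP; exists d => // h; rewrite subr0 => /andP[h0 hd].
have h0' : h != 0 by rewrite -cmod_gt0.
have -> : h^-1 *: ((f \o shift a) (h *: 1) - f a) = phi (h + a).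
  rewrite /GRing.scale /= mulr1 E addrC addKr addrK mulrC mulfK//.
by apply: H; rewrite addrK.
Qed.

Lemma derivableC_continuous f a : derivable f a 1 -> ccont f a.
Proof.
move=> /derivableCP[phi cphi E].
have fE := funext (E : f =1 _); rewrite fE.
apply: ccontD; first exact: ccont_cst.
by apply: ccontM cphi _; apply: ccontD; [exact: ccont_id|exact: ccont_cst].
Qed.

Lemma derivableC_cst l a : derivable (fun=> l : R[i]) a 1.
Proof.
by apply/derivableCP; exists (fun=> 0); [exact: ccont_cst|move=> z; rewrite mul0r addr0].
Qed.

Lemma derivableC_id a : derivable (fun z : R[i] => z) a 1.
Proof.
by apply/derivableCP; exists (fun=> 1); [exact: ccont_cst|move=> z; rewrite mul1r addrC subrK].
Qed.

Lemma derivableCD f g a : derivable f a 1 -> derivable g a 1 ->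
  derivable (fun z => f z + g z) a 1.
Proof.
move=> /derivableCP[p cp Ep] /derivableCP[q cq Eq]; apply/derivableCP.
exists (fun z => p z + q z); first exact: ccontD.
by move=> z; rewrite Ep Eq; ring.
Qed.

Lemma derivableCM f g a : derivable f a 1 -> derivable g a 1 ->
  derivable (fun z => f z * g z) a 1.
Proof.
move=> df dg; have cg := derivableC_continuous dg.
move: df dg => /derivableCP[p cp Ep] /derivableCP[q cq Eq]; apply/derivableCP.
exists (fun z => f a * q z + p z * g z).
  by apply: ccontD; [apply: ccontM => //; exact: ccont_cst|exact: ccontM].
by move=> z; rewrite (Ep z) {1}(Eq z) [in RHS](Eq z); ring.
Qed.

Lemma derivableC_comp f g a : derivable g a 1 -> derivable f (g a) 1 ->
  derivable (fun z => f (g z)) a 1.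
Proof.
move=> dg df; have cg := derivableC_continuous dg.
move: df dg => /derivableCP[p cp Ep] /derivableCP[q cq Eq]; apply/derivableCP.
exists (fun z => p (g z) * q z).
  by apply: ccontM => //; exact: (@ccont_comp _ p g).
by move=> z; rewrite (Ep (g z)) {2}(Eq z); ring.
Qed.

Lemma derivableCV f a : f a != 0 -> derivable f a 1 ->
  derivable (fun z => (f z)^-1) a 1.
Proof.
move=> fa0 df; have cf := derivableC_continuous df.
move: df => /derivableCP[p cp Ep]; apply/derivableCP.
pose phi z := if f z == 0 then ((f z)^-1 - (f a)^-1) / (z - a)
              else - (p z * ((f z)^-1 * (f a)^-1)).
exists phi.
  apply: (@ccont_near _ (fun z => - (p z * ((f z)^-1 * (f a)^-1)))).
    have [|d d0 H] := cf (cmod (f a)); first by rewrite cmod_gt0.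
    exists d => // z /H; rewrite /phi; have [->|//] := eqVneq (f z) 0.
    by rewrite sub0r cmodN ltxx.
  apply: ccontN; apply: (ccontM cp).
  by apply: ccontM; [exact: ccontV|exact: ccont_cst].
move=> z; rewrite /phi; have [fz0|fz0] := eqVneq (f z) 0.
  have za : z - a != 0.
    by apply: contraNneq fa0 => /subr0_eq <-; rewrite fz0.
  by rewrite divfK// addrC subrK.
have pE : p z * (z - a) = f z - f a by rewrite [f z]Ep; ring.
rewrite mulNr mulrAC pE.
by rewrite mulrBl mulrA divff// mul1r [(f z)^-1 / _]mulrC mulrA divff// mul1r opprB addrC subrK.
Qed.

Lemma derivableC_near_eq f g a : (\forall z \near a, f z = g z) ->
  derivable f a 1 -> derivable g a 1.
Proof.
move=> fg /derivableCP[p cp Ep]; apply/derivableCP.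
move: (fg) => /nbhsCP[d d0 H].
have fga : f a = g a by apply: H; rewrite subrr cmod0.
exists (fun z => if z == a then p a else (g z - g a) / (z - a)); last first.
  move=> z; case: eqVneq => [->|za]; first by rewrite subrr mulr0 addr0.
  by rewrite divfK ?subr_eq0// addrC subrK.
apply: (ccont_near _ cp); exists d => // z zd.
have [->//|za] := eqVneq z a.
by rewrite -H// -fga Ep addrC addKr mulfK// subr_eq0.
Qed.

(** Holomorphy at a, with derivability at a itself replaced by continuity: this is what
    can be read off directly at a cleared pole, and all that enters the mean value
    property. *)
Definition holo f a :=
  ccont f a /\ \forall z \near a^', derivable f z 1.

Lemma holo_derivable f a : (\forall z \near a, derivable f z 1) -> holo f a.
Proof.
move=> /nbhsCP[d d0 H]; split.
  by apply: derivableC_continuous; apply: H; rewrite subrr cmod0.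
by apply/dnbhsCP; exists d => // z /andP[_]; exact: H.
Qed.

Lemma holoT f a : (forall z, derivable f z 1) -> holo f a.
Proof. by move=> H; apply: holo_derivable; apply/nbhsCP; exists 1. Qed.

Lemma holoM f g a : holo f a -> holo g a -> holo (fun z => f z * g z) a.
Proof.
move=> [cf df] [cg dg]; split; first exact: ccontM.
by apply: filterS2 df dg => z; exact: derivableCM.
Qed.

Lemma holo_cst l a : holo (fun=> l) a.
Proof. by apply: holoT => z; exact: derivableC_cst. Qed.

Lemma holo_prod (I : Type) (r : seq I) (F : I -> R[i] -> R[i]) a :
  (forall i, holo (F i) a) -> holo (fun z => \prod_(i <- r) F i z) a.
Proof.
move=> H; elim: r => [|i r IH].
  rewrite (_ : (fun _ => _) = fun=> 1); first exact: holo_cst.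
  by apply/funext => z; rewrite big_nil.
rewrite (_ : (fun _ => _) = fun z => F i z * \prod_(j <- r) F j z); first exact: (@holoM (F i) (fun z => \prod_(j <- r) F j z) a (H i) IH).
by apply/funext => z; rewrite big_cons.
Qed.

Lemma holo_comp f g a : (\forall z \near a^', g z != g a) ->
  derivable g a 1 -> (\forall z \near a^', derivable g z 1) -> holo f (g a) ->
  holo (fun z => f (g z)) a.
Proof.
move=> /dnbhsCP[d3 d30 H3] dga dg [cf df]; have cg := derivableC_continuous dga; split.
  exact: (@ccont_comp _ f g).
have /dnbhsCP[d d0 H] := df.
have [d1 d10 H1] := cg _ d0.
have /dnbhsCP[d2 d20 H2] := dg.
apply/dnbhsCP; exists (Num.min d3 (Num.min d1 d2)); first by rewrite !lt_min d30 d10.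
move=> z /andP[z0]; rewrite !lt_min => /andP[zd3 /andP[zd1 zd2]].
have dgz : derivable g z 1 by apply: H2; apply/andP.
apply: (derivableC_comp dgz).
apply: H; apply/andP; split; last exact: H1.
by rewrite cmod_gt0 subr_eq0; apply: H3; apply/andP.
Qed.

End Derivable.

(** * Goursat's theorem on rectangles *)

Section Integral.
Variable R : realType.
Implicit Types (a b c t x y : R) (h g : R -> R).

Definition itg h a b : R := \int[lebesgue_measure]_(t in `[a, b]) h t.

Definition icont h a b : Prop := forall t, a <= t <= b -> {for t, continuous h}.

Lemma icont_within h a b : icont h a b -> {within `[a, b], continuous h}.
Proof.
move=> ch; apply: continuous_in_subspaceT => t; rewrite inE /= in_itv /=.
exact: ch.
Qed.

Lemma icont_integrable h a b : icont h a b ->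
  lebesgue_measure.-integrable `[a, b] (EFin \o h).
Proof.
move=> ch; apply: continuous_compact_integrable; first exact: segment_compact.
exact: icont_within.
Qed.

Lemma icontS h a b a' b' : a <= a' -> b' <= b -> icont h a b -> icont h a' b'.
Proof.
move=> aa bb ch t /andP[at_ tb]; apply: ch.
by rewrite (le_trans aa)//= (le_trans tb).
Qed.

Lemma icontD h g a b : icont h a b -> icont g a b -> icont (fun t => h t + g t) a b.
Proof. by move=> ch cg t tab; apply: cvgD; [exact: ch|exact: cg]. Qed.

Lemma icontB h g a b : icont h a b -> icont g a b -> icont (fun t => h t - g t) a b.
Proof. by move=> ch cg t tab; apply: cvgB; [exact: ch|exact: cg]. Qed.

Lemma icontM h g a b : icont h a b -> icont g a b -> icont (fun t => h t * g t) a b.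
Proof. by move=> ch cg t tab; apply: cvgM; [exact: ch|exact: cg]. Qed.

Lemma icont_cst c a b : icont (fun=> c) a b.
Proof. by move=> t _; exact: cvg_cst. Qed.

Lemma itgD h g a b : icont h a b -> icont g a b ->
  itg (fun t => h t + g t) a b = itg h a b + itg g a b.
Proof. by move=> ch cg; rewrite /itg RintegralD//; exact: icont_integrable. Qed.

Lemma itgB h g a b : icont h a b -> icont g a b ->
  itg (fun t => h t - g t) a b = itg h a b - itg g a b.
Proof. by move=> ch cg; rewrite /itg RintegralB//; exact: icont_integrable. Qed.

Lemma itgZ c h a b : icont h a b -> itg (fun t => c * h t) a b = c * itg h a b.
Proof. by move=> ch; rewrite /itg RintegralZl//; exact: icont_integrable. Qed.

Lemma itg_cst c a b : a <= b -> itg (fun=> c) a b = c * (b - a).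
Proof.
by move=> ab; rewrite /itg Rintegral_cst//= lebesgue_measure_itv /= lte_fin;
  case: ltP => [//|ba]; rewrite (le_anti (introT andP (conj ab ba))) subrr.
Qed.

Lemma eq_itg h g a b : (forall t, a <= t <= b -> h t = g t) -> itg h a b = itg g a b.
Proof.
move=> H; apply: eq_Rintegral => t; rewrite inE /= in_itv /=; exact: H.
Qed.

Lemma le_itg h g a b : icont h a b -> icont g a b ->
  (forall t, a <= t <= b -> h t <= g t) -> itg h a b <= itg g a b.
Proof.
move=> ch cg H; apply: le_Rintegral => //; exact: icont_integrable.
Qed.

Lemma itg_split h a c b : a <= c -> c <= b -> icont h a b ->
  itg h a b = itg h a c + itg h c b.
Proof.
move=> ac cb ch; have ih := icont_integrable ch.
have := @Rintegral_itvB R h (BLeft a) (BRight b) c ih.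
rewrite !bnd_simp => /(_ ac cb) => /eqP; rewrite subr_eq => /eqP E.
rewrite /itg [LHS]E addrC; congr (_ + _).
rewrite Rintegral_itv_obnd_cbnd//.
apply: integrableS ih => //; apply: subset_itvr; rewrite bnd_simp//.
Qed.

Lemma itg_near_cst h c e a b : a <= b -> icont h a b ->
  (forall t, a <= t <= b -> `|h t - c| <= e) ->
  `|itg h a b - c * (b - a)| <= e * (b - a).
Proof.
move=> ab ch H; rewrite -(itg_cst c ab) -itgB//; last exact: icont_cst.
apply: (le_trans (le_normr_Rintegral _ _)) => //.
  by apply: icont_integrable; apply: icontB => //; exact: icont_cst.
rewrite -(itg_cst e ab); apply: le_itg => //; last exact: icont_cst.
move=> t tab; apply: (@continuous_comp _ _ _ (fun t => h t - c) (fun x => `|x|)).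
  by apply: cvgB; [exact: ch|exact: cvg_cst].
exact: norm_continuous.
Qed.

End Integral.

Section Goursat.
Variable R : realType.
Implicit Types (x y l w e d : R) (n : nat).

Local Notation h n := ((2 : R) ^- n).

Lemma halfS n : h n = h n.+1 + h n.+1.
Proof. by rewrite exprS invfM; field. Qed.

Lemma half_gt0 n : 0 < h n.
Proof. by rewrite invr_gt0 exprn_gt0. Qed.

Lemma half_small d : 0 < d -> exists n, h n < d.
Proof.
move=> d0; have [N _ H] := near_infty_natSinv_expn_lt (PosNum d0).
by exists N; have := H N (leqnn N); rewrite /= mul1r.
Qed.

(** Cantor's nested rectangles: if P fails, it fails on a quarter, and the successive
    failing quarters shrink to a point around which small rectangles satisfy P.  Here
    [P n x y] speaks of the rectangle with lower left corner (x, y) and sides L / 2^n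
    and W / 2^n. *)
Lemma bisection (P : nat -> R -> R -> Prop) x0 y0 L W : 0 < L -> 0 < W ->
  (forall n x y, P n.+1 x y -> P n.+1 (x + L * h n.+1) y ->
     P n.+1 x (y + W * h n.+1) -> P n.+1 (x + L * h n.+1) (y + W * h n.+1) ->
     P n x y) ->
  (forall x y, x0 <= x <= x0 + L -> y0 <= y <= y0 + W ->
     exists2 d, 0 < d & forall n x' y', x' <= x <= x' + L * h n ->
       y' <= y <= y' + W * h n -> h n < d -> P n x' y') ->
  P 0 x0 y0.
Proof.
move=> L0 W0 quarter loc; apply: contrapT => nP0.
have step n x y : exists s : R * R, ~ P n x y ->
    [/\ ~ P n.+1 s.1 s.2, (s.1 = x \/ s.1 = x + L * h n.+1) &
      (s.2 = y \/ s.2 = y + W * h n.+1)].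
  have [nP|nP] := pselect (P n x y); first by exists (0, 0).
  apply: contrapT => nE.
  apply: nP; apply: quarter; apply: contrapT => nP'; apply: nE;
    [exists (x, y)|exists (x + L * h n.+1, y)|exists (x, y + W * h n.+1)
    |exists (x + L * h n.+1, y + W * h n.+1)] => _; split => //=;
    by [left|right].
have [F HF] : {F : nat -> R -> R -> R * R & forall n x y, ~ P n x y ->
    [/\ ~ P n.+1 (F n x y).1 (F n x y).2,
      ((F n x y).1 = x \/ (F n x y).1 = x + L * h n.+1) &
      ((F n x y).2 = y \/ (F n x y).2 = y + W * h n.+1)]}.
  exists (fun n x y => sval (cid (step n x y))) => n x y.
  exact: svalP (cid (step n x y)).
pose s := fix s n := if n is m.+1 then F m (s m).1 (s m).2 else (x0, y0).
have sP n : ~ P n (s n).1 (s n).2.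
  by elim: n => [//|n IH] /=; have [] := HF _ _ _ IH.
have lim (u : nat -> R) K : 0 < K ->
    (forall n, u n.+1 = u n \/ u n.+1 = u n + K * h n.+1) ->
    exists l, forall n, u n <= l <= u n + K * h n.
  move=> K0 Hu.
  have up n : u n <= u n.+1 /\ u n.+1 + K * h n.+1 <= u n + K * h n.
    rewrite (halfS n) mulrDr; have k0 : 0 <= K * h n.+1.
      by rewrite mulr_ge0// ltW// half_gt0.
    by case: (Hu n) => ->; split; lra.
  have mono n m : u n <= u (n + m)%N /\ u (n + m)%N + K * h (n + m) <= u n + K * h n.
    elim: m => [|m [IH1 IH2]]; first by rewrite addn0.
    by rewrite addnS; have [? ?] := up (n + m)%N; split; lra.
  have le n m : u n <= u m + K * h m.
    have hp k : 0 <= K * h k by rewrite mulr_ge0// ltW// half_gt0.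
    have [nm|/ltnW mn] := leqP n m.
      have [] := mono n (m - n)%N; rewrite subnKC// => ? _.
      by have := hp m; lra.
    have [_] := mono m (n - m)%N; rewrite subnKC// => ?.
    by have := hp n; lra.
  have ubu m : ubound (range u) (u m + K * h m) by move=> _ [n _ <-].
  have hs : has_sup (range u).
    by split; [exists (u 0%N); exists 0%N|exists (u 0%N + K * h 0%N); exact: ubu].
  exists (sup (range u)) => n; apply/andP; split.
    by apply: sup_ubound; [exact: hs.2|exists n].
  by apply: ge_sup; [exact: hs.1|exact: ubu].
have [lx Hlx] : exists l, forall n, (s n).1 <= l <= (s n).1 + L * h n.
  by apply: lim => // n; have [_] := HF _ _ _ (sP n).
have [ly Hly] : exists l, forall n, (s n).2 <= l <= (s n).2 + W * h n.
  by apply: lim => // n; have [_ _] := HF _ _ _ (sP n).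
have [] := loc lx ly.
- by have := Hlx 0%N; rewrite expr0 invr1 mulr1.
- by have := Hly 0%N; rewrite expr0 invr1 mulr1.
move=> d /half_small[n nd] /(_ n _ _ (Hlx n) (Hly n) nd).
exact: sP.
Qed.

(** Real differentiability together with the Cauchy-Riemann equations: to first order
    the pair (U, V) is multiplication by d1 + i d2. *)
Definition cr_diff (U V : R -> R -> R) x y : Prop :=
  exists d1 d2 : R, forall e, 0 < e -> exists2 d, 0 < d &
    forall x' y', `|x' - x| < d -> `|y' - y| < d ->
      `|U x' y' - U x y - (d1 * (x' - x) - d2 * (y' - y))|
         <= e * (`|x' - x| + `|y' - y|) /\
      `|V x' y' - V x y - (d2 * (x' - x) + d1 * (y' - y))|
         <= e * (`|x' - x| + `|y' - y|).

Lemma lip_cont (f : R -> R) x K d : 0 < d ->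
  (forall x', `|x' - x| < d -> `|f x' - f x| <= K * `|x' - x|) ->
  {for x, continuous f}.
Proof.
move=> d0 H; apply/cvgrPdist_lt => e e0.
have K1 : 0 < `|K| + 1 by rewrite ltr_wpDl.
have m0 : 0 < Num.min d (e / (`|K| + 1)) by rewrite lt_min d0 divr_gt0.
apply/nbhs_ballP; exists (Num.min d (e / (`|K| + 1))) => // x'.
rewrite /= distrC lt_min => /andP[xd xe].
rewrite distrC; apply: le_lt_trans (H _ xd) _.
apply: (@le_lt_trans _ _ ((`|K| + 1) * `|x' - x|)).
  by apply: ler_wpM2r => //; have := ler_norm K; lra.
by rewrite mulrC -ltr_pdivlMr.
Qed.

Lemma cr_diff_cont U V x y : cr_diff U V x y ->
  [/\ {for y, continuous (U x)}, {for y, continuous (V x)},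
      {for x, continuous (U ^~ y)} & {for x, continuous (V ^~ y)}].
Proof.
move=> [d1 [d2 /(_ 1 ltr01)[d d0 H]]].
have tri (p q r : R) K : `|p - q| <= 1 * r -> `|q| <= K * r -> `|p| <= (1 + K) * r.
  by move=> h1 h2; rewrite -(subrK q p); apply: le_trans (ler_normD _ _) _; lra.
split; [apply: (@lip_cont _ _ (1 + `|d2|) d)|apply: (@lip_cont _ _ (1 + `|d1|) d)
  |apply: (@lip_cont _ _ (1 + `|d1|) d)|apply: (@lip_cont _ _ (1 + `|d2|) d)] => //.
- move=> y' yd; have [|] := H x y' _ yd; first by rewrite subrr normr0.
  rewrite subrr normr0 add0r => /tri + _; apply.
  by rewrite mulr0 sub0r normrN normrM.
- move=> y' yd; have [|_] := H x y' _ yd; first by rewrite subrr normr0.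
  rewrite subrr normr0 add0r => /tri; apply.
  by rewrite mulr0 add0r normrM.
- move=> x' xd; have [|] := H x' y xd; first by rewrite subrr normr0.
  rewrite subrr normr0 addr0 => /tri + _; apply.
  by rewrite mulr0 subr0 normrM.
- move=> x' xd; have [|_] := H x' y xd; first by rewrite subrr normr0.
  rewrite subrr normr0 addr0 => /tri; apply.
  by rewrite mulr0 addr0 normrM.
Qed.

(** The circulation of U dy - V dx along the boundary of a rectangle. *)
Definition bd (U V : R -> R -> R) x y l w : R :=
  (itg (U (x + l)) y (y + w) - itg (U x) y (y + w)) -
  (itg (V ^~ (y + w)) x (x + l) - itg (V ^~ y) x (x + l)).

Definition on_rect (U V : R -> R -> R) x y l w : Prop :=
  forall a b, x <= a <= x + l -> y <= b <= y + w -> cr_diff U V a b.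

Lemma on_rectU U V x y l w a : on_rect U V x y l w -> x <= a <= x + l ->
  icont (U a) y (y + w).
Proof. by move=> H ha t ht; have [] := cr_diff_cont (H a t ha ht). Qed.

Lemma on_rectV U V x y l w b : on_rect U V x y l w -> y <= b <= y + w ->
  icont (V ^~ b) x (x + l).
Proof. by move=> H hb t ht; have [] := cr_diff_cont (H t b ht hb). Qed.

Lemma bd_quarters U V x y l w : 0 < l -> 0 < w ->
  on_rect U V x y (l + l) (w + w) ->
  bd U V x y (l + l) (w + w) =
     bd U V x y l w + bd U V (x + l) y l w + bd U V x (y + w) l w
       + bd U V (x + l) (y + w) l w.
Proof.
move=> l0 w0 H.
have sU a : x <= a <= x + (l + l) ->
    itg (U a) y (y + w + w) = itg (U a) y (y + w) + itg (U a) (y + w) (y + w + w).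
  move=> ha; apply: itg_split; rewrite ?lerDl ?(ltW w0)// -addrA.
  exact: on_rectU H ha.
have sV b : y <= b <= y + (w + w) ->
    itg (V ^~ b) x (x + l + l) =
    itg (V ^~ b) x (x + l) + itg (V ^~ b) (x + l) (x + l + l).
  move=> hb; apply: itg_split; rewrite ?lerDl ?(ltW l0)// -addrA.
  exact: on_rectV H hb.
rewrite /bd !addrA (sU (x + l + l)) ?(sU x) ?(sV (y + w + w)) ?(sV y);
  try by move: l0 w0; clear; lra.
Qed.

(** The constant and linear parts of U and V have no circulation, so that only the
    first order error contributes. *)
Lemma bd_local U V x y x' y' l w d1 d2 e : 0 < e -> 0 < l -> 0 < w ->
  on_rect U V x' y' l w ->
  (forall a b, x' <= a <= x' + l -> y' <= b <= y' + w ->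
    `|U a b - U x y - (d1 * (a - x) - d2 * (b - y))| <= e * (l + w) /\
    `|V a b - V x y - (d2 * (a - x) + d1 * (b - y))| <= e * (l + w)) ->
  `|bd U V x' y' l w| <= 2 * e * (l + w) ^+ 2.
Proof.
move=> e0 l0 w0 H E.
have x'x' : x' <= x' <= x' + l by move: l0; clear; lra.
have x'l : x' <= x' + l <= x' + l by move: l0; clear; lra.
have y'y' : y' <= y' <= y' + w by move: w0; clear; lra.
have y'w : y' <= y' + w <= y' + w by move: w0; clear; lra.
have [_ y'w'] := andP y'y'; have [_ x'l'] := andP x'x'.
have iU a := @on_rectU U V x' y' l w a H.
have iV a := @on_rectV U V x' y' l w a H.
rewrite /bd -!itgB; try by [exact: iU|exact: iV].
have two (p q r s p0 E' : R) : `|p - p0 - r| <= E' -> `|q - p0 - s| <= E' ->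
    `|(p - q) - (r - s)| <= 2 * E'.
  by clear; rewrite !ler_norml; lra.
have B1 : `|itg (fun t => U (x' + l) t - U x' t) y' (y' + w) - d1 * l * (y' + w - y')|
    <= 2 * (e * (l + w)) * (y' + w - y').
  apply: itg_near_cst => //; first by apply: icontB; apply: iU.
  move=> t ht; have [E1 _] := E _ _ x'l ht; have [E2 _] := E _ _ x'x' ht.
  by apply: le_trans (two _ _ _ _ _ _ E1 E2); rewrite le_eqVlt; apply/orP; left;
    apply/eqP; congr `|_|; clear; ring.
have B2 : `|itg (fun t => V t (y' + w) - V t y') x' (x' + l) - d1 * w * (x' + l - x')|
    <= 2 * (e * (l + w)) * (x' + l - x').
  apply: itg_near_cst => //; first by apply: icontB; apply: iV.
  move=> t ht; have [_ E1] := E _ _ ht y'w; have [_ E2] := E _ _ ht y'y'.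
  by apply: le_trans (two _ _ _ _ _ _ E1 E2); rewrite le_eqVlt; apply/orP; left;
    apply/eqP; congr `|_|; clear; ring.
move: B1 B2; rewrite !(addrC _ (- _)) !addKr.
set I1 := itg _ _ _; set I2 := itg _ _ _; clearbody I1 I2.
move: l0 w0 e0; clear; rewrite !ler_norml; nra.
Qed.

(** The partial derivatives need not be continuous: by [bd_local] the circulation is
    quadratically small on small rectangles, and [bisection] carries the bound
    proportional to the area up to the whole rectangle. *)
Lemma goursat (U V : R -> R -> R) x0 y0 L W : 0 < L -> 0 < W ->
  (forall x y, x0 <= x <= x0 + L -> y0 <= y <= y0 + W -> cr_diff U V x y) ->
  itg (U (x0 + L)) y0 (y0 + W) - itg (U x0) y0 (y0 + W) =
  itg (V ^~ (y0 + W)) x0 (x0 + L) - itg (V ^~ y0) x0 (x0 + L).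
Proof.
move=> L0 W0 H; apply/eqP; rewrite -subr_eq0; apply/eqP.
have LW0 : 0 < L + W by rewrite addr_gt0.
have LW : 0 < 2 * (L + W) ^+ 2 by rewrite mulr_gt0// exprn_gt0.
suff bd_small e : 0 < e -> `|bd U V x0 y0 L W| <= 2 * (L + W) ^+ 2 * e.
  apply/eqP; rewrite -normr_eq0; apply/eqP/le_anti; rewrite normr_ge0 andbT.
  apply/ler_addgt0Pl => e e0; rewrite addr0.
  have := bd_small (e / (2 * (L + W) ^+ 2)) (divr_gt0 e0 LW).
  by rewrite mulrC divfK// gt_eqF.
move=> e0.
pose P n x y := x0 <= x -> x + L * h n <= x0 + L -> y0 <= y -> y + W * h n <= y0 + W ->
  `|bd U V x y (L * h n) (W * h n)| <= 2 * (L + W) ^+ 2 * e * (h n) ^+ 2.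
have onr x y l w : x0 <= x -> x + l <= x0 + L -> y0 <= y -> y + w <= y0 + W ->
    on_rect U V x y l w.
  by move=> h1 h2 h3 h4 a b /andP[h5 h6] /andP[h7 h8]; apply: H; apply/andP; split;
    by [exact: le_trans h5|exact: le_trans h2|exact: le_trans h7|exact: le_trans h4].
suff : P 0%N x0 y0 by rewrite /P expr0 invr1 expr1n !mulr1; apply.
apply: (@bisection P x0 y0 L W) => //.
  move=> n x y; rewrite /P [in h n](halfS n).
  have hn0 := half_gt0 n.+1; move: hn0; set hn := h n.+1 => hn0.
  have l0 : 0 < L * hn by rewrite mulr_gt0.
  have w0 : 0 < W * hn by rewrite mulr_gt0.
  have -> : 2 * (L + W) ^+ 2 * e * (hn + hn) ^+ 2 = 4 * (2 * (L + W) ^+ 2 * e * hn ^+ 2).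
    by clear; ring.
  rewrite !mulrDr; move: l0 w0 (2 * _ * _ * _).
  move: (L * hn) (W * hn) => l w l0 w0 K P1 P2 P3 P4 hx hxl hy hyw.
  rewrite bd_quarters//; last exact: onr.
  have {}P1 := P1 hx _ hy _; have {}P2 := P2 _ _ hy _.
  have {}P3 := P3 hx _ _ _; have {}P4 := P4 _ _ _ _.
  have {P1 P2 P3 P4} [P1 P2 P3 P4] : [/\ `|bd U V x y l w| <= K,
      `|bd U V (x + l) y l w| <= K, `|bd U V x (y + w) l w| <= K &
      `|bd U V (x + l) (y + w) l w| <= K].
    by split; [apply: P1|apply: P2|apply: P3|apply: P4];
      move: hx hxl hy hyw l0 w0; clear; lra.
  move: P1 P2 P3 P4; clear.
  move: (bd _ _ _ _ _ _) (bd _ _ _ _ _ _) (bd _ _ _ _ _ _) (bd _ _ _ _ _ _).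
  by move=> b1 b2 b3 b4; rewrite !ler_norml; lra.
move=> x y hx hy; have [d1 [d2 /(_ _ e0)[d d0 Hd]]] := H x y hx hy.
exists (d / (L + W)); first by rewrite divr_gt0.
move=> n x' y' hx' hy' hd hx0 hxL hy0 hyW.
have hn0 := half_gt0 n; move: hd hx' hy' hxL hyW hn0; move: (h n) => hn.
move=> hd hx' hy' hxL hyW hn0; have l0 : 0 < L * hn by rewrite mulr_gt0.
have w0 : 0 < W * hn by rewrite mulr_gt0.
have lwd : L * hn + W * hn < d by rewrite -mulrDl mulrC -ltr_pdivlMr.
have -> : 2 * (L + W) ^+ 2 * e * hn ^+ 2 = 2 * e * (L * hn + W * hn) ^+ 2.
  by clear; ring.
move: (onr x' y' (L * hn) (W * hn) hx0 hxL hy0 hyW) l0 w0 lwd hx' hy'.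
move: (L * hn) (W * hn) => l w H' l0 w0 lwd hx' hy'.
apply: (@bd_local _ _ x y _ _ _ _ d1 d2) => // a b ha hb.
have da : `|a - x| <= l by rewrite ler_norml; move: ha hx'; clear; lra.
have db : `|b - y| <= w by rewrite ler_norml; move: hb hy'; clear; lra.
have leE : e * (`|a - x| + `|b - y|) <= e * (l + w) by rewrite ler_pM2l// lerD.
have [] := Hd a b; [by move: da l0 w0 lwd; clear; lra|by move: db l0 w0 lwd; clear; lra|].
by move=> h1 h2; split; [exact: le_trans h1 leE|exact: le_trans h2 leE].
Qed.

End Goursat.

(** * The mean value property *)

Section MeanValue.
Variable R : realType.
Implicit Types (x y s t u v e d r : R) (a z : R[i]) (g : R[i] -> R[i]).

Lemma derive_eps (f : R -> R) x df : is_derive x 1 f df ->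
  forall e, 0 < e -> exists2 d, 0 < d & forall h, `|h| < d ->
    `|f (x + h) - f x - df * h| <= e * `|h|.
Proof.
move=> [dfx <-] e e0; have /cvgrPdist_lt/(_ e e0) := dfx.
move=> /nbhs_ballP[d /= d0 H]; exists d => // h hd.
have [->|h0] := eqVneq h 0; first by rewrite addr0 subrr mulr0 subr0 normr0 mulr0.
have hd' : ball (0 : R) d h by rewrite -ball_normE /= sub0r normrN.
have := H h hd' h0.
rewrite /GRing.scale /= mulr1 => /ltW hle.
have -> : f (x + h) - f x - 'D_1 f x * h =
  - (('D_1 f x - h^-1 * (f (h + x) - f x)) * h).
  by rewrite (addrC h); field.
by rewrite normrN normrM ler_wpM2r.
Qed.

(** First order expansion of exp at 0, in real and imaginary parts. *)
Lemma polar_linearization e : 0 < e -> exists2 d, 0 < d &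
  forall u v, `|u| < d -> `|v| < d ->
  cmod ((expR u)%:C%C * cis v - 1 - Complex u v) <= e * (`|u| + `|v|).
Proof.
move=> e0; pose e' := Num.min 1 (e / 8).
have e'0 : 0 < e' by rewrite lt_min ltr01 divr_gt0.
have [e'1 e'8] : e' <= 1 /\ e' * 8 <= e.
  split; first by rewrite ge_min lexx.
  by rewrite -ler_pdivlMr// ge_min lexx orbT.
clearbody e'.
have [d1 d10 H1] := derive_eps (is_derive_expR 0) e'0.
have [d2 d20 H2] := derive_eps (is_derive_cos 0) e'0.
have [d3 d30 H3] := derive_eps (is_derive_sin 0) e'0.
exists (Num.min (Num.min d1 e') (Num.min d2 d3)).
  by rewrite !lt_min d10 e'0 d20.
move=> u v; rewrite !lt_min => /andP[/andP[u1 u2] _] /andP[_ /andP[v2 v3]].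
have {H1} := H1 _ u1; have {H2} := H2 _ v2; have {H3} := H3 _ v3.
rewrite !add0r expR0 sin0 cos0 oppr0 mul0r !subr0 !mul1r ?addr0.
set E := expR u; set C := cos v; set S := sin v => HS HC HE.
have C1 : `|C| <= 1 by rewrite ler_norml cos_geN1 cos_le1.
apply: le_trans (cmod_le_ReIm _) _; rewrite /= -/E -/C -/S.
rewrite !mul0r subr0 addr0 oppr0 addr0.
have -> : E * C - 1 - u = (E - 1 - u) * C + (1 + u) * (C - 1) by ring.
have -> : E * S - v = (E - 1) * S + (S - v) by ring.
have h1 : `|(E - 1 - u) * C| <= e' * `|u|.
  by rewrite normrM -[leRHS]mulr1 ler_pM.
have h2 : `|(1 + u) * (C - 1)| <= 2 * (e' * `|v|).
  rewrite normrM ler_pM//; apply: le_trans (ler_normD _ _) _.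
  by rewrite normr1; move: u2 e'1; clear; lra.
have two (x w : R) : `|x - w| <= e' * `|w| -> `|x| <= 2 * `|w|.
  move=> xw; rewrite -(subrK w x); apply: le_trans (ler_normD _ _) _.
  by rewrite mulr_natl mulr2n lerD2r; apply: le_trans xw _; rewrite ler_piMl.
have h3 : `|(E - 1) * S| <= 2 * `|u| * (2 * `|v|).
  by rewrite normrM ler_pM//; exact: two.
have h4 := ler_normD ((E - 1 - u) * C) ((1 + u) * (C - 1)).
have h5 := ler_normD ((E - 1) * S) (S - v).
have := normr_ge0 u; have := normr_ge0 v.
move: h1 h2 h3 h4 h5 HS u2 e'8 e'0; clear.
move: `|u| `|v| `|S - v| `|(E - 1) * S| `|(1 + u) * _| `|(E - 1 - u) * C|.
move: `|_ + _| `|_ + _| => p q nu nv nsv n1 n2 n3 h1 h2 h3 h4 h5 h6 h7 h8 h9 h10 h11.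
have h12 : nu * nv <= e' * nv by rewrite ler_wpM2r// ltW.
have h13 : 8 * e' * (nu + nv) <= e * (nu + nv) by rewrite ler_wpM2r ?addr_ge0// mulrC.
by move: h1 h2 h3 h4 h5 h6 h12 h13 h9 h10 h11; clear; nra.
Qed.

(** In logarithmic polar coordinates z = a + exp (s + i t) a holomorphic function stays
    holomorphic, while circles around a become sides of rectangles. *)
Lemma cr_diff_polar g a s t :
  derivable g (a + (expR s)%:C%C * cis t) 1 ->
  cr_diff (fun s t => complex.Re (g (a + (expR s)%:C%C * cis t)))
          (fun s t => complex.Im (g (a + (expR s)%:C%C * cis t))) s t.
Proof.
pose ga0 := (expR s)%:C%C * cis t; rewrite -/ga0.
pose z0 := a + ga0; move=> /derivableCP[phi cphi E].
pose D := phi z0 * ga0.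
exists (complex.Re D), (complex.Im D) => e e0.
pose K := cmod ga0; pose K' := cmod (phi z0).
have K0 : 0 <= K := cmod_ge0 _; have K'0 : 0 <= K' := cmod_ge0 _.
pose e1 := e / (2 * (2 * K + 1)); have e10 : 0 < e1.
  by rewrite divr_gt0// mulr_gt0// ltr_wpDl// mulr_ge0.
pose e2 := Num.min 1 (e / (2 * (K' * K + 1))); have e20 : 0 < e2.
  by rewrite lt_min ltr01 divr_gt0// mulr_gt0// ltr_wpDl// mulr_ge0.
have e21 : e2 <= 1 by rewrite ge_min lexx.
have h3 : e1 * (2 * K + 1) * 2 <= e.
  by rewrite /e1 invfM mulrA [e / 2 / _ * _]divfK ?gt_eqF// ?divfK// ltr_wpDl// mulr_ge0.
have h4 : e2 * (K' * K + 1) * 2 <= e.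
  have c0 : 0 < K' * K + 1 by rewrite ltr_wpDl// mulr_ge0.
  have : e2 <= e / (2 * (K' * K + 1)) by rewrite ge_min lexx orbT.
  rewrite ler_pdivlMr ?mulr_gt0//; by rewrite [2 * _]mulrC mulrA.
clearbody e1 e2.
have [d1 d10 H1] := cphi _ e10.
have [d2 d20 H2] := polar_linearization e20.
pose d := Num.min d2 (d1 / (4 * K + 1)).
exists d; first by rewrite lt_min d20 divr_gt0// ltr_wpDl// mulr_ge0.
move=> s' t'; rewrite !lt_min => /andP[s2 s1] /andP[t2 t1].
pose u := s' - s; pose v := t' - t; rewrite -/u -/v in s1 s2 t1 t2 *.
pose W := (expR u)%:C%C * cis v.
have gaE : (expR s')%:C%C * cis t' = ga0 * W.
  rewrite /ga0 /W mulrACA -rmorphM -expRD -cisD /u /v.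
  by rewrite (addrC s) (addrC t) !subrK.
have HW := H2 _ _ s2 t2; rewrite -/W in HW.
have n0 : 0 <= `|u| + `|v| by rewrite addr_ge0.
have W1 : cmod (W - 1) <= 2 * (`|u| + `|v|).
  rewrite -(subrK (Complex u v) (W - 1)); apply: le_trans (cmodD _ _) _.
  have h1 := cmod_le_ReIm (Complex u v).
  have h2 : e2 * (`|u| + `|v|) <= `|u| + `|v| by rewrite ler_piMl.
  by move: HW h1 h2 => /=; clear; lra.
set z' := a + _ * cis t'; have zE : z' - z0 = ga0 * (W - 1).
  by rewrite /z' /z0 gaE; clear; ring.
have zd : cmod (z' - z0) < d1.
  rewrite zE cmodM -/K; apply: le_lt_trans (ler_wpM2l K0 W1) _.
  have c0 : 0 < 4 * K + 1 by rewrite ltr_wpDl// mulr_ge0.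
  move: s1 t1; rewrite !ltr_pdivlMr//.
  by move: (normr_ge0 u) (normr_ge0 v); clear; lra.
have main : cmod (g z' - g z0 - D * Complex u v) <= e * (`|u| + `|v|).
  have -> : g z' - g z0 - D * Complex u v =
    (phi z' - phi z0) * (ga0 * (W - 1)) + D * (W - 1 - Complex u v).
    by rewrite (E z') zE /D; clear; ring.
  apply: le_trans (cmodD _ _) _.
  rewrite (cmodM (phi z' - phi z0)) (cmodM ga0) (cmodM D) [cmod D]cmodM -/K -/K'.
  have h1 : cmod (phi z' - phi z0) * (K * cmod (W - 1)) <= e1 * (K * (2 * (`|u| + `|v|))).
    apply: ler_pM; rewrite ?cmod_ge0 ?mulr_ge0 ?cmod_ge0//.
      by apply: ltW; exact: H1.
    by rewrite ler_wpM2l.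
  have h2 : K' * K * cmod (W - 1 - Complex u v) <= K' * K * (e2 * (`|u| + `|v|)).
    by rewrite ler_wpM2l// mulr_ge0.
  have h5 := mulr_ge0 K'0 K0.
  move: h1 h2 h3 h4 h5 n0 K0 e10 e20; clear; move: (`|u| + `|v| : R) (K' * K) => n L.
  move: (cmod (phi z' - _) * _) (L * cmod _) => p q h1 h2 h3 h4 h5 n0 K0 e10 e20.
  have h6 := ler_wpM2r n0 h3; have h7 := ler_wpM2r n0 h4.
  have h8 := mulr_ge0 (ltW e10) n0; have h9 := mulr_ge0 (ltW e20) n0.
  by move: h1 h2 h6 h7 h8 h9; clear; lra.
have ReDuv : complex.Re (D * Complex u v) = complex.Re D * u - complex.Im D * v.
  by rewrite cReM.
have ImDuv : complex.Im (D * Complex u v) = complex.Im D * u + complex.Re D * v.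
  by rewrite cImM addrC.
split.
  by rewrite -ReDuv -!cReN -!cReD; apply: le_trans (Re_le_cmod _) main.
by rewrite -ImDuv -!cImN -!cImD; apply: le_trans (Im_le_cmod _) main.
Qed.

(** By [goursat] in logarithmic polar coordinates the mean over a circle does not depend
    on its radius, the other two sides of the rectangle cancelling by periodicity; as the
    radius tends to 0 the mean tends to the value at a.  The puncture at a is harmless
    because it lies at s = - oo. *)
Lemma mean_value g a d r : ccont g a ->
  (forall z, 0 < cmod (z - a) < d -> derivable g z 1) -> 0 < r < d ->
  itg (fun t => complex.Re (g (a + r%:C%C * cis t))) 0 (2 * pi) =
  complex.Re (g a) * (2 * pi).
Proof.
move=> ca dg /andP[r0 rd].
pose U s t := complex.Re (g (a + (expR s)%:C%C * cis t)).
pose V s t := complex.Im (g (a + (expR s)%:C%C * cis t)).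
have pi0 : 0 < 2 * pi :> R by rewrite mulr_gt0// pi_gt0.
have cmE s t : cmod (a + (expR s)%:C%C * cis t - a) = expR s.
  by rewrite addrC addKr cmodM cmodC cmod_cis mulr1 ger0_norm ?expR_ge0.
have crUV s t : s <= ln r -> cr_diff U V s t.
  move=> sr; apply: cr_diff_polar; apply: dg; rewrite cmE expR_gt0 /=.
  by apply: le_lt_trans rd; rewrite -[leRHS]lnK// ler_expR.
have indep s : s < ln r -> itg (U (ln r)) 0 (2 * pi) = itg (U s) 0 (2 * pi).
  move=> sr; have L0 : 0 < ln r - s by rewrite subr_gt0.
  have := @goursat _ U V s 0 (ln r - s) (2 * pi) L0 pi0.
  rewrite !(addrC s) !subrK !add0r => E; apply/eqP; rewrite -subr_eq0 E.
    rewrite subr_eq0; apply/eqP/eq_itg => x _.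
    by rewrite /V -[2 * pi]add0r cisD2pi.
  by move=> x y /andP[_ ?] _; exact: crUV.
rewrite -[r]lnK// -/(U (ln r)); apply/eqP; rewrite -subr_eq0 -normr_eq0.
apply/eqP/le_anti; rewrite normr_ge0 andbT; apply/ler_addgt0Pl => e e0; rewrite addr0.
have e'0 : 0 < e / (2 * pi) by rewrite divr_gt0.
have [d' d'0 H] := ca _ e'0.
(* a radius exp s smaller than r at which g is within e / (2 pi) of g a *)
pose s := Num.min (ln r - 1) (ln (d' / 2)).
have sr : s < ln r by rewrite gt_min; apply/orP; left; rewrite ltrBlDr ltrDl.
rewrite (indep s sr).
have sd : expR s < d'.
  apply: (@le_lt_trans _ _ (d' / 2)); last by rewrite ltr_pdivrMr// mulr_natr mulr2n ltrDl.
  by rewrite -[leRHS]lnK ?posrE ?divr_gt0// ler_expR ge_min lexx orbT.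
have := @itg_near_cst R (U s) (complex.Re (g a)) (e / (2 * pi)) 0 (2 * pi) (ltW pi0).
rewrite subr0 divfK ?gt_eqF//; apply.
  by move=> t _; have [] := cr_diff_cont (crUV s t (ltW sr)).
move=> t _; rewrite /U -cReN -cReD; apply: le_trans (Re_le_cmod _) _.
by apply: ltW; apply: H; rewrite cmE.
Qed.

End MeanValue.

(** * The maximum principle *)

Section MaximumPrinciple.
Variable R : realType.
Implicit Types (x y s t u v e d r M : R) (a z : R[i]) (g : R[i] -> R[i]).

Lemma continuous_on_circle (f : R[i] -> R) r t : {for r%:C%C * cis t, continuous f} ->
  {for t, continuous (fun t => f (r%:C%C * cis t))}.
Proof.
move=> cf; apply: (@continuous_comp _ _ _ (fun t => r%:C%C * cis t) f) => //.
apply: (@cvgCM _ _ (nbhs t) _ (fun=> r%:C%C) (@cis R)); first exact: cvgC_cst.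
exact: continuous_cis.
Qed.

(** Polar coordinates map a compact rectangle onto the disc. *)
Lemma disc_max (f : R[i] -> R) r : 0 <= r ->
  (forall z, cmod z <= r -> {for z, continuous f}) ->
  exists2 a, cmod a <= r & forall z, cmod z <= r -> f z <= f a.
Proof.
move=> r0 cf; pose A : set (R * R) := `[0, r] `*` `[0, 2 * pi].
pose pol (p : R * R) : R[i] := p.1%:C%C * cis p.2.
have polr p : A p -> cmod (pol p) <= r.
  by move=> [/= + _]; rewrite in_itv /= => /andP[p0 pr]; rewrite cmodM cmodC cmod_cis mulr1 ger0_norm.
have cA : compact A by apply: compact_setX; exact: segment_compact.
have cpol p : {for p, continuous pol}.
  apply: (@cvgCM _ _ (nbhs p) _ (fun p => p.1%:C%C) (fun p => cis p.2)).
    apply: (@cvg_Complex _ _ (nbhs p) _ (fun p => p.1) (fun=> 0)); first exact: cvg_fst.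
    exact: cvg_cst.
  apply: (@continuous_comp _ _ _ (fun p : R * R => p.2) (@cis R)); first exact: cvg_snd.
  exact: continuous_cis.
have [||p pA pmax] := @compact_EVT_max _ R (f \o pol) A _ cA.
- exists (0, 0); split; rewrite /= in_itv /= lexx//.
  by rewrite mulr_ge0// pi_ge0.
- apply: continuous_in_subspaceT => p; rewrite inE => pA.
  by apply: (@continuous_comp _ _ _ pol f); [exact: cpol|exact: cf (polr _ pA)].
exists (pol p) => [|z zr]; first by apply: polr; move: pA; rewrite inE.
have [t t01 ->] := polar_form z.
by apply: (pmax (cmod z, t)); rewrite inE; split; rewrite /= in_itv /= ?cmod_ge0.
Qed.

Lemma cont_Re g a : ccont g a -> {for a, continuous (fun z => complex.Re (g z))}.
Proof. by move=> /ccontE cg; exact: (@cvg_Re _ _ (nbhs a) _ g _ cg). Qed.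

Lemma cont_cmod g a : ccont g a -> {for a, continuous (fun z => cmod (g z))}.
Proof. by move=> /ccontE cg; exact: (@cvg_cmod _ _ (nbhs a) _ g _ cg). Qed.

Lemma sqr_cmod z : cmod z ^+ 2 = complex.Re z ^+ 2 + complex.Im z ^+ 2.
Proof. by rewrite cmodE sqr_sqrtr// addr_ge0 ?sqr_ge0. Qed.

(** At an interior maximum a of Re h + c |z|^2 the function h + 2 c conj(a) z would violate
    the mean value property; the quadratic term makes the contradiction strict. *)
Lemma no_interior_max (h : R[i] -> R[i]) c a d : 0 < c -> 0 < d -> holo h a ->
  (forall z, cmod (z - a) < d ->
    complex.Re (h z) + c * cmod z ^+ 2 <= complex.Re (h a) + c * cmod a ^+ 2) ->
  False.
Proof.
move=> c0 d0 [ca /dnbhsCP[d1 d10 dh]] hmax.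
pose w : R[i] := (2 * c)%:C%C * a^*%C; pose k z := h z + w * z.
pose r := Num.min d d1 / 2.
have m0 : 0 < Num.min d d1 by rewrite lt_min d0.
have r0 : 0 < r by rewrite divr_gt0.
have rm : r < Num.min d d1 by rewrite ltr_pdivrMr// mulr_natr mulr2n ltrDl.
have [rd rd1] : r < d /\ r < d1 by apply/andP; rewrite -lt_min.
have pi0 : 0 < 2 * pi :> R by rewrite mulr_gt0// pi_gt0.
have dl z : derivable (fun z : R[i] => w * z) z 1.
  have := @derivableCM _ (fun=> w) (fun z => z) z (@derivableC_cst R w z) (@derivableC_id R z).
  by [].
have ck : ccont k a.
  exact: (ccontD ca (derivableC_continuous (dl a))).
have dk z : 0 < cmod (z - a) < d1 -> derivable k z 1.
  by move=> /dh dhz; exact: (derivableCD dhz (dl z)).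
have MV := @mean_value R k a d1 r ck dk (introT andP (conj r0 rd1)).
have ReK z : complex.Re (k z) = complex.Re (h z) + c * cmod z ^+ 2
     + c * cmod a ^+ 2 - c * cmod (z - a) ^+ 2.
  rewrite /k /w !cReD !cReM !cImM !sqr_cmod !cReD !cImD.
  rewrite /=; have -> : complex.Re (a^*%C) = complex.Re a by case: (a).
  have -> : complex.Im (a^*%C) = - complex.Im a by case: (a).
  by rewrite !cReN !cImN; ring.
pose K := complex.Re (k a) - c * r ^+ 2.
have : itg (fun t => complex.Re (k (a + r%:C%C * cis t))) 0 (2 * pi) <= K * (2 * pi).
  rewrite -[X in K * X]subr0 -itg_cst ?(ltW pi0)//; apply: le_itg.
  - move=> t _; apply: (@continuous_on_circle (fun b => complex.Re (k (a + b)))).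
    apply: cont_Re; apply: (@ccont_comp _ k (fun b => a + b)).
      exact: (ccontD (ccont_cst a _) (ccont_id _)).
    apply: derivableC_continuous; apply: dk.
    by rewrite addrC addKr cmodM cmodC cmod_cis mulr1 gtr0_norm// r0.
  - exact: icont_cst.
  - move=> t _; rewrite /K !ReK subrr cmod0.
    have -> : cmod (a + r%:C%C * cis t - a) = r.
      by rewrite addrC addKr cmodM cmodC cmod_cis mulr1 gtr0_norm.
    have := hmax (a + r%:C%C * cis t); rewrite addrC addKr cmodM cmodC cmod_cis mulr1 gtr0_norm//.
    by move=> /(_ rd); rewrite addrC; clear; lra.
rewrite MV ler_pM2r// /K lerBrDl gerDr leNgt mulr_gt0// exprn_gt0//.
Qed.

(** A value larger than M inside the disc survives, after a rotation that makes it
    positive real, the addition of a small multiple of |z|^2, and then yields an interior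
    maximum excluded by [no_interior_max]. *)
Lemma maximum_principle g r M : 0 < r ->
  (forall z, cmod z <= r -> holo g z) ->
  (forall t, 0 <= t <= 2 * pi -> cmod (g (r%:C%C * cis t)) <= M) ->
  forall z, cmod z <= r -> cmod (g z) <= M.
Proof.
move=> r0 hg bd z0 z0r; rewrite leNgt; apply/negP => Mz0.
pose l := (g z0)^*%C / (cmod (g z0))%:C%C.
have M0 : 0 <= M.
  by apply: le_trans (bd 0 _); rewrite ?cmod_ge0// lexx mulr_ge0// pi_ge0.
have gz0 : 0 < cmod (g z0) by apply: le_lt_trans Mz0.
pose h z := l * g z.
have l1 : cmod l = 1.
  by rewrite /l cmodM cmodV cmodC cmod_conj ger0_norm ?(ltW gz0)// divff// gt_eqF.
have hz0 : complex.Re (h z0) = cmod (g z0).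
  suff -> : h z0 = (cmod (g z0))%:C%C by [].
  rewrite /h /l mulrAC [_^*%C * _]mulrC -sqr_normc normCE expr2 mulfK//.
  by rewrite (inj_eq (@complexI R)) gt_eqF.
have hh z : cmod z <= r -> holo h z.
  by move=> /hg hgz; apply: (holoM (holo_cst l z) hgz).
(* c r^2 is half the gap |g z0| - M: the boundary values of v stay below v z0 *)
pose c := (cmod (g z0) - M) / (2 * r ^+ 2).
have c0 : 0 < c by rewrite divr_gt0 ?subr_gt0// mulr_gt0// exprn_gt0.
have cr : c * r ^+ 2 < cmod (g z0) - M.
  have -> : c * r ^+ 2 = (cmod (g z0) - M) / 2 by rewrite /c; field; rewrite gt_eqF.
  by rewrite ltr_pdivrMr// mulr_natr mulr2n ltrDl subr_gt0.
pose v z := complex.Re (h z) + c * cmod z ^+ 2.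
have [|z zr|a ar amax] := @disc_max v r; first exact: ltW.
  have c1 : {for z, continuous (fun z => complex.Re (h z))} := cont_Re (hh z zr).1.
  have c2 : {for z, continuous (fun z : R[i] => cmod z)} := @cont_cmod id z (@ccont_id R z).
  have c3 : {for z, continuous (fun z : R[i] => c * (cmod z * cmod z))}.
    exact: (cvgM (cvg_cst _) (cvgM c2 c2)).
  exact: (cvgD c1 c3).
have ar' : cmod a < r.
  rewrite lt_neqAle ar andbT; apply/eqP => aE.
  have := amax _ z0r; rewrite /v hz0 aE leNgt => /negP; apply.
  have [t t01 tE] := polar_form a.
  have h1 : complex.Re (h a) <= M.
    apply: le_trans (ler_norm _) _; apply: le_trans (Re_le_cmod _) _.
    by rewrite /h cmodM l1 mul1r tE aE; exact: bd.
  have h2 : 0 <= c * cmod z0 ^+ 2 by rewrite mulr_ge0 ?(ltW c0)// exprn_ge0// cmod_ge0.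
  by move: h1 h2 cr; clear; lra.
apply: (@no_interior_max h c a (r - cmod a)) => //.
- by rewrite subr_gt0.
- exact: hh.
move=> z; rewrite ltrBrDr => zd; apply: amax; apply: ltW; apply: le_lt_trans zd.
by rewrite -{1}(subrK a z); exact: cmodD.
Qed.

End MaximumPrinciple.

(** * Subharmonicity of ln |g| *)

Section SubMean.
Variable R : realType.
Implicit Types (x y s t u v e d r M : R) (a z : R[i]) (g : R[i] -> R[i]).

Lemma uniform_continuity (f : R -> R) (a b : R) e : icont f a b -> 0 < e ->
  exists2 d, 0 < d & forall x y, a <= x <= b -> `|y - x| < d -> `|f y - f x| < e.
Proof.
move=> cf e0; have e2 : 0 < e / 2 by rewrite divr_gt0.
have := @segment_compact R a b; rewrite compact_near_coveringP.
move=> /(_ nat \oo (fun n x => forall y, `|y - x| < n.+1%:R^-1 -> `|f y - f x| < e)).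
case=> [x|N _ HN].
  rewrite /= in_itv /= => xab.
  have /cvgrPdist_lt/(_ _ e2)/nbhs_ballP[d /= d0 Hd] := cf x xab.
  have d2 : 0 < d / 2 by rewrite divr_gt0.
  exists (ball x (d / 2), [set n | n.+1%:R^-1 < d / 2]).
    by split; [exact: nbhsx_ballx|exact: (near_infty_natSinv_lt (PosNum d2))].
  move=> [x' n] [/=]; rewrite -ball_normE /= => xx' nd y yx'.
  have Hd' (z : R) : `|x - z| < d -> `|f x - f z| < e / 2.
    by move=> xz; apply: Hd; rewrite -ball_normE.
  have h1 := Hd' x' ltac:(by apply: lt_trans xx' _; move: d0; clear; lra).
  have h2 := Hd' y.
  have : `|x - y| < d.
    rewrite -(subrK x' (x - y)) (_ : x - y - x' + x' = (x - x') + (x' - y)); last by ring.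
    apply: le_lt_trans (ler_normD _ _) _; rewrite [`|x' - y|]distrC.
    by move: xx' (lt_trans yx' nd); clear; lra.
  move=> /h2 {}h2; rewrite -(subrK (f x) (f y - f x')).
  rewrite (_ : f y - f x' - f x + f x = - (f x - f y) + (f x - f x')); last by ring.
  apply: le_lt_trans (ler_normD _ _) _; rewrite normrN.
  by move: h1 h2; clear; lra.
exists N.+1%:R^-1; first by rewrite invr_gt0.
by move=> x y xab yx; apply: (HN N (leqnn N) x) => //=; rewrite in_itv.
Qed.

Lemma itg_chain (f : R -> R) (w : R) n : 0 <= w -> icont f 0 (n%:R * w) ->
  itg f 0 (n%:R * w) = \sum_(k < n) itg f (k%:R * w) (k.+1%:R * w).
Proof.
move=> w0; elim: n => [|n IH] cf.
  by rewrite big_ord0 mul0r /itg set_itv1 Rintegral_set1.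
have nw : n%:R * w <= n.+1%:R * w by rewrite ler_wpM2r// ler_nat.
rewrite big_ord_recr /= -IH; last by apply: icontS cf.
by apply: itg_split => //; rewrite mulr_ge0.
Qed.

Lemma rotate_holo g (b z : R[i]) : b != 0 -> holo g (b * z) -> holo (fun z => g (b * z)) z.
Proof.
move=> b0; have db (y : R[i]) : derivable (fun z : R[i] => b * z) y 1.
  have := @derivableCM _ (fun=> b) (fun z => z) y (@derivableC_cst R b y) (@derivableC_id R y).
  by [].
apply: (@holo_comp _ g (fun z => b * z)) => //; last by apply/dnbhsCP; exists 1.
apply/dnbhsCP; exists 1 => // y /andP[yz _].
by rewrite (inj_eq (mulfI b0)) -subr_eq0 -cmod_gt0.
Qed.

(** The maximum principle is applied to the product G of N rotated copies of g: on the
    circle ln |G| is a Riemann sum for N times the mean of ln |g|, while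
    ln |G 0| = N ln |g 0|.  The truncation at e keeps the integrand continuous at the
    zeros of g on the circle. *)
Lemma sub_mean g e : (forall z, cmod z <= 1 -> holo g z) -> 0 < e ->
  ln (Num.max (cmod (g 0)) e) * (2 * pi) <=
  itg (fun t => ln (Num.max (cmod (g (cis t))) e)) 0 (2 * pi).
Proof.
move=> hg e0; set u := fun t => ln _.
have pi0 : 0 < 2 * pi :> R by rewrite mulr_gt0// pi_gt0.
have me z : 0 < Num.max (cmod (g z)) e by rewrite lt_max e0 orbT.
have ue t : ln e <= u t by rewrite ler_ln ?posrE// le_max lexx orbT.
have cu t : {for t, continuous u}.
  have c1 : {for t, continuous (fun t => cmod (g (cis t)))}.
    have -> : (fun t => cmod (g (cis t))) = (fun t => cmod (g (1%:C%C * cis t))).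
      by apply/funext => x; congr (cmod (g _)); exact/esym/mul1r.
    apply: (@continuous_on_circle R (fun z => cmod (g z)) 1 t); apply: cont_cmod.
    by have [|//] := hg (1%:C%C * cis t); rewrite cmodM cmodC normr1 cmod_cis mulr1.
  have c2 : {for t, continuous (fun t => Num.max (cmod (g (cis t))) e)}.
    by apply: (@continuous_max R _ (fun t => cmod (g (cis t))) (fun=> e)) => //; exact: cvg_cst.
  apply: (@continuous_comp _ _ _ (fun t => Num.max (cmod (g (cis t))) e) (@ln R)) => //.
  exact: continuous_ln.
have icu (a b : R) : icont u a b by move=> t _; exact: cu.
set I := itg _ _ _.
have [ge|eg] := leP (cmod (g 0)) e.
  rewrite -[X in _ * X]subr0 -itg_cst ?(ltW pi0)//.
  by apply: le_itg => //; exact: icont_cst.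
apply/ler_addgt0Pl => eta eta0.
have eta'0 : 0 < eta / (2 * pi) by rewrite divr_gt0.
have [d d0 Hd] := uniform_continuity (icu 0 (2 * pi)) eta'0.
(* N rotations by the angle w, which is below the modulus of continuity d of u *)
pose N := (Num.bound (2 * pi / d)).+1.
pose w := 2 * pi / N%:R :> R.
have N0 : 0 < N%:R :> R by rewrite ltr0n.
have w0 : 0 < w by rewrite divr_gt0.
have Nw : N%:R * w = 2 * pi by rewrite /w mulrC divfK// gt_eqF.
have wd : w < d.
  rewrite /w ltr_pdivrMr// [d * _]mulrC -ltr_pdivrMr//.
  have := archi_boundP (ltW (divr_gt0 pi0 d0) : 0 <= 2 * pi / d).
  by move=> /lt_trans; apply; rewrite ltr_nat.
pose G z := \prod_(k < N) g (cis (k%:R * w) * z).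
have hG z : cmod z <= 1 -> holo G z.
  move=> z1; apply: (@holo_prod R 'I_N _ (fun k z => g (cis (k%:R * w) * z))) => k.
  apply: rotate_holo; first exact: cis_neq0.
  by apply: hg; rewrite cmodM cmod_cis mul1r.
have Gw z : G (cis w * z) = G z.
  rewrite /G; case: (N) Nw => [|n] Nw; first by rewrite !big_ord0.
  rewrite big_ord_recr big_ord_recl /= mulrC; congr (_ * _).
    rewrite mulrA -cisD mul0r cis0 (_ : n%:R * w + w = 2 * pi) ?cis2pi//.
    by rewrite -Nw -natr1; ring.
  by apply: eq_bigr => k _; rewrite mulrA -cisD /bump /= add1n -natr1 mulrDl mul1r.
have Gj j z : G (cis (j%:R * w) * z) = G z.
  elim: j z => [|j IH] z; first by rewrite mul0r cis0 mul1r.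
  by rewrite -natr1 mulrDl mul1r cisD -mulrA IH Gw.
pose M := expR ((I + eta) / w).
have bd0 t : 0 <= t <= w -> cmod (G (cis t)) <= M.
  move=> /andP[t0 tw]; rewrite cmod_prod.
  apply: (@le_trans _ _ (expR (\sum_(k < N) u (k%:R * w + t)))).
    rewrite expR_sum; apply: ler_prod => k _; rewrite cmod_ge0 /= -cisD.
    by rewrite /u lnK ?posrE// le_max lexx.
  rewrite ler_expR ler_pdivlMr// mulr_suml.
  apply: (@le_trans _ _ (\sum_(k < N) itg (fun t => u t + eta / (2 * pi)) (k%:R * w) (k.+1%:R * w))).
    apply: ler_sum => k _.
    have kw : k.+1%:R * w - k%:R * w = w by rewrite -natr1; ring.
    have kw' : k%:R * w <= k.+1%:R * w by rewrite -subr_ge0 kw ltW.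
    rewrite -[X in _ * X <= _]kw -itg_cst//; apply: le_itg; first exact: icont_cst.
      by apply: icontD => //; exact: icont_cst.
    move=> y /andP[yk yk1].
    have yI : 0 <= y <= 2 * pi.
      apply/andP; split; first by apply: le_trans yk; rewrite mulr_ge0// ltW.
      by rewrite -Nw; apply: le_trans yk1 _; rewrite ler_pM2r// ler_nat.
    have := Hd y (k%:R * w + t) yI.
    have -> : `|k%:R * w + t - y| < d.
      apply: le_lt_trans wd; rewrite ler_norml.
      by move: t0 tw yk yk1; rewrite -natr1 mulrDl mul1r; clear; lra.
    by move=> /(_ isT)/ltW; rewrite ler_norml lerBlDl => /andP[].
  have cD : icont (fun t => u t + eta / (2 * pi)) 0 (N%:R * w).
    by apply: icontD => //; exact: icont_cst.
  rewrite -itg_chain ?(ltW w0)//.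
  rewrite Nw itgD ?itg_cst ?(ltW pi0)//; last exact: icont_cst.
  by rewrite subr0 divfK// gt_eqF.
have bd t : 0 <= t <= 2 * pi -> cmod (G (1%:C%C * cis t)) <= M.
  rewrite mul1r => /andP[t0 _].
  have /truncn_itv/andP[jt tj] : 0 <= t / w by rewrite divr_ge0// ltW.
  rewrite -(subrKC ((Num.truncn (t / w))%:R * w) t) cisD Gj; apply: bd0.
  rewrite subr_ge0 -ler_pdivlMr// jt /= lerBlDr.
  by move: tj; rewrite ltr_pdivrMr// -natr1 mulrDl mul1r addrC => /ltW.
have := @maximum_principle R G 1 M ltr01 hG bd 0.
rewrite cmod0 ler01 => /(_ isT).
have -> : cmod (G 0) = cmod (g 0) ^+ N.
  rewrite cmod_prod -[N in RHS]card_ord -prodr_const; apply: eq_bigr => k _.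
  by rewrite mulr0.
have g0 : 0 < cmod (g 0) by apply: lt_trans eg.
rewrite -ler_ln ?posrE ?exprn_gt0 ?expR_gt0// lnXn// expRK.
by rewrite ler_pdivlMr// -[_ *+ N]mulr_natr -mulrA Nw addrC.
Qed.

End SubMean.

(** * Disc automorphisms on the circle *)

Section Substitution.
Variable R : realType.
Implicit Types (a b c t x y d e : R) (u : R -> R).

Lemma is_derive_inv u x d : u x != 0 -> is_derive x 1 u d ->
  is_derive x 1 (fun y => (u y)^-1) (- (u x) ^- 2 * d).
Proof.
move=> ux [du <-]; apply: DeriveDef; first exact: derivableV.
by rewrite deriveV.
Qed.

Lemma is_derive_continuous u x d : is_derive x 1 u d -> {for x, continuous u}.
Proof. by move=> [du _]; apply: differentiable_continuous; exact/derivable1_diffP. Qed.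

Lemma itg_subst u (F F' : R -> R) a b : a < b -> continuous u -> continuous F' ->
  (forall x, is_derive x 1 F (F' x)) -> (forall x, 0 < F' x) ->
  itg u (F a) (F b) = itg (fun x => u (F x) * F' x) a b.
Proof.
move=> ab cu cF' dF F'0.
have cF : continuous F by move=> x; exact: is_derive_continuous (dF x).
have F'E : derive1 F = F' by apply/funext => x; rewrite derive1E; exact: derive_val.
rewrite /itg /Rintegral (@integration_by_substitution_increasing _ F u a b (ltW ab)).
- by rewrite F'E.
- apply: gtr0_derive1_lt; last exact: continuous_subspaceT.
    by move=> x _; have [] := dF x.
  by move=> x _; rewrite F'E.
- by rewrite F'E => x _; exact: cF'.
- by rewrite F'E; apply/cvg_ex; exists (F' a); apply: cvg_at_right_filter; exact: cF'.
- by rewrite F'E; apply/cvg_ex; exists (F' b); apply: cvg_at_left_filter; exact: cF'.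
- split.
  + by move=> x _; have [] := dF x.
  + by apply: cvg_at_right_filter; exact: cF.
  + by apply: cvg_at_left_filter; exact: cF.
- exact: continuous_subspaceT.
Qed.

Lemma continuous_icont u a b : continuous u -> icont u a b.
Proof. by move=> cu t _; exact: cu. Qed.

Lemma itg_shift_period u c : continuous u -> (forall x, u (x + 2 * pi) = u x) ->
  0 <= c <= 2 * pi -> itg u c (c + 2 * pi) = itg u 0 (2 * pi).
Proof.
move=> cu pu /andP[c0 c2]; have pi0 : 0 < 2 * pi :> R by rewrite mulr_gt0// pi_gt0.
rewrite (@itg_split _ u c (2 * pi)) ?lerDr//; last exact: continuous_icont.
rewrite (@itg_split _ u 0 c (2 * pi))//; last exact: continuous_icont.
rewrite addrC; congr (_ + _).
move: c0; rewrite le_eqVlt => /predU1P[<-|c0]; first by rewrite add0r /itg !set_itv1 !Rintegral_set1.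
have c1 : continuous (fun _ : R => 1 : R) by move=> x; exact: cvg_cst.
have d1 x : is_derive x 1 (fun x : R => x + 2 * pi) ((fun _ : R => 1 : R) x).
  have := @is_deriveD _ _ _ id _ x 1 _ _ (is_derive_id x 1) (is_derive_cst (2 * pi) x 1).
  by rewrite addr0.
have := itg_subst c0 cu c1 d1 (fun=> ltr01).
by rewrite add0r => ->; apply: eq_itg => x _; rewrite mulr1.
Qed.

End Substitution.

Section Mobius.
Variable R : realType.
Implicit Types (t s x y d e r : R) (a z w c : R[i]) (u : R -> R).

(** The automorphism of the unit disc that sends 0 to t. *)
Definition mobius t z : R[i] := (z + t%:C%C) / (1 + t%:C%C * z).

(** A continuous determination of the argument of [mobius t (cis x)]. *)
Definition mobius_arg t x : R := x - 2 * atan (t * sin x / (1 + t * cos x)).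

(** The Poisson kernel at - t, which is the derivative of [mobius_arg t]. *)
Definition poisson t x : R := (1 - t ^+ 2) / (1 + 2 * t * cos x + t ^+ 2).

Lemma cos_bounds x : -1 <= cos x <= 1.
Proof. by rewrite cos_geN1 cos_le1. Qed.

Lemma tcos_gt0 t x : 0 <= t <= 2^-1 -> 0 < 1 + t * cos x.
Proof.
move=> /andP[t0 t1]; have /andP[c1 _] := cos_bounds x.
have : t * -1 <= t * cos x by rewrite ler_wpM2l.
by move: t1; clear; lra.
Qed.

Lemma mobius_cis t x : 0 <= t <= 2^-1 -> mobius t (cis x) = cis (mobius_arg t x).
Proof.
move=> t01; have p0 := tcos_gt0 x t01.
rewrite /mobius /mobius_arg; set p := 1 + t * cos x in p0 *; set q := t * sin x.
set al := atan (q / p).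
have c0 : 0 < cos al by apply: cos_gt0_pihalf; rewrite atan_gtNpi2 atan_ltpi2.
have q1 : p / cos al * cos al = p by rewrite divfK// gt_eqF.
have q2 : p / cos al * sin al = q.
  have tE : sin al / cos al = q / p by rewrite -/(tan al) atanK.
  by rewrite mulrAC -mulrA tE mulrC divfK// gt_eqF.
have qE : 1 + t%:C%C * cis x = (p / cos al)%:C%C * cis al.
  apply: eqC_ReIm; rewrite ?cReD ?cImD ?cReM ?cImM /= !mul0r ?subr0 ?addr0 ?add0r.
    by rewrite q1.
  by rewrite q2.
have qE' : cis x + t%:C%C = cis x * ((p / cos al)%:C%C * cis (- al)).
  have -> : (p / cos al)%:C%C * cis (- al) = Complex p (- q).
    apply: eqC_ReIm; rewrite ?cReM ?cImM /= !mul0r ?subr0 ?addr0 ?cosN ?sinN.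
      by rewrite q1.
    by rewrite mulrN q2.
  have c2s2 := cos2Dsin2 x; apply: eqC_ReIm; rewrite ?cReM ?cImM /= /p /q.
    transitivity (cos x + t * (cos x ^+ 2 + sin x ^+ 2)); first by rewrite c2s2 mulr1.
    by clear; ring.
  by clear; ring.
rewrite qE qE'; have pc : (p / cos al)%:C%C != 0.
  by rewrite (inj_eq (@complexI R)) gt_eqF// divr_gt0.
have cn := cis_neq0 al.
transitivity (cis x * cis (- al) * (cis al)^-1).
  move: (p / cos al)%:C%C pc (cis al) cn => P P0 Q Q0.
  by field; rewrite P0 Q0.
apply: (mulIf cn); rewrite divfK// -!cisD; congr cis; clear; ring.
Qed.

Lemma is_derive_mobius_arg t x : 0 <= t <= 2^-1 ->
  is_derive x 1 (mobius_arg t) (poisson t x).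
Proof.
move=> t01; have p0 := tcos_gt0 x t01.
have dsin : is_derive x 1 (fun x => t * sin x) (t * cos x).
  exact: (@is_deriveZ _ _ _ (@sin R) t x 1 _ (is_derive_sin x)).
have dcos : is_derive x 1 (fun x => 1 + t * cos x) (t * - sin x).
  have dtc := @is_deriveZ _ _ _ (@cos R) t x 1 _ (is_derive_cos x).
  have := @is_deriveD _ _ _ _ _ x 1 _ _ (is_derive_cst (1 : R) x 1) dtc.
  by rewrite add0r.
have dV := @is_derive_inv _ (fun x => 1 + t * cos x) _ _ (lt0r_neq0 p0) dcos.
have dq := @is_deriveM _ _ (fun x => t * sin x) (fun x => (1 + t * cos x)^-1) x 1 _ _ dsin dV.
have dA := @is_derive1_comp _ (@atan R) (fun x => t * sin x / (1 + t * cos x)) x _ _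
  (is_derive1_atan _) dq.
have dA2 : is_derive x 1 (fun x : R => - 2 * atan (t * sin x / (1 + t * cos x)))
   (-2 * ((1 + (t * sin x / (1 + t * cos x)) ^+ 2)^-1 *
     ((t * sin x) * (- (1 + t * cos x) ^- 2 * (t * - sin x)) + (1 + t * cos x)^-1 * (t * cos x)))).
  exact: (@is_deriveZ _ _ _ _ (-2) x 1 _ dA).
have := @is_deriveD _ _ _ id _ x 1 _ _ (is_derive_id x 1) dA2.
have -> : id + (fun x : R => - 2 * atan (t * sin x / (1 + t * cos x))) = mobius_arg t.
  apply/funext => y; rewrite /mobius_arg -mulNr.
  by [].
move=> H; apply: (is_derive_eq H).
have s2 : sin x ^+ 2 = 1 - cos x ^+ 2 by rewrite -(cos2Dsin2 x) addrC addKr.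
have D0 : 1 + 2 * t * cos x + t ^+ 2 != 0.
  rewrite gt_eqF// (_ : _ + _ = (1 + t * cos x) ^+ 2 + t ^+ 2 * sin x ^+ 2).
    by rewrite ltr_pwDl ?exprn_gt0// mulr_ge0// sqr_ge0.
  by rewrite s2; ring.
rewrite /poisson; move: (lt0r_neq0 p0) D0 s2; move: (cos x) (sin x) => c s p1 D0 s2.
have E1 : 1 + (t * s / (1 + t * c)) ^+ 2 = (1 + 2 * t * c + t ^+ 2) / (1 + t * c) ^+ 2.
  have -> : 1 + 2 * t * c + t ^+ 2 = (1 + t * c) ^+ 2 + t ^+ 2 * s ^+ 2 by rewrite s2; ring.
  by field.
rewrite E1; have -> : t * s * (- (1 + t * c) ^- 2 * (t * - s)) + (1 + t * c)^-1 * (t * c)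
   = (t ^+ 2 * s ^+ 2 + t * c * (1 + t * c)) / (1 + t * c) ^+ 2 by field.
by rewrite s2; field; rewrite D0.
Qed.

Lemma poisson_bounds t x : 0 <= t <= 2^-1 -> 3^-1 <= poisson t x <= 3.
Proof.
move=> /andP[t0 t1]; have /andP[c1 c2] := cos_bounds x.
have tc1 : - t <= t * cos x by rewrite -mulrN1 ler_wpM2l.
have tc2 : t * cos x <= t by rewrite -{2}[t]mulr1 ler_wpM2l.
rewrite /poisson; set D := 1 + _ + _.
have DE : D = 1 + 2 * (t * cos x) + t ^+ 2 by rewrite /D; ring.
have D0 : 0 < D by rewrite DE; move: tc1 t1 t0; clear; nra.
rewrite ler_pdivlMr// ler_pdivrMr// DE.
move: tc1 tc2 t0 t1; clear; move: (t * cos x) => k; nra.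
Qed.

Lemma poisson_gt0 t x : 0 <= t <= 2^-1 -> 0 < poisson t x.
Proof.
by move=> t01; have /andP[+ _] := poisson_bounds x t01; apply: lt_le_trans; rewrite invr_gt0.
Qed.

Lemma continuous_poisson t : 0 <= t <= 2^-1 -> continuous (poisson t).
Proof.
move=> t01 x.
have D0 : 1 + 2 * t * cos x + t ^+ 2 != 0.
  have /andP[t0 t1] := t01; have p0 := poisson_gt0 x t01.
  by apply: contraTneq p0 => D0; rewrite /poisson D0 invr0 mulr0 ltxx.
apply: cvgM; first exact: cvg_cst.
apply: cvgV => //; apply: cvgD; last exact: cvg_cst.
apply: cvgD; first exact: cvg_cst.
by apply: cvgM; [exact: cvg_cst|exact: continuous_cos].
Qed.

(** The Mobius reparametrization of the circle distorts means of nonnegative functions by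
    a factor at most 3, the Poisson kernel being between 1/3 and 3. *)
Lemma mobius_mean u t s : continuous u -> (forall x, u (x + 2 * pi) = u x) ->
  (forall x, 0 <= u x) -> 0 <= t <= 2^-1 -> 0 <= s <= 2 * pi ->
  itg (fun x => u (s + mobius_arg t x)) 0 (2 * pi) <= 3 * itg u 0 (2 * pi) /\
  itg u 0 (2 * pi) <= 3 * itg (fun x => u (s + mobius_arg t x)) 0 (2 * pi).
Proof.
move=> cu pu u0 t01 s01; have pi0 : 0 < 2 * pi :> R by rewrite mulr_gt0// pi_gt0.
pose F x := s + mobius_arg t x.
have dF x : is_derive x 1 F (poisson t x).
  have := @is_deriveD _ _ _ _ _ x 1 _ _ (is_derive_cst s x 1) (is_derive_mobius_arg x t01).
  by rewrite add0r.
have cF : continuous F by move=> x; exact: is_derive_continuous (dF x).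
have cuF : continuous (fun x => u (F x)).
  by move=> x; apply: (@continuous_comp _ _ _ F u); [exact: cF|exact: cu].
have cP := continuous_poisson t01.
have F0 : F 0 = s by rewrite /F /mobius_arg sin0 mulr0 mul0r atan0 mulr0 subr0 addr0.
have F2 : F (2 * pi) = s + 2 * pi.
  by rewrite /F /mobius_arg [in sin _]mulr_natl sin2pi mulr0 mul0r atan0 mulr0 subr0.
have E : itg u 0 (2 * pi) = itg (fun x => u (F x) * poisson t x) 0 (2 * pi).
  rewrite -(itg_shift_period cu pu s01) -F2 -{1}F0.
  by apply: itg_subst => // x; exact: poisson_gt0.
have c1 : icont (fun x => u (F x)) 0 (2 * pi) by exact: continuous_icont.
have c2 : icont (fun x => u (F x) * poisson t x) 0 (2 * pi).
  by apply: icontM => //; exact: continuous_icont.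
have cZ h : icont h 0 (2 * pi) -> icont (fun x => 3 * h x) 0 (2 * pi).
  by move=> ch; apply: icontM => //; exact: icont_cst.
rewrite E; split; rewrite -itgZ//; apply: le_itg => //; try exact: cZ.
  move=> x _; rewrite mulrCA -[leLHS]mulr1 ler_wpM2l//.
  have /andP[+ _] := poisson_bounds x t01.
  by rewrite -(ler_pM2l (_ : 0 < 3)) ?divff// => ->.
move=> x _; rewrite mulrC ler_wpM2r//.
by have /andP[] := poisson_bounds x t01.
Qed.

End Mobius.

(** * Pointwise and mean bounds for ln |g| *)

Section Poisson.
Variable R : realType.
Implicit Types (t s x y d e r : R) (a z w c : R[i]) (g : R[i] -> R[i]).

Lemma cmod_tz_lt1 t z : 0 <= t <= 2^-1 -> cmod z < 2 -> 1 + t%:C%C * z != 0.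
Proof.
move=> /andP[t0 t1] z2; apply/eqP => E.
have : cmod (t%:C%C * z) = 1.
  have -> : t%:C%C * z = -1 by apply/eqP; rewrite -addr_eq0 addrC E.
  by rewrite cmodN cmod1.
rewrite cmodM cmodC ger0_norm// => E1.
have := cmod_ge0 z; move: z2 E1 t0 t1; clear; nra.
Qed.

Lemma mobius_le1 t z : 0 <= t <= 2^-1 -> cmod z <= 1 -> cmod (mobius t z) <= 1.
Proof.
move=> t01 z1; have D0 : 1 + t%:C%C * z != 0.
  by apply: cmod_tz_lt1 => //; apply: le_lt_trans z1 _; rewrite ltr1n.
rewrite /mobius cmodM cmodV ler_pdivrMr ?cmod_gt0// mul1r.
rewrite -(ler_pXn2r (n := 2)) ?nnegrE ?cmod_ge0//.
have z2 : cmod z ^+ 2 <= 1 by rewrite expr_le1// cmod_ge0.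
move: z2; rewrite !sqr_cmod !cReD !cImD cReM cImM /= => z2.
have /andP[t0 t1] := t01; have t2 : t ^+ 2 <= 1.
  by rewrite expr_le1//; apply: le_trans t1 _; rewrite invf_le1// ler1n.
rewrite -subr_ge0; set X := complex.Re z in z2 *; set Y := complex.Im z in z2 *.
rewrite (_ : _ - _ = (1 - t ^+ 2) * (1 - (X ^+ 2 + Y ^+ 2))); last by clear; ring.
by rewrite mulr_ge0// subr_ge0.
Qed.

Lemma derivable_mobius t z : 1 + t%:C%C * z != 0 -> derivable (mobius t) z 1.
Proof.
move=> D0; have d1 := @derivableCD _ (fun z => z) (fun=> t%:C%C) z (@derivableC_id R z) (@derivableC_cst R t%:C%C z).
have d2 := @derivableCM _ (fun=> t%:C%C) (fun z => z) z (@derivableC_cst R t%:C%C z) (@derivableC_id R z).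
have d3 := @derivableCD _ (fun=> 1) (fun z => t%:C%C * z) z (@derivableC_cst R 1 z) d2.
exact: (@derivableCM _ (fun z => z + t%:C%C) _ z d1 (@derivableCV _ (fun z => 1 + t%:C%C * z) z D0 d3)).
Qed.

Lemma mobius_inj t z w : 0 <= t <= 2^-1 -> 1 + t%:C%C * z != 0 -> 1 + t%:C%C * w != 0 ->
  mobius t z = mobius t w -> z = w.
Proof.
move=> t01 Dz Dw /eqP; rewrite /mobius eqr_div// -subr_eq0.
rewrite (_ : _ - _ = (z - w) * (1 - t%:C%C ^+ 2)); last by clear; ring.
rewrite mulf_eq0 subr_eq0 => /orP[/eqP//|].
rewrite -rmorphXn -(rmorph1 (real_complex R)) -rmorphB (inj_eq (@complexI R)) subr_eq0 => /eqP t1.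
have : t ^+ 2 < 1; last by rewrite -t1 ltxx.
have /andP[t0 t2] := t01; rewrite expr_lt1//; apply: le_lt_trans t2 _.
by rewrite invf_lt1// ltr1n.
Qed.

Lemma mobius_holo g t c (b : R[i]) : 0 <= t <= 2^-1 -> b != 0 ->
  (forall z, cmod (z - c) <= cmod b -> holo g z) ->
  forall z, cmod z <= 1 -> holo (fun z => g (c + b * mobius t z)) z.
Proof.
move=> t01 b0 hg z z1.
have near (y : R[i]) : cmod (y - z) < 1 -> 1 + t%:C%C * y != 0.
  move=> yz; apply: cmod_tz_lt1 => //; rewrite -(subrK z y).
  by apply: le_lt_trans (cmodD _ _) _; move: yz z1; clear; lra.
have nz : 1 + t%:C%C * z != 0 by apply: near; rewrite subrr cmod0.
have dg (y : R[i]) : 1 + t%:C%C * y != 0 -> derivable (fun z => c + b * mobius t z) y 1.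
  move=> /derivable_mobius dm.
  have d2 := @derivableCM _ (fun=> b) (mobius t) y (@derivableC_cst R b y) dm.
  exact: (@derivableCD _ (fun=> c) (fun z => b * mobius t z) y (@derivableC_cst R c y) d2).
apply: (@holo_comp _ g (fun z => c + b * mobius t z)).
- apply/dnbhsCP; exists 1 => // y /andP[y0 y1].
  apply/eqP => /addrI /(mulfI b0) /mobius_inj; move=> /(_ t01 (near _ y1) nz) yz.
  by move: y0; rewrite yz subrr cmod0 ltxx.
- exact: dg.
- by apply/dnbhsCP; exists 1 => // y /andP[_ y1]; apply: dg; exact: near.
- apply: hg; rewrite addrC addKr cmodM -[leRHS]mulr1 ler_wpM2l ?cmod_ge0//.
  exact: mobius_le1.
Qed.

(** [sub_mean] for g composed with the disc automorphism carrying the centre to w; the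
    distance of w to the centre is at most half the radius, so that its parameter is at
    most 1/2 and [mobius_mean] applies. *)
Lemma sub_mean_at g c r w : 0 < r -> (forall z, cmod (z - c) <= r -> holo g z) ->
  cmod (w - c) <= r / 2 ->
  exists ts : R * R, [/\ 0 <= ts.1 <= 2^-1, 0 <= ts.2 <= 2 * pi & forall e, 0 < e ->
  ln (Num.max (cmod (g w)) e) * (2 * pi) <=
  itg (fun x => ln (Num.max (cmod (g (c + r%:C%C * cis (ts.2 + mobius_arg ts.1 x)))) e)) 0 (2 * pi)].
Proof.
move=> r0 hg wr; have [s s01 sE] := polar_form (w - c).
pose t := cmod (w - c) / r; have t01 : 0 <= t <= 2^-1.
  by rewrite divr_ge0 ?cmod_ge0 ?(ltW r0)//= ler_pdivrMr// mulrC.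
exists (t, s); split => // e e0; rewrite /=.
pose b := r%:C%C * cis s; have rb : cmod b = r.
  by rewrite cmodM cmodC cmod_cis mulr1 gtr0_norm.
have b0 : b != 0 by rewrite -cmod_gt0 rb.
have hG := @mobius_holo g t c b t01 b0.
have := @sub_mean R (fun z => g (c + b * mobius t z)) e _ e0; rewrite rb in hG.
move=> /(_ (hG hg)).
have -> : c + b * mobius t 0 = w.
  rewrite /mobius mulr0 addr0 add0r divr1 /b mulrAC -rmorphM /t [r * _]mulrC divfK ?gt_eqF//.
  by rewrite -sE addrC subrK.
move=> /le_trans; apply; rewrite le_eqVlt; apply/orP; left; apply/eqP/eq_itg => x _.
by rewrite mobius_cis// /b -mulrA -cisD.
Qed.

(** log^+ and log^- of a modulus x.  The second is truncated at e, which keeps it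
    continuous at the zeros of the function; e tends to 0 only in [itg_le_lim]. *)
Definition lpos x : R := ln (Num.max x 1).
Definition lneg e x : R := - ln (Num.min (Num.max x e) 1).

Lemma lpos_ge0 x : 0 <= lpos x.
Proof. by rewrite ln_ge0// le_max lexx orbT. Qed.

Lemma lneg_ge0 e x : 0 < e -> 0 <= lneg e x.
Proof. by move=> e0; rewrite oppr_ge0 ln_le0// ge_min lexx orbT. Qed.

Lemma lposBneg e x : 0 < e <= 1 -> ln (Num.max x e) = lpos x - lneg e x.
Proof.
move=> /andP[e0 e1]; rewrite /lneg opprK /lpos.
have [x1|/ltW x1] := leP x 1.
  by rewrite ln1 add0r minEle ifT// ge_max x1.
have xe : e <= x := le_trans e1 x1.
by rewrite (max_idPl xe) (min_idPr x1) ln1 addr0.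
Qed.

Lemma ler_lpos x y : x <= y -> lpos x <= lpos y.
Proof.
by move=> xy; rewrite ler_ln ?posrE ?lt_max ?ltr01 ?orbT// ge_max !le_max xy lexx orbT.
Qed.

Lemma continuous_lpos : continuous lpos.
Proof.
move=> x; apply: (@continuous_comp _ _ _ (fun x => Num.max x 1) (@ln R)).
  by apply: (@continuous_max R _ (fun x => x) (fun=> 1)); [exact: cvg_id|exact: cvg_cst].
by apply: continuous_ln; rewrite lt_max ltr01 orbT.
Qed.

Lemma continuous_lneg e : 0 < e -> continuous (lneg e).
Proof.
move=> e0 x; apply: cvgN.
apply: (@continuous_comp _ _ _ (fun x => Num.min (Num.max x e) 1) (@ln R)).
  apply: (@continuous_min R _ (fun x => Num.max x e) (fun=> 1)); last exact: cvg_cst.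
  by apply: (@continuous_max R _ (fun x => x) (fun=> e)); [exact: cvg_id|exact: cvg_cst].
by apply: continuous_ln; rewrite lt_min ltr01 andbT lt_max e0 orbT.
Qed.

Lemma circle_continuous g c r (h : R -> R) : 0 <= r -> continuous h ->
  (forall z, cmod (z - c) <= r -> holo g z) ->
  continuous (fun x => h (cmod (g (c + r%:C%C * cis x)))).
Proof.
move=> r0 ch hg x.
apply: (@continuous_comp _ _ _ (fun x => cmod (g (c + r%:C%C * cis x))) h); last exact: ch.
apply: (@continuous_on_circle R (fun z => cmod (g (c + z)))).
apply: (@cont_cmod R (fun z => g (c + z))).
apply: (@ccont_comp R g (fun z => c + z)).
  exact: (ccontD (@ccont_cst R c _) (@ccont_id R _)).
have [] // := hg (c + r%:C%C * cis x).
by rewrite addrC addKr cmodM cmodC cmod_cis mulr1 ger0_norm.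
Qed.

(** The Poisson kernel is at most 3. *)
Lemma log_upper g c r w : 0 < r -> (forall z, cmod (z - c) <= r -> holo g z) ->
  cmod (w - c) <= r / 2 ->
  lpos (cmod (g w)) * (2 * pi) <=
  3 * itg (fun x => lpos (cmod (g (c + r%:C%C * cis x)))) 0 (2 * pi).
Proof.
move=> r0 hg wr; have [[t s] /= [t01 s01 /(_ 1 ltr01) H]] := sub_mean_at r0 hg wr.
apply: le_trans H _.
have [H _] := @mobius_mean R (fun x => lpos (cmod (g (c + r%:C%C * cis x)))) t s
  (circle_continuous (ltW r0) continuous_lpos hg)
  (fun x => congr1 (fun z => lpos (cmod (g (c + r%:C%C * z)))) (cisD2pi x))
  (fun x => lpos_ge0 _) t01 s01.
exact: H.
Qed.

(** The mean of log^+ minus log^- against the Poisson kernel of w is at least ln |g w|.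
    Comparing both means with the uniform ones costs a factor 3 for each, whence 9. *)
Lemma log_lower g c r w e : 0 < r -> (forall z, cmod (z - c) <= r -> holo g z) ->
  cmod (w - c) <= r / 2 -> g w != 0 -> 0 < e <= 1 ->
  itg (fun x => lneg e (cmod (g (c + r%:C%C * cis x)))) 0 (2 * pi) <=
  9 * itg (fun x => lpos (cmod (g (c + r%:C%C * cis x)))) 0 (2 * pi)
  - 3 * (2 * pi) * ln (cmod (g w)).
Proof.
move=> r0 hg wr gw e01; have /andP[e0 e1] := e01.
have [[t s] /= [t01 s01 /(_ e e0) H]] := sub_mean_at r0 hg wr.
have pi0 : 0 < 2 * pi :> R by rewrite mulr_gt0// pi_gt0.
set p := fun x => lpos (cmod (g (c + r%:C%C * cis x))).
set n := fun x => lneg e (cmod (g (c + r%:C%C * cis x))).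
have cp : continuous p := circle_continuous (ltW r0) continuous_lpos hg.
have cn : continuous n := circle_continuous (ltW r0) (continuous_lneg e0) hg.
have [P1 _] := @mobius_mean R p t s cp
  (fun x => congr1 (fun z => lpos (cmod (g (c + r%:C%C * z)))) (cisD2pi x))
  (fun x => lpos_ge0 _) t01 s01.
have [_ N1] := @mobius_mean R n t s cn
  (fun x => congr1 (fun z => lneg e (cmod (g (c + r%:C%C * z)))) (cisD2pi x))
  (fun x => lneg_ge0 _ e0) t01 s01.
have cF : continuous (fun x => s + mobius_arg t x).
  move=> x; apply: cvgD; first exact: cvg_cst.
  exact: is_derive_continuous (is_derive_mobius_arg x t01).
have H1 : ln (cmod (g w)) * (2 * pi) <=
    itg (fun x => p (s + mobius_arg t x) - n (s + mobius_arg t x)) 0 (2 * pi).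
  apply: (@le_trans _ _ (ln (Num.max (cmod (g w)) e) * (2 * pi))).
    by rewrite ler_pM2r// ler_ln ?posrE ?cmod_gt0 ?lt_max ?cmod_gt0 ?gw// le_max lexx.
  apply: le_trans H _; rewrite le_eqVlt; apply/orP; left; apply/eqP/eq_itg => x _.
  exact: lposBneg.
rewrite itgB in H1; last 2 first.
- apply: continuous_icont => x.
  by apply: (@continuous_comp _ _ _ (fun x => s + mobius_arg t x) p); [exact: cF|exact: cp].
- apply: continuous_icont => x.
  by apply: (@continuous_comp _ _ _ (fun x => s + mobius_arg t x) n); [exact: cF|exact: cn].
by move: H1 P1 N1; clear; rewrite -/p -/n; lra.
Qed.

(** Monotone convergence for S, followed by a comparison of F with the limit: the integral
    of a nonnegative function is a supremum over the simple functions below it, hence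
    monotone even for functions that are not known to be measurable. *)
Lemma itg_le_lim (F : R -> R) (S : nat -> R -> R) (K a b : R) :
  (forall t, a <= t <= b -> 0 <= F t) ->
  (forall n, icont (S n) a b) -> (forall n t, 0 <= S n t) ->
  (forall n m t, (n <= m)%N -> S n t <= S m t) ->
  (forall n, itg (S n) a b <= K) ->
  (forall t, a <= t <= b -> exists n, F t <= S n t) ->
  itg F a b <= K.
Proof.
move=> F0 cS S0 mS SK FS.
pose D : set R := `[a, b]%classic; have mD : measurable D by exact: measurable_itv.
have iS n := icont_integrable (cS n).
have mS' n := measurable_int lebesgue_measure (iS n).
have MC := @monotone_convergence _ _ R lebesgue_measure D mD (fun n => EFin \o S n) mS'
  (fun n x _ => S0 n x) (fun x _ n m nm => mS n m x nm).
have le1 : (\int[lebesgue_measure]_(t in D) (F t)%:E <=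
    \int[lebesgue_measure]_(t in D) limn (fun n => (S n t)%:E))%E.
  rewrite !ge0_integralE.
  - apply: ge_ereal_sup => _ /= [h hF <-]; apply: ereal_sup_ubound; exists h => // x.
    apply: le_trans (hF x) _; rewrite /patch; case: ifPn => // xD.
    have [n Fn] := FS x ltac:(by move: xD; rewrite inE /D /= in_itv).
    apply: (@le_trans _ _ (S n x)%:E); first by rewrite lee_fin.
    apply: lime_ge.
      by apply: ereal_nondecreasing_is_cvgn => m k mk; rewrite lee_fin mS.
    by exists n => // m /= nm; rewrite lee_fin mS.
  - move=> x _; apply: lime_ge.
      by apply: ereal_nondecreasing_is_cvgn => m k mk; rewrite lee_fin mS.
    by apply: nearW => m; rewrite lee_fin.
  - by move=> x; rewrite /D /= in_itv /= lee_fin; exact: F0.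
have le2 : (\int[lebesgue_measure]_(t in D) (F t)%:E <= K%:E)%E.
  apply: le_trans le1 _; rewrite MC; apply: lime_le.
    apply: ereal_nondecreasing_is_cvgn => m k mk.
    apply: ge0_le_integral => //= x _; rewrite lee_fin//; exact: mS.
  apply: nearW => n; have := SK n; rewrite -lee_fin /itg /Rintegral fineK; first by [].
  exact: integrable_fin_num (iS n).
have F0' : (0 <= \int[lebesgue_measure]_(t in D) (F t)%:E)%E.
  by apply: integral_ge0 => x; rewrite /D /= in_itv /= lee_fin; exact: F0.
rewrite /itg /Rintegral -lee_fin fineK// ge0_fin_numE//.
by apply: le_lt_trans le2 _; rewrite ltry.
Qed.

End Poisson.

(** * Poles of meromorphic functions *)

Section Poles.
Variable R : realType.
Implicit Types (t s x y d e r M : R) (a b z w c l : R[i]) (f g : R[i] -> R[i]).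

Lemma pole_of_orderP f a n l : (fun z => (z - a) ^+ n * f z) @ a^' --> l ->
  forall e, 0 < e -> exists2 d, 0 < d &
    forall z, 0 < cmod (z - a) < d -> cmod ((z - a) ^+ n * f z - l) < e.
Proof.
move=> H e e0; apply/dnbhsCP.
exact: (@cvgCP _ _ (a^') _ (fun z => (z - a) ^+ n * f z) l).1 H e e0.
Qed.

Lemma pole_unbounded f a M : is_pole f a ->
  exists2 d, 0 < d & forall z, 0 < cmod (z - a) < d -> M < cmod (f z).
Proof.
move=> [n [n0 [l l0 /pole_of_orderP H]]].
have l0' : 0 < cmod l by rewrite cmod_gt0.
have l2 : 0 < cmod l / 2 by rewrite divr_gt0.
have [d d0 Hd] := H _ l2; have M1 : 0 < `|M| + 1 by rewrite ltr_wpDl.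
pose k := cmod l / 2 / (`|M| + 1); have k0 : 0 < k by rewrite divr_gt0.
exists (Num.min d (Num.min 1 k)); first by rewrite !lt_min d0 ltr01.
move=> z; rewrite !lt_min => /andP[z0 /andP[zd /andP[z1 zk]]].
have h1 : cmod l / 2 <= cmod (z - a) ^+ n * cmod (f z).
  have := Hd z; rewrite z0 zd => /(_ isT); rewrite (cmod_distC _ l) => h.
  have := cmodB_ge l ((z - a) ^+ n * f z); rewrite cmodM cmodX.
  by move: h; clear; lra.
have h2 : cmod (z - a) ^+ n <= cmod (z - a).
  by case: (n) n0 => // m _; rewrite exprS ler_piMr ?cmod_ge0// exprn_ile1 ?cmod_ge0// ltW.
have h3 : cmod l / 2 <= cmod (z - a) * cmod (f z).
  by apply: le_trans h1 _; rewrite ler_wpM2r ?cmod_ge0.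
rewrite ltNge; apply/negP => fM.
have fM1 : cmod (f z) < `|M| + 1.
  by apply: le_lt_trans fM _; apply: le_lt_trans (ler_norm M) _; rewrite ltrDl.
have : cmod (z - a) * cmod (f z) < k * (`|M| + 1).
  by rewrite ltr_pM ?cmod_ge0.
by rewrite /k divfK ?gt_eqF// ltNge h3.
Qed.

Lemma bounded_not_pole f a M d : 0 < d ->
  (forall z, 0 < cmod (z - a) < d -> cmod (f z) <= M) -> ~ is_pole f a.
Proof.
move=> d0 H /(pole_unbounded M)[d' d'0 H'].
pose e := Num.min d d' / 2; have m0 : 0 < Num.min d d' by rewrite lt_min d0.
have e0 : 0 < e by rewrite divr_gt0.
have em : e < Num.min d d' by rewrite ltr_pdivrMr// mulr_natr mulr2n ltrDl.
have /andP[ed ed'] : (e < d) && (e < d') by rewrite -lt_min.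
have zE : cmod (a + e%:C%C - a) = e by rewrite addrC addKr cmodC gtr0_norm.
have := H (a + e%:C%C); have := H' (a + e%:C%C); rewrite zE e0 ed ed' => /(_ isT) h /(_ isT).
by rewrite leNgt h.
Qed.

Lemma ccont_not_pole f a : ccont f a -> ~ is_pole f a.
Proof.
move=> cf; have [d d0 H] := cf 1 ltr01.
apply: (@bounded_not_pole f a (cmod (f a) + 1) d) => // z /andP[_ /H h].
rewrite -(subrK (f a) (f z)); apply: le_trans (cmodD _ _) _.
by rewrite addrC lerD2l ltW.
Qed.

Lemma derivable_not_pole f a : derivable f a 1 -> ~ is_pole f a.
Proof. by move=> /derivableC_continuous; exact: ccont_not_pole. Qed.

Lemma meromorphic_derivable f a : meromorphic f -> ~ is_pole f a -> derivable f a 1.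
Proof. by move=> /(_ a)[_ []]. Qed.

Lemma poles_isolated f a : meromorphic f ->
  exists2 d, 0 < d & forall z, 0 < cmod (z - a) < d -> derivable f z 1.
Proof. by move=> /(_ a)[/dnbhsCP]. Qed.

(** By [bisection] of a square containing the disc: finiteness passes from the quarters to
    the whole, and a small square contains at most one pole because poles are isolated. *)
Lemma finite_poles f r : meromorphic f -> 0 < r ->
  exists2 ps : seq R[i], uniq ps & forall a, a \in ps <-> cmod a <= r /\ is_pole f a.
Proof.
move=> mf r0.
have [s Hs] : exists s : seq R[i], forall a, is_pole f a ->
    - r <= complex.Re a <= - r + 2 * r -> - r <= complex.Im a <= - r + 2 * r -> a \in s.
  have r2 : 0 < 2 * r by rewrite mulr_gt0.
  pose P (n : nat) x y := exists s : seq R[i], forall a, is_pole f a ->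
    x <= complex.Re a <= x + 2 * r * 2 ^- n -> y <= complex.Im a <= y + 2 * r * 2 ^- n ->
    a \in s.
  have : P 0%N (- r) (- r); last by rewrite /P expr0 invr1 !mulr1.
  apply: (@bisection _ P (- r) (- r) (2 * r) (2 * r)) => //.
    move=> n x y [s1 H1] [s2 H2] [s3 H3] [s4 H4].
    exists (s1 ++ s2 ++ s3 ++ s4) => a pa; rewrite (halfS R n) !mulrDr !mem_cat.
    move: H1 H2 H3 H4; move: (2 * r * _) => k H1 H2 H3 H4 hx hy.
    have [hx1|hx2] := leP (complex.Re a) (x + k); have [hy1|hy2] := leP (complex.Im a) (y + k).
    - by rewrite H1//; move: hx hy hx1 hy1; clear; lra.
    - by rewrite H3 ?orbT//; move: hx hy hx1 hy2; clear; lra.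
    - by rewrite H2 ?orbT//; move: hx hy hx2 hy1; clear; lra.
    - by rewrite H4 ?orbT//; move: hx hy hx2 hy2; clear; lra.
  move=> x y _ _; have [d d0 Hd] := poles_isolated (Complex x y) mf.
  exists (d / (4 * r)); first by rewrite divr_gt0// mulr_gt0.
  move=> n x' y' hx' hy'; rewrite ltr_pdivlMr ?mulr_gt0// => hn.
  exists [:: Complex x y] => a pa hx hy; rewrite inE; apply: contraT => axy.
  suff dfa : derivable f a 1 by case: (derivable_not_pole dfa pa).
  apply: Hd; rewrite cmod_gt0 subr_eq0 axy /=.
  apply: le_lt_trans (cmod_le_ReIm _) _; rewrite !cReD !cImD !cReN !cImN /=.
  have k2 : 2 * (2 * r * 2 ^- n) < d by rewrite (_ : _ * _ = 2 ^- n * (4 * r)); [|ring].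
  apply: le_lt_trans k2; move: hx hy hx' hy'; clear; move: (2 * r * _) => k hx hy hx' hy'.
  have -> : 2 * k = k + k by ring.
  by apply: lerD; rewrite ler_norml; move: hx hy hx' hy'; clear; lra.
exists (undup [seq a <- s | (cmod a <= r) && `[< is_pole f a >]]); first exact: undup_uniq.
move=> a; rewrite mem_undup mem_filter; split.
  by move=> /andP[/andP[ar /asboolP pa] _].
move=> [ar pa]; rewrite ar /=; apply/andP; split; first exact/asboolP.
have := Re_le_cmod a; have := Im_le_cmod a; rewrite !ler_norml => h1 h2.
by apply: Hs => //; move: h1 h2 ar; clear; lra.
Qed.

Lemma pole_mult_pole f a : is_pole f a -> pole_of_order f a (pole_mult f a).
Proof. exact: xgetPex. Qed.

Lemma pole_mult_gt0 f a : is_pole f a -> (0 < pole_mult f a)%N.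
Proof. by move=> /pole_mult_pole[]. Qed.

Lemma pole_mult0 f a : ~ is_pole f a -> pole_mult f a = 0%N.
Proof. by move=> npa; apply: xgetPN => n pn; apply: npa; exists n. Qed.

Definition poles_in f r (ps : seq R[i]) : Prop :=
  uniq ps /\ forall a, a \in ps <-> cmod a <= r /\ is_pole f a.

Lemma pole_countE f r ps t : poles_in f r ps -> t <= r ->
  pole_count f t = \sum_(a <- ps | cmod a <= t) (pole_mult f a)%:R.
Proof.
move=> [ups Hps] tr; rewrite /pole_count.
rewrite (@fsbigE _ _ _ _ _ [seq a <- ps | cmod a <= t]).
- rewrite big_filter_cond; apply: eq_bigl => a.
  by have [at_|//] := leP (cmod a) t; rewrite mem_set.
- exact: filter_uniq.
- by move=> a /=; rewrite mem_filter => /andP[].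
- move=> a /= at_; rewrite mem_filter at_ /= => aps.
  rewrite pole_mult0// => pa; move/negP: aps; apply; apply/Hps; split => //.
  exact: le_trans tr.
Qed.

(** The division by 2 r makes every factor at most 1 in modulus on the disc of radius r. *)
Definition pole_prod f r (ps : seq R[i]) z : R[i] :=
  \prod_(a <- ps) ((z - a) / (2 * r)%:C%C) ^+ pole_mult f a.

Lemma derivable_pole_prod f r ps z : derivable (pole_prod f r ps) z 1.
Proof.
have dX (a : R[i]) n (y : R[i]) : derivable (fun z => ((z - a) / (2 * r)%:C%C) ^+ n) y 1.
  have d1 := @derivableCD _ (fun z => z) (fun=> - a) y (@derivableC_id R y) (@derivableC_cst R (- a) y).
  have d2 := @derivableCM _ (fun z => z - a) (fun=> (2 * r)%:C%C^-1) y d1 (@derivableC_cst R _ y).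
  elim: n => [|n IH].
    rewrite (_ : (fun _ => _) = fun=> 1); first exact: derivableC_cst.
    by apply/funext => w; rewrite expr0.
  rewrite (_ : (fun _ => _) = fun z => (z - a) / (2 * r)%:C%C * ((z - a) / (2 * r)%:C%C) ^+ n).
    exact: (@derivableCM _ _ _ y d2 IH).
  by apply/funext => w; rewrite exprS.
rewrite /pole_prod; elim: ps => [|a ps IH].
  rewrite (_ : (fun _ => _) = fun=> 1); first exact: derivableC_cst.
  by apply/funext => w; rewrite big_nil.
rewrite (_ : (fun _ => _) = fun z => ((z - a) / (2 * r)%:C%C) ^+ pole_mult f a *
   \prod_(a <- ps) ((z - a) / (2 * r)%:C%C) ^+ pole_mult f a).
  exact: (@derivableCM _ _ _ z (dX a _ z) IH).
by apply/funext => w; rewrite big_cons.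
Qed.

(** [pole_prod] cancels each pole with its multiplicity; at the pole itself g takes the
    limit provided by [pole_of_order]. *)
Lemma clear_poles f r ps : meromorphic f -> 0 < r -> poles_in f r ps ->
  exists2 g, (forall z, cmod z <= r -> holo g z) &
    forall z, ~ is_pole f z -> g z = f z * pole_prod f r ps z.
Proof.
move=> mf r0 [ups Hps].
pose B := pole_prod f r ps; have dB z : derivable B z 1 by exact: derivable_pole_prod.
have c0 : (2 * r)%:C%C != 0 :> R[i] by rewrite (inj_eq (@complexI R)) gt_eqF// mulr_gt0.
have [l Hl] : {l : R[i] -> R[i] & forall a, is_pole f a ->
    (fun z => (z - a) ^+ pole_mult f a * f z) @ a^' --> l a}.
  pose l a := if pselect (is_pole f a) is left pa
    then sval (cid2 (pole_mult_pole pa).2) else 0.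
  exists l => a pa; rewrite /l; case: pselect => // pa'.
  exact: (svalP (cid2 (pole_mult_pole pa').2)).2.
pose Q a z := \prod_(b <- ps | b != a) ((z - b) / (2 * r)%:C%C) ^+ pole_mult f b.
pose K a : R[i] := (2 * r)%:C%C^-1 ^+ pole_mult f a.
pose g z := if `[< is_pole f z >] then l z * (K z * Q z z) else f z * B z.
have gE z : ~ is_pole f z -> g z = f z * B z by rewrite /g; case: asboolP.
have gP z : is_pole f z -> g z = l z * (K z * Q z z).
  by move=> pz; rewrite /g asboolT.
have BE a z : a \in ps -> B z = (z - a) ^+ pole_mult f a * (K a * Q a z).
  by move=> aps; rewrite /B /pole_prod (bigD1_seq a)//= exprMn mulrA.
have dQ a z : derivable (Q a) z 1.
  rewrite (_ : Q a = pole_prod f r [seq b <- ps | b != a]).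
    exact: derivable_pole_prod.
  by apply/funext => y; rewrite /pole_prod big_filter.
exists g; last exact: gE.
clearbody g B K Q.
move=> a ar; have [d d0 Hd] := poles_isolated a mf.
have np z : 0 < cmod (z - a) < d -> ~ is_pole f z by move=> /Hd /derivable_not_pole.
have dg z : 0 < cmod (z - a) < d -> derivable g z 1.
  move=> /andP[z0 zd].
  have dfB : derivable (fun z => f z * B z) z 1.
    by apply: (@derivableCM _ f B z) => //; apply: Hd; rewrite z0.
  apply: derivableC_near_eq dfB; apply/nbhsCP.
  exists (Num.min (cmod (z - a)) (d - cmod (z - a))).
    by rewrite lt_min z0 subr_gt0.
  move=> y; rewrite lt_min => /andP[y1 y2]; rewrite gE//; apply: np; apply/andP; split.
    have := cmodB_ge (z - a) (z - y).
    rewrite (_ : z - a - (z - y) = y - a); last by ring.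
    by apply: lt_le_trans; rewrite subr_gt0 cmod_distC.
  rewrite -(subrK z y) -addrA; apply: le_lt_trans (cmodD _ _) _.
  by rewrite -ltrBrDr.
split; last by apply/dnbhsCP; exists d.
have [pa|npa] := pselect (is_pole f a); last first.
  have dfa := meromorphic_derivable mf npa.
  have cfB : ccont (fun z => f z * B z) a.
    exact: (@ccontM R f B a (derivableC_continuous dfa) (derivableC_continuous (dB a))).
  apply: (@ccont_near R (fun z => f z * B z) g a _ cfB); exists d; first exact: d0.
  move=> z zd; rewrite gE; first by [].
  have [->|za] := eqVneq z a; first exact: npa.
  by apply: np; rewrite cmod_gt0 subr_eq0 za.
have aps : a \in ps by apply/Hps.
pose k z := if z == a then l a else (z - a) ^+ pole_mult f a * f z.
have ck : ccont k a.
  move=> e e0; have [d' d'0 H] := pole_of_orderP (Hl _ pa) e0.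
  exists d' => // z zd; rewrite /k eqxx; have [_|za] := eqVneq z a.
    by rewrite subrr cmod0.
  by apply: H; rewrite cmod_gt0 subr_eq0 za.
have cQ : ccont (fun z => K a * Q a z) a.
  exact: (@ccontM R (fun=> K a) (Q a) a (@ccont_cst R (K a) a) (derivableC_continuous (dQ a a))).
have ckQ := @ccontM R k (fun z => K a * Q a z) a ck cQ.
apply: (@ccont_near R (fun z => k z * (K a * Q a z)) g a _ ckQ); exists d; first exact: d0.
move=> z zd; rewrite /k; have [->|za] := eqVneq z a; first by rewrite gP.
rewrite gE; last by apply: np; rewrite cmod_gt0 subr_eq0 za.
by rewrite (BE a z aps) [RHS]mulrCA [RHS]mulrA.
Qed.

End Poles.

(** * The counting function *)

Section Nevanlinna.
Variable R : realType.
Implicit Types (t s x y d e r : R) (a b z w c l : R[i]) (f g : R[i] -> R[i]).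

Lemma itg_inv x r : 0 < x -> x <= r -> itg (fun t => t^-1) x r = ln r - ln x.
Proof.
move=> x0; rewrite le_eqVlt => /predU1P[<-|xr].
  by rewrite subrr /itg set_itv1 Rintegral_set1.
have cV : {within `[x, r], continuous (fun t : R => t^-1)}.
  apply: icont_within => t /andP[xt _]; apply: inv_continuous.
  by rewrite gt_eqF// (lt_le_trans x0).
rewrite /itg /Rintegral (@continuous_FTC2 _ _ (@ln R) _ _ xr cV)//.
- split.
  + move=> t; rewrite in_itv /= => /andP[xt _].
    by have [] := is_derive1_ln (lt_trans x0 xt).
  + by apply: cvg_at_right_filter; exact: continuous_ln.
  + by apply: cvg_at_left_filter; apply: continuous_ln; exact: lt_trans xr.
- move=> t; rewrite in_itv /= => /andP[xt _].
  by rewrite derive1E; have [_ ->] := is_derive1_ln (lt_trans x0 xt).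
Qed.

Let step x t : R := if x <= t then t^-1 else 0.

Let step_patch x r : {in `[0, r]%classic, step x =1 ((fun t => t^-1) \_ `[x, r])}.
Proof.
move=> t; rewrite inE /= in_itv /= => /andP[t0 tr]; rewrite /step /patch.
have [xt|tx] := leP x t; first by rewrite mem_set//= in_itv /= xt.
by rewrite memNset//= in_itv /= leNgt tx.
Qed.

Let itv_sub x r : 0 < x -> `[0, r] `&` `[x, r] = `[x, r]%classic.
Proof.
move=> x0; apply/seteqP; split => [t []//|t]; rewrite /= !in_itv /= => /andP[xt tr].
by rewrite xt tr (le_trans (ltW x0) xt).
Qed.

Let icont_inv x r : 0 < x -> icont (fun t : R => t^-1) x r.
Proof.
move=> x0 t /andP[xt _]; apply: inv_continuous.
by rewrite gt_eqF// (lt_le_trans x0).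
Qed.

Let itg_step x r : 0 < x -> x <= r -> itg (step x) 0 r = ln r - ln x.
Proof.
move=> x0 xr; rewrite -(itg_inv x0 xr) /itg -[in RHS](itv_sub r x0) Rintegral_mkcondr.
apply: eq_Rintegral => t; exact: step_patch.
Qed.

Let step_integrable x r : 0 < x ->
  lebesgue_measure.-integrable `[0, r] (EFin \o step x).
Proof.
move=> x0; have ih := icont_integrable (@icont_inv x r x0).
have H0 := (@integrable_mkcond _ _ R lebesgue_measure _ _ (measurable_itv `[x, r])).1 ih.
have H := @integrableS _ _ R lebesgue_measure _ _ _ measurableT (measurable_itv `[0, r])
  (@subsetT _ _) H0.
apply: eq_integrable H; first exact: measurable_itv.
by move=> t tr; rewrite /= (step_patch _ tr) /patch; case: ifP.
Qed.

Lemma Rintegral_sum (I : Type) (s : seq I) (h : I -> R -> R) (D : set R) :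
  measurable D -> (forall i, lebesgue_measure.-integrable D (EFin \o h i)) ->
  lebesgue_measure.-integrable D (EFin \o (fun t => \sum_(i <- s) h i t)) /\
  \int[lebesgue_measure]_(t in D) (\sum_(i <- s) h i t) =
  \sum_(i <- s) \int[lebesgue_measure]_(t in D) h i t.
Proof.
move=> mD ih; elim: s => [|i s [IH1 IH2]].
  have E : (fun t => \sum_(i <- [::]) h i t) = cst 0 by apply/funext => t; rewrite big_nil.
  rewrite E big_nil; split; first exact: integrable0.
  by rewrite /Rintegral integral0.
have E : (fun t => \sum_(j <- i :: s) h j t) = (fun t => h i t + \sum_(j <- s) h j t).
  by apply/funext => t; rewrite big_cons.
rewrite E big_cons -IH2; split; last by rewrite RintegralD.
rewrite (_ : _ \o _ = (EFin \o h i) \+ (EFin \o (fun t => \sum_(j <- s) h j t))).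
  exact: integrableD.
by apply/funext => t; rewrite /= EFinD.
Qed.

(** A pole at the origin counts as one at distance 1, because it enters [Nevanlinna_N]
    through the term ln r = ln r - ln 1. *)
Definition pole_dist a : R := if a == 0 then 1 else cmod a.

Definition poles_weight f (ps : seq R[i]) : R := \sum_(a <- ps) (pole_mult f a)%:R.

(** A pole a outside the origin contributes the function 1 / t on [|a|, r] to the
    integrand, once for each multiplicity, hence ln r - ln |a| to the integral. *)
Lemma N_formula f r ps : 0 < r -> poles_in f r ps ->
  Nevanlinna_N f r = \sum_(a <- ps) (pole_mult f a)%:R * (ln r - ln (pole_dist a)).
Proof.
move=> r0 Hps; rewrite /Nevanlinna_N.
have E0 : pole_count f 0 = \sum_(a <- ps | a == 0) (pole_mult f a)%:R.
  rewrite (pole_countE Hps (ltW r0)); apply: eq_bigl => a.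
  by rewrite -cmod_eq0 eq_le cmod_ge0 andbT.
have Et t : 0 <= t <= r -> (pole_count f t - pole_count f 0) / t =
    \sum_(a <- [seq a <- ps | a != 0]) (pole_mult f a)%:R * step (cmod a) t.
  move=> /andP[t0 tr]; rewrite (pole_countE Hps tr) E0 big_filter.
  rewrite big_mkcond [X in _ - X]big_mkcond [RHS]big_mkcond -sumrB mulr_suml.
  apply: eq_bigr => a _; rewrite /step; have [->|a0] /= := eqVneq a 0.
    by rewrite cmod0 t0 subrr mul0r.
  by case: ifP => _; rewrite subr0 ?mul0r ?mulr0.
pose h a : R -> R := if a != 0 then fun t => (pole_mult f a)%:R * step (cmod a) t else cst 0.
have ih a : lebesgue_measure.-integrable `[0, r] (EFin \o h a).
  rewrite /h; case: ifPn => a0; last exact: integrable0.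
  have := @integrableZl _ _ _ lebesgue_measure `[0, r]%classic (measurable_itv _)
    (pole_mult f a)%:R _ (@step_integrable (cmod a) r _).
  by rewrite cmod_gt0 => /(_ a0).
have [_ Eh] := @Rintegral_sum _ [seq a <- ps | a != 0] h `[0, r]%classic (measurable_itv _) ih.
have -> : \int[lebesgue_measure]_(t in `[0, r]) ((pole_count f t - pole_count f 0) / t) =
    \sum_(a <- [seq a <- ps | a != 0]) (pole_mult f a)%:R * (ln r - ln (cmod a)).
  transitivity (\int[lebesgue_measure]_(t in `[0, r]) (\sum_(a <- [seq a <- ps | a != 0]) h a t)).
    apply: eq_Rintegral => t; rewrite inE /= in_itv /= => tr; rewrite Et// !big_filter.
    by apply: eq_bigr => a a0; rewrite /h a0.
  rewrite Eh !big_filter big_seq_cond [RHS]big_seq_cond; apply: eq_bigr => a /andP[aps a0].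
  have a0' : 0 < cmod a by rewrite cmod_gt0.
  rewrite /h a0 RintegralZl//; last exact: step_integrable.
  congr (_ * _); apply: itg_step => //.
  by have [_ /(_ a)[/(_ aps)[]]] := Hps.
rewrite E0 big_filter mulr_suml big_mkcond [X in _ + X]big_mkcond -big_split /=.
apply: eq_bigr => a _; rewrite /pole_dist; have [_|_] /= := eqVneq a 0.
  by rewrite add0r ln1 subr0.
by rewrite addr0.
Qed.

Lemma pole_dist_gt0 a : 0 < pole_dist a.
Proof. by rewrite /pole_dist; case: eqVneq => // a0; rewrite cmod_gt0. Qed.

Lemma pole_dist_le a r : 1 <= r -> cmod a <= r -> pole_dist a <= r.
Proof. by rewrite /pole_dist; case: eqVneq. Qed.

Lemma N_ge f r r' ps : meromorphic f -> 1 <= r' -> r <= r' -> poles_in f r ps ->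
  \sum_(a <- ps) (pole_mult f a)%:R * (ln r' - ln (pole_dist a)) <= Nevanlinna_N f r'.
Proof.
move=> mf r1 rr' [ups Hps]; have r'0 : 0 < r' := lt_le_trans ltr01 r1.
have [ps' ups' Hps'] := finite_poles mf r'0.
rewrite (N_formula r'0 (conj ups' Hps')).
have term0 a : a \in ps' -> 0 <= (pole_mult f a)%:R * (ln r' - ln (pole_dist a)) :> R.
  move=> /Hps'[ar _]; rewrite mulr_ge0// subr_ge0 ler_ln ?posrE ?pole_dist_gt0//.
  exact: pole_dist_le.
have pE : perm_eq ps [seq a <- ps' | cmod a <= r].
  apply: uniq_perm => //; first exact: filter_uniq.
  move=> a; rewrite mem_filter; apply/idP/idP.
    by move=> /Hps[ar pa]; rewrite ar /=; apply/Hps'; split => //; exact: le_trans rr'.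
  by move=> /andP[ar /Hps'[_ pa]]; apply/Hps.
rewrite (perm_big _ pE) big_filter /= [leRHS](bigID (fun a => cmod a <= r)) /= lerDl.
by rewrite big_seq_cond sumr_ge0// => a /andP[aps' _]; exact: term0.
Qed.

Lemma N_ge0 f r : meromorphic f -> 1 <= r -> 0 <= Nevanlinna_N f r.
Proof.
move=> mf r1; have r0 : 0 < r := lt_le_trans ltr01 r1.
have [ps ups Hps] := finite_poles mf r0.
rewrite (N_formula r0 (conj ups Hps)) big_seq sumr_ge0// => a /Hps[ar _].
by rewrite mulr_ge0// subr_ge0 ler_ln ?posrE ?pole_dist_gt0// pole_dist_le.
Qed.

Lemma m_ge0 f r : 0 <= Nevanlinna_m f r.
Proof.
rewrite /Nevanlinna_m mulr_ge0// ?invr_ge0 ?mulr_ge0 ?pi_ge0//.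
by apply: Rintegral_ge0 => x _; rewrite /logplus le_max lexx.
Qed.

(** Each pole in the disc of radius r contributes at least ln 2 to N(2 r). *)
Lemma poles_weight_le f r ps : meromorphic f -> 1 <= r -> poles_in f r ps ->
  poles_weight f ps * ln 2 <= Nevanlinna_N f (2 * r).
Proof.
move=> mf r1 Hps; have r0 : 0 < r := lt_le_trans ltr01 r1.
have r2 : r <= 2 * r by rewrite ler_peMl ?ler1n// ltW.
apply: le_trans (N_ge mf (le_trans r1 r2) r2 Hps).
rewrite /poles_weight mulr_suml big_seq [leRHS]big_seq; apply: ler_sum => a aps.
have [_ /(_ a)[/(_ aps)[ar _] _]] := Hps.
rewrite ler_wpM2l// lnM ?posrE// -addrA lerDl subr_ge0 ler_ln ?posrE ?pole_dist_gt0//.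
exact: pole_dist_le.
Qed.

End Nevanlinna.

(** * Estimates after clearing the poles *)

Section Estimates.
Variable R : realType.
Implicit Types (t s x y d e r : R) (a b z w c l : R[i]) (f g : R[i] -> R[i]).

(** Only finitely many radii carry poles.  On a pole-free circle log^+ |f| is continuous,
    so that its mean can be compared with other integrals. *)
Lemma pole_free_radius f r s : meromorphic f -> 0 < r -> r < s ->
  exists2 x, r <= x <= s & forall z, cmod z = x -> ~ is_pole f z.
Proof.
move=> mf r0 rs; have s0 : 0 < s := lt_trans r0 rs.
have [ps ups Hps] := finite_poles mf s0.
have avoid (u : seq R) : exists2 x, r <= x <= s & x \notin u.
  have [d d0 Hd] : exists2 d, 0 < d & forall x, x \in u -> r < x -> r + d <= x.
    elim: u => [|y u [d d0 Hd]]; first by exists 1.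
    have [ry|yr] := ltP r y.
      exists (Num.min d (y - r)); first by rewrite lt_min d0 subr_gt0.
      move=> x; rewrite inE => /predU1P[-> _|/Hd H rx].
        by rewrite -lerBrDl ge_min lexx orbT.
      by apply: le_trans (H rx); rewrite lerD2l ge_min lexx.
    exists d => // x; rewrite inE => /predU1P[->|]; last exact: Hd.
    by rewrite ltNge yr.
  pose k := Num.min d (s - r) / 2.
  have m0 : 0 < Num.min d (s - r) by rewrite lt_min d0 subr_gt0.
  have k0 : 0 < k by rewrite divr_gt0.
  have /andP[kd ks] : (k < d) && (k < s - r).
    by rewrite -lt_min ltr_pdivrMr// mulr_natr mulr2n ltrDl.
  exists (r + k); first by rewrite lerDl (ltW k0)/= -lerBrDl ltW.
  apply/negP => /Hd; rewrite ltrDl => /(_ k0); rewrite lerD2l leNgt kd //.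
have [x /andP[rx xs] xu] := avoid [seq cmod a | a <- ps].
exists x; first by rewrite rx.
move=> z zx pz; move/negP: xu; apply; rewrite -zx map_f//; apply/Hps.
by rewrite zx.
Qed.

Lemma lposE x : 0 <= x -> lpos x = logplus x.
Proof.
move=> x0; rewrite /lpos /logplus; have [x1|x1] := leP x 1.
  by rewrite ln1; apply/esym/max_idPl; rewrite ln_le0.
by apply/esym/max_idPr; rewrite ln_ge0// ltW.
Qed.

Lemma two_pi_gt0 : 0 < 2 * pi :> R.
Proof. by rewrite mulr_gt0// pi_gt0. Qed.

Lemma m_itg f r : itg (fun x => lpos (cmod (f (r%:C%C * cis x)))) 0 (2 * pi) =
  Nevanlinna_m f r * (2 * pi).
Proof.
rewrite /Nevanlinna_m [RHS]mulrAC mulVf ?gt_eqF ?two_pi_gt0// mul1r.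
apply: eq_Rintegral => x _; rewrite lposE ?cmod_ge0//; congr (logplus (cmod (f _))).
by apply: eqC_ReIm; rewrite ?cReM ?cImM /= mul0r ?subr0 ?addr0.
Qed.

Lemma pole_prod_le1 f r ps z : 0 < r -> poles_in f r ps -> cmod z <= r ->
  cmod (pole_prod f r ps z) <= 1.
Proof.
move=> r0 [_ Hps] zr; rewrite cmod_prod big_seq; apply: prodr_ile1 => a /Hps[ar _].
rewrite cmod_ge0 /= cmodX exprn_ile1 ?cmod_ge0//.
rewrite cmodM cmodV cmodC ger0_norm ?mulr_ge0 ?(ltW r0)//.
rewrite ler_pdivrMr ?mulr_gt0// mul1r; apply: le_trans (cmodB _ _) _.
by rewrite mulr_natl mulr2n lerD.
Qed.

Lemma cmod_circle r x : 0 <= r -> cmod (r%:C%C * cis x : R[i]) = r.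
Proof. by move=> r0; rewrite cmodM cmodC cmod_cis mulr1 ger0_norm. Qed.

Section Cleared.
Variables (f g : R[i] -> R[i]) (r : R) (ps : seq R[i]).
Hypotheses (mf : meromorphic f) (r0 : 0 < r) (Hps : poles_in f r ps).
Hypothesis good : forall z, cmod z = r -> ~ is_pole f z.
Hypothesis hg : forall z, cmod z <= r -> holo g z.
Hypothesis gE : forall z, ~ is_pole f z -> g z = f z * pole_prod f r ps z.

Lemma mean_cleared :
  itg (fun x => lpos (cmod (g (0 + r%:C%C * cis x)))) 0 (2 * pi)
  <= Nevanlinna_m f r * (2 * pi).
Proof.
rewrite -m_itg; apply: le_itg.
- apply: continuous_icont; apply: (@circle_continuous _ g 0 r (@lpos R)) => //.
  + exact: ltW.
  + exact: continuous_lpos.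
  + by move=> z; rewrite subr0; exact: hg.
- move=> x _; apply: (@continuous_comp _ _ _ (fun x => cmod (f (r%:C%C * cis x))) (@lpos R)).
    apply: (@continuous_on_circle R (fun z => cmod (f z))); apply: cont_cmod.
    apply: derivableC_continuous; apply: meromorphic_derivable => //.
    by apply: good; rewrite cmod_circle// ltW.
  exact: continuous_lpos.
- move=> x _; rewrite add0r; apply: ler_lpos.
  have rE := @cmod_circle r x (ltW r0).
  rewrite gE; last exact: good.
  rewrite cmodM -[leRHS]mulr1 ler_wpM2l ?cmod_ge0//.
  by apply: pole_prod_le1 => //; rewrite rE.
Qed.

(** Clearing the poles only decreases |f| on the disc, so that the mean of log^+ |g| over
    the circle is at most m(r, f). *)
Lemma log_upper_cleared w : cmod w <= r / 2 -> lpos (cmod (g w)) <= 3 * Nevanlinna_m f r.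
Proof.
move=> wr; rewrite -(ler_pM2r two_pi_gt0) -mulrA.
apply: le_trans (@log_upper R g 0 r w r0 _ _) _; rewrite ?subr0//.
  by move=> z; rewrite subr0; exact: hg.
by rewrite ler_pM2l// mean_cleared.
Qed.

(** [log_lower] on a smaller circle, where log^+ |g| is bounded pointwise by
    [log_upper_cleared]. *)
Lemma log_lower_cleared w c d e : cmod (w - c) <= d / 2 -> 0 < d -> d + cmod c <= r / 2 ->
  0 < e <= 1 -> g w != 0 ->
  itg (fun x => lneg e (cmod (g (c + d%:C%C * cis x)))) 0 (2 * pi) <=
  3 * (2 * pi) * (9 * Nevanlinna_m f r - ln (cmod (g w))).
Proof.
move=> wc d0 dr e01 gw.
have r2 : r / 2 <= r by rewrite ler_pdivrMr// mulr_natr mulr2n lerDl ltW.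
have zr z : cmod (z - c) <= d -> cmod z <= r / 2.
  move=> zd; apply: le_trans dr; rewrite -{1}(subrK c z).
  by apply: le_trans (cmodD _ _) _; rewrite lerD2r.
have hg' z : cmod (z - c) <= d -> holo g z.
  by move=> /zr zr2; apply: hg; exact: le_trans r2.
apply: le_trans (@log_lower R g c d w e d0 hg' wc gw e01) _.
have : itg (fun x => lpos (cmod (g (c + d%:C%C * cis x)))) 0 (2 * pi) <=
    3 * Nevanlinna_m f r * (2 * pi).
  have -> : 3 * Nevanlinna_m f r * (2 * pi) = itg (fun=> 3 * Nevanlinna_m f r) 0 (2 * pi).
    by rewrite itg_cst ?(ltW two_pi_gt0)// subr0.
  apply: le_itg.
  - apply: continuous_icont; apply: (@circle_continuous _ g c d (@lpos R)) => //.
      exact: ltW.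
    exact: continuous_lpos.
  - exact: icont_cst.
  - move=> x _; apply: log_upper_cleared; apply: zr.
    by rewrite addrC addKr cmod_circle// ltW.
by lra.
Qed.

End Cleared.

Lemma ln_prod_pow (I : eqType) (n : I -> nat) (u : seq I) (q : I -> R) :
  (forall a : I, a \in u -> 0 < q a) ->
  0 < \prod_(a <- u) q a ^+ n a /\
  ln (\prod_(a <- u) q a ^+ n a) = \sum_(a <- u) (n a)%:R * ln (q a).
Proof.
elim: u => [|a u IH] qu; first by rewrite !big_nil ln1.
have qa : 0 < q a by apply: qu; rewrite mem_head.
have [IH1 IH2] := IH (fun (b : I) bu => qu b (mem_behead (s := a :: u) bu)).
have qn : 0 < q a ^+ n a by apply: exprn_gt0.
by rewrite !big_cons mulr_gt0// lnM ?posrE// IH2 lnXn// mulr_natl.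
Qed.

(** For z = c + d e^(i x) one has |z - a| = |d - conj(a - c) e^(i x)|, so that on the circle
    the product has the modulus of a function G of e^(i x) that is holomorphic on the unit
    disc and satisfies |G 0| = (d / 2 r)^n, n being the number of poles with
    multiplicity.  Then [log_lower] applies to G at its centre. *)
Lemma pole_prod_lower f r ps c d e : 0 < d -> d + cmod c <= r -> poles_in f r ps ->
  0 < e <= 1 ->
  itg (fun x => lneg e (cmod (pole_prod f r ps (c + d%:C%C * cis x)))) 0 (2 * pi) <=
  3 * (2 * pi) * (poles_weight f ps * ln (2 * r / d)).
Proof.
move=> d0 dr Hps e01.
have r0 : 0 < r by apply: lt_le_trans dr; rewrite ltr_wpDr// cmod_ge0.
pose G z : R[i] := \prod_(a <- ps) ((d%:C%C - (a - c)^*%C * z) / (2 * r)%:C%C) ^+ pole_mult f a.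
have hG z : holo G z.
  apply: (@holo_prod R _ ps (fun a z => ((d%:C%C - (a - c)^*%C * z) / (2 * r)%:C%C) ^+ pole_mult f a)) => a.
  move: ((a - c)^*%C) => b.
  have hl : holo (fun z => (d%:C%C - b * z) / (2 * r)%:C%C) z.
    apply: holoT => y.
    have d1 := @derivableCM _ (fun=> - b) (fun z => z) y (@derivableC_cst R (- b) y) (@derivableC_id R y).
    have d2 := @derivableCD _ (fun=> d%:C%C) (fun z => - b * z) y (@derivableC_cst R d%:C%C y) d1.
    have := @derivableCM _ (fun z => d%:C%C + - b * z) (fun=> (2 * r)%:C%C^-1) y d2 (@derivableC_cst R _ y).
    by apply: derivableC_near_eq; apply/nbhsCP; exists 1 => // v _; rewrite mulNr.
  elim: (pole_mult f a) => [|n IH].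
    rewrite (_ : (fun _ => _) = fun=> 1); first exact: holo_cst.
    by apply/funext => w; rewrite expr0.
  rewrite (_ : (fun _ => _) = fun z => (d%:C%C - b * z) / (2 * r)%:C%C * ((d%:C%C - b * z) / (2 * r)%:C%C) ^+ n).
    exact: (@holoM _ _ _ z hl IH).
  by apply/funext => w; rewrite exprS.
have GE x : cmod (pole_prod f r ps (c + d%:C%C * cis x)) = cmod (G (0 + 1%:C%C * cis x)).
  have -> : 0 + 1%:C%C * cis x = cis x :> R[i] by rewrite add0r; exact: mul1r.
  rewrite !cmod_prod; apply: eq_bigr => a _; rewrite !cmodX !cmodM; congr ((_ * _) ^+ _).
  have -> : c + d%:C%C * cis x - a = d%:C%C * cis x - (a - c) by ring.
  move: (a - c) => u; rewrite -cmod_conj.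
  have -> : (d%:C%C * cis x - u)^*%C = (d%:C%C - u^*%C * cis x) * cis (- x).
    rewrite mulrBl -mulrA -cisD subrr cis0 mulr1; case: u => u1 u2.
    by apply: eqC_ReIm; rewrite /= ?cosN ?sinN; ring.
  by rewrite cmodM cmod_cis mulr1.
have G0 : cmod (G 0) = \prod_(a <- ps) (d / (2 * r)) ^+ pole_mult f a.
  rewrite cmod_prod; apply: eq_bigr => a _; rewrite mulr0 subr0 cmodX cmodM cmodV !cmodC.
  by rewrite !ger0_norm ?mulr_ge0 ?(ltW r0) ?(ltW d0).
have q0 : 0 < d / (2 * r) by rewrite divr_gt0// mulr_gt0.
have lnG0 : - ln (cmod (G 0)) = poles_weight f ps * ln (2 * r / d).
  rewrite G0 (ln_prod_pow _ (fun _ _ => q0)).2 -mulr_suml.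
  by rewrite -[2 * r / d]invf_div lnV ?posrE// mulrN.
have G0n : G 0 != 0.
  by rewrite -cmod_gt0 G0; apply: prodr_gt0 => b _; rewrite exprn_gt0.
have hG' z : cmod (z - 0) <= 1 -> holo G z by move=> _; exact: hG.
have c01 : cmod (0 - 0 : R[i]) <= 1 / 2 by rewrite subrr cmod0.
have := @log_lower R G 0 1 0 e ltr01 hG' c01 G0n e01.
have -> : itg (fun x => lpos (cmod (G (0 + 1%:C%C * cis x)))) 0 (2 * pi) = 0.
  rewrite (@eq_itg _ _ (fun=> 0)) ?itg_cst ?mul0r ?(ltW two_pi_gt0)// => x _.
  rewrite -GE /lpos (max_idPr _) ?ln1//; apply: pole_prod_le1 => //.
  by apply: le_trans (cmodD _ _) _; rewrite cmod_circle ?(ltW d0)// addrC.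
rewrite mulr0 sub0r -mulrN lnG0 => H.
by rewrite (@eq_itg _ _ (fun x => lneg e (cmod (G (0 + 1%:C%C * cis x))))) // => x _; rewrite GE.
Qed.

(** The poles stay away from w, so that |w - a| is at least a fixed fraction of |a|, and
    the terms ln (2 r / |w - a|) are those of N(2 r) up to a constant. *)
Lemma pole_prod_ref f w : meromorphic f -> ~ is_pole f w ->
  exists2 K, 0 <= K & forall r ps, 1 <= r -> cmod w <= r -> poles_in f r ps ->
    pole_prod f r ps w != 0 /\
    - ln (cmod (pole_prod f r ps w)) <= K * Nevanlinna_N f (2 * r).
Proof.
move=> mf npw; have [d0 d00 Hd0] := poles_isolated w mf.
pose d := Num.min 1 d0; have d_0 : 0 < d by rewrite lt_min ltr01.
have far a : is_pole f a -> d <= cmod (w - a).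
  move=> pa; rewrite leNgt; apply/negP => wa.
  have [aw|aw] := eqVneq a w; first by rewrite aw in pa.
  apply: (derivable_not_pole _ pa); apply: Hd0.
  rewrite cmod_gt0 subr_eq0 aw /= cmod_distC; apply: lt_le_trans wa _.
  by rewrite ge_min lexx orbT.
(* for every pole a the distance of a to 0 is at most k |w - a| *)
pose k := 1 + (cmod w + 1) / d; have k1 : 1 <= k.
  by rewrite lerDl divr_ge0 ?addr_ge0 ?cmod_ge0 ?ler01 ?(ltW d_0).
have k0 : 0 < k := lt_le_trans ltr01 k1.
have pk a : is_pole f a -> pole_dist a <= k * cmod (w - a).
  move=> /far da; rewrite /k mulrDl mul1r.
  have h1 : cmod w + 1 <= (cmod w + 1) / d * cmod (w - a).
    by rewrite mulrAC ler_pdivlMr// ler_wpM2l// addr_ge0// cmod_ge0.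
  have h2 := cmod_ge0 w; have h3 := cmod_ge0 (w - a).
  rewrite /pole_dist; case: ifP => _; first by move: h1 h2 h3; clear; lra.
  have h4 : cmod a <= cmod (w - a) + cmod w.
    by rewrite cmod_distC -{1}(subrK w a); exact: cmodD.
  by move: h1 h2 h3 h4; clear; lra.
clearbody k d.
have l2 : 0 < ln 2 :> R by rewrite ln_gt0// ltr1n.
exists (1 + ln k / ln 2).
  by apply: addr_ge0 => //; apply: divr_ge0; [exact: ln_ge0|exact: ltW].
move=> r ps r1 wr Hps; have r0 : 0 < r := lt_le_trans ltr01 r1.
have r20 : 0 < 2 * r by rewrite mulr_gt0.
have [_ Hps'] := Hps.
have fac0 a : a \in ps -> 0 < cmod ((w - a) / (2 * r)%:C%C).
  move=> /Hps'[_ /far da]; rewrite cmodM cmodV cmodC gtr0_norm// divr_gt0//.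
  exact: lt_le_trans da.
have [prod0 lnP] := ln_prod_pow (pole_mult f) fac0.
have prodE : cmod (pole_prod f r ps w) =
    \prod_(a <- ps) cmod ((w - a) / (2 * r)%:C%C) ^+ pole_mult f a.
  by rewrite /pole_prod cmod_prod; apply: eq_bigr => a _; rewrite cmodX.
have lnE : - ln (cmod (pole_prod f r ps w)) =
    \sum_(a <- ps) (pole_mult f a)%:R * (ln (2 * r) - ln (cmod (w - a))).
  rewrite prodE lnP -sumrN big_seq [RHS]big_seq; apply: eq_bigr => a aps.
  have fa0 := fac0 a aps; rewrite -mulrN; congr (_ * _).
  rewrite cmodM cmodV cmodC gtr0_norm// in fa0 *.
  have wa0 : 0 < cmod (w - a) by move: fa0; rewrite pmulr_lgt0// invr_gt0.
  by rewrite lnM ?posrE ?invr_gt0// lnV ?posrE// opprD opprK addrC.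
split; first by rewrite -cmod_gt0 prodE.
rewrite lnE.
have rr2 : r <= 2 * r by rewrite ler_peMl ?ler1n// ltW.
have h1 := N_ge mf (le_trans r1 rr2) rr2 Hps.
have h2 := poles_weight_le mf r1 Hps.
apply: (@le_trans _ _ (\sum_(a <- ps) (pole_mult f a)%:R * (ln (2 * r) - ln (pole_dist a))
    + poles_weight f ps * ln k)).
  rewrite /poles_weight mulr_suml -big_split /= big_seq [leRHS]big_seq.
  apply: ler_sum => a /[dup] /fac0 fa0 /Hps'[_ pa].
  have wa0 : 0 < cmod (w - a) := lt_le_trans d_0 (far a pa).
  rewrite -mulrDr; apply: ler_wpM2l; first exact: ler0n.
  have kw0 : 0 < k * cmod (w - a) by apply: mulr_gt0.
  have kpos : k \is Num.pos := k0.
  have wpos : cmod (w - a) \is Num.pos := wa0.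
  have lnk : ln (pole_dist a) <= ln k + ln (cmod (w - a)).
    rewrite -(lnM kpos wpos) ler_ln; [exact: pk|exact: pole_dist_gt0|exact: kw0].
  by rewrite -addrA lerD2l lerNl opprD opprK lerBlDl.
rewrite [leRHS]mulrDl [1 * _]mul1r; apply: lerD; first exact: h1.
rewrite mulrC -mulrA; apply: ler_wpM2l; first exact: ln_ge0.
by rewrite mulrC ler_pdivlMr.
Qed.

End Estimates.

(** * The proximity function of the dominant coefficient *)

Section LogCalculus.
Variable R : realType.
Implicit Types (x y e : R).

Lemma lposM x y : 0 <= x -> 0 <= y -> lpos (x * y) <= lpos x + lpos y.
Proof.
move=> x0 y0; have mx : 0 < Num.max x 1 by rewrite lt_max ltr01 orbT.
have my : 0 < Num.max y 1 by rewrite lt_max ltr01 orbT.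
rewrite /lpos -lnM ?posrE// ler_ln ?posrE ?mulr_gt0 ?lt_max ?ltr01 ?orbT//.
rewrite ge_max; apply/andP; split.
  by apply: ler_pM => //; rewrite le_max lexx.
by apply: mulr_ege1; rewrite le_max lexx orbT.
Qed.

Lemma lposD x y : 0 <= x -> 0 <= y -> lpos (x + y) <= lpos x + (lpos y + ln 2).
Proof.
move=> x0 y0; have mx : 1 <= Num.max x 1 by rewrite le_max lexx orbT.
have my : 1 <= Num.max y 1 by rewrite le_max lexx orbT.
have xm : x <= Num.max x 1 by rewrite le_max lexx.
have ym : y <= Num.max y 1 by rewrite le_max lexx.
have mx0 := lt_le_trans ltr01 mx; have my0 := lt_le_trans ltr01 my.
rewrite /lpos -!lnM ?posrE ?mulr_gt0// ler_ln ?posrE ?mulr_gt0 ?lt_max ?ltr01 ?orbT//.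
rewrite ge_max; move: (Num.max x 1) (Num.max y 1) xm ym mx my mx0 my0; clear.
move=> X Y xX yY X1 Y1 X0 Y0.
have XY1 : X <= X * Y by rewrite ler_peMr// ltW.
have XY2 : Y <= X * Y by rewrite ler_peMl// ltW.
by apply/andP; split; move: xX yY X1 Y1 XY1 XY2; clear; lra.
Qed.

Lemma lpos_sum (I : Type) (s : seq I) (P : pred I) (F : I -> R) :
  (forall i, 0 <= F i) ->
  lpos (\sum_(i <- s | P i) F i) <= \sum_(i <- s | P i) (lpos (F i) + ln 2).
Proof.
move=> F0; elim: s => [|i s IH].
  by rewrite !big_nil /lpos (max_idPr _) ?ln1.
rewrite !big_cons; case: ifP => // _.
apply: le_trans (lposD (F0 i) _) _; first exact: sumr_ge0.
by rewrite -[leRHS]addrA lerD2l [leLHS]addrC lerD2l.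
Qed.

Lemma lneg_mono e e' x : 0 < e' -> e' <= e -> lneg e x <= lneg e' x.
Proof.
move=> e0 ee; have e0' := lt_le_trans e0 ee.
rewrite lerN2 ler_ln ?posrE ?lt_min ?lt_max ?ltr01 ?e0 ?e0' ?orbT//.
rewrite le_min !ge_min lexx !orbT andbT ge_max !le_max lexx ee !orbT //.
Qed.

Lemma lneg0 e : 0 < e <= 1 -> lneg e 0 = - ln e.
Proof. by move=> /andP[e0 e1]; rewrite /lneg (max_idPr (ltW e0)) (min_idPl e1). Qed.

Lemma lpos_div x y e : 0 <= x -> 0 < e -> e <= y -> lpos (x / y) <= lpos x + lneg e y.
Proof.
move=> x0 e0 ey; have y0 := lt_le_trans e0 ey.
rewrite /lneg (max_idPl ey) -lnV; last by rewrite posrE lt_min y0 ltr01.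
have m0 : 0 < Num.min y 1 by rewrite lt_min y0 ltr01.
rewrite /lpos -lnM ?posrE ?invr_gt0 ?lt_max ?ltr01 ?orbT//.
rewrite ler_ln ?posrE ?divr_gt0 ?lt_max ?ltr01 ?orbT//.
rewrite ge_max ler_pdivlMr// ler_pdivlMr// mul1r; apply/andP; split.
  rewrite mulrAC ler_pdivrMr//; apply: ler_pM => //; first exact: ltW.
    by rewrite le_max lexx.
  by rewrite ge_min lexx.
by rewrite ge_min [1 <= _]le_max lexx !orbT.
Qed.

End LogCalculus.

Section Core.
Variable R : realType.
Implicit Types (t s x y d e r : R) (a b z w : R[i]) (g : R[i] -> R[i]).

Definition cleared f r ps g : Prop :=
  [/\ poles_in f r ps, forall z, cmod z = r -> ~ is_pole f z,
    forall z, cmod z <= r -> @holo R g z &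
    forall z, ~ is_pole f z -> g z = f z * pole_prod f r ps z].

Lemma cleared_exists f r : meromorphic f -> 0 < r ->
  exists p : R * seq R[i] * (R[i] -> R[i]),
    4 * r <= p.1.1 <= 8 * r /\ cleared f p.1.1 p.1.2 p.2.
Proof.
move=> mf r0; have r40 : 0 < 4 * r by rewrite mulr_gt0.
have r48 : 4 * r < 8 * r by rewrite ltr_pM2r// ltr_nat.
have [x /andP[x4 x8] good] := pole_free_radius mf r40 r48.
have x0 := lt_le_trans r40 x4.
have [ps ups Hps] := finite_poles mf x0.
have [g hg gE] := clear_poles mf x0 (conj ups Hps).
by exists (x, ps, g); split; [rewrite x4|split].
Qed.

Lemma pole_prod_eq0 f r ps z : 0 < r -> poles_in f r ps -> cmod z <= r ->
  is_pole f z -> pole_prod f r ps z = 0.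
Proof.
move=> r0 [ups Hps] zr pz; have zps : z \in ps by apply/Hps.
rewrite /pole_prod (bigD1_seq z)//= subrr mul0r expr0n.
by rewrite gtn_eqF ?pole_mult_gt0// mul0r.
Qed.

Lemma itg_sum (I : Type) (s : seq I) (h : I -> R -> R) (a b : R) :
  (forall i, icont (h i) a b) ->
  icont (fun t => \sum_(i <- s) h i t) a b /\
  itg (fun t => \sum_(i <- s) h i t) a b = \sum_(i <- s) itg (h i) a b.
Proof.
move=> ch; elim: s => [|i s [IH1 IH2]].
  have -> : (fun t => \sum_(i <- [::]) h i t) = fun=> 0 by apply/funext => t; rewrite big_nil.
  split; first exact: icont_cst.
  by rewrite big_nil /itg /Rintegral integral0.
have -> : (fun t => \sum_(j <- i :: s) h j t) = fun t => h i t + \sum_(j <- s) h j t.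
  by apply/funext => t; rewrite big_cons.
by split; [exact: icontD|rewrite itgD// IH2 big_cons].
Qed.

Variables (I : finType) (A : I -> R[i] -> R[i]) (c : I -> R[i]) (f : R[i] -> R[i]) (m : I).
Hypotheses (mA : forall i, meromorphic (A i)) (mf : meromorphic f).
Hypothesis eqn : forall z, (forall i, ~ is_pole (A i) z) ->
  (forall i, ~ is_pole f (c i + z)) -> \sum_i A i z * f (c i + z) = 0.

Section Circle.
Variables (rho rf : R) (psf : seq R[i]) (gf : R[i] -> R[i]).
Variables (rA : I -> R) (psA : I -> seq R[i]) (gA : I -> R[i] -> R[i]).
Hypotheses (rho0 : 0 < rho) (rrA : forall i, 4 * rho <= rA i) (rrf : 4 * rho <= rf).
Hypothesis clA : forall i, cleared (A i) (rA i) (psA i) (gA i).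
Hypothesis clf : cleared f rf psf gf.
Hypothesis crho : forall i, cmod (c i) <= rho.

Let BA i z := pole_prod (A i) (rA i) (psA i) z.
Let Bf z := pole_prod f rf psf z.
Let K0 : R := \sum_(i | i != m)
  (3 * Nevanlinna_m (A i) (rA i) + 3 * Nevanlinna_m f rf + ln 2).

(** The constant K0 bounds the log^+ of the cleared numerators on the circle of radius
    rho; the terms in e make up for the small denominators, namely the pole products of
    the coefficients and of the translates of f, and the cleared f(z + c_m). *)
Definition majorant e x : R := K0
  + (\sum_i lneg e (cmod (BA i (0 + rho%:C%C * cis x)))
  + (\sum_i lneg e (cmod (Bf (c i + rho%:C%C * cis x)))
  + lneg e (cmod (gf (c m + rho%:C%C * cis x))))).

Lemma rf0 : 0 < rf.
Proof. by apply: lt_le_trans rrf; rewrite mulr_gt0. Qed.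

Lemma rA0 i : 0 < rA i.
Proof. by apply: lt_le_trans (rrA i); rewrite mulr_gt0. Qed.

Lemma ln2_gt0 : 0 < ln 2 :> R.
Proof. by rewrite ln_gt0// ltr1n. Qed.

Lemma K0_ge0 : 0 <= K0.
Proof.
apply: sumr_ge0 => i _; apply: addr_ge0; last exact: ltW ln2_gt0.
by apply: addr_ge0; apply: mulr_ge0 => //; exact: m_ge0.
Qed.

Lemma sum_lneg_ge0 e (F : I -> R) : 0 < e -> 0 <= \sum_i lneg e (F i).
Proof. by move=> e0; apply: sumr_ge0 => i _; exact: lneg_ge0. Qed.

Lemma term_le_sum (F : I -> R) i : (forall j, 0 <= F j) -> F i <= \sum_j F j.
Proof. by move=> F0; rewrite (bigD1 i)//= lerDl sumr_ge0. Qed.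

Lemma small_pole_bound M : exists n : nat, forall e, 0 < e -> e <= n.+1%:R^-1 -> M <= - ln e.
Proof.
have [n _ Hn] := near_infty_natSinv_lt (PosNum (expR_gt0 (- M))).
exists n => e e0 en; rewrite lerNr -[- M]expRK ler_ln ?posrE ?expR_gt0//.
by apply: le_trans en _; apply: ltW; exact: (Hn n (leqnn n)).
Qed.

Lemma shift_le i x : cmod (c i + rho%:C%C * cis x) <= rf / 2.
Proof.
apply: le_trans (cmodD _ _) _; rewrite cmod_circle ?(ltW rho0)// ler_pdivlMr//.
by move: (crho i) rrf; lra.
Qed.

Lemma shift_rf i : rho + cmod (c i) <= rf / 2.
Proof. by rewrite ler_pdivlMr//; move: (crho i) rrf; lra. Qed.

Lemma rho_rA i : rho + cmod (0 : R[i]) <= rA i.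
Proof. by rewrite cmod0 addr0; move: (rrA i) rho0; lra. Qed.

Lemma rf2 : rf / 2 <= rf.
Proof. by rewrite ler_pdivrMr// mulr_natr mulr2n lerDl ltW// rf0. Qed.

(** Where a denominator vanishes the majorant exceeds any bound as e tends to 0. *)
Lemma zero_big (Q : R -> R) M : 
  (forall e, 0 < e <= 1 -> lneg e 0 <= Q e) -> exists n : nat, M <= Q n.+1%:R^-1.
Proof.
move=> HQ; have [n Hn] := small_pole_bound M.
have e0 : 0 < n.+1%:R^-1 :> R by rewrite invr_gt0.
have e1 : n.+1%:R^-1 <= 1 :> R by rewrite invf_le1// ler1n.
by exists n; apply: le_trans (HQ _ _); rewrite ?lneg0 ?e0//; exact: Hn.
Qed.

(** If no denominator vanishes at the point, the equation holds there and expresses A_m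
    through the other coefficients and the translates of f; otherwise [zero_big] applies,
    and nothing has to be known about A_m at the point. *)
Lemma majorant_dominates x : exists n : nat,
  lpos (cmod (A m (rho%:C%C * cis x))) <= majorant n.+1%:R^-1 x.
Proof.
set z := rho%:C%C * cis x; have zrho : cmod z = rho by rewrite cmod_circle ?(ltW rho0).
have z0E : 0 + z = z by rewrite add0r.
have zrA i : cmod z <= rA i / 2.
  by rewrite zrho ler_pdivlMr//; move: (rrA i) rho0; lra.
have zrA' i : cmod z <= rA i.
  by apply: le_trans (zrA i) _; rewrite ler_pdivrMr// mulr_natr mulr2n lerDl ltW// rA0.
have K00 := K0_ge0.
have [[i Bi0]|nBA] := pselect (exists i, BA i z = 0).
  apply: (@zero_big (fun e => majorant e x)) => e /andP[e0 _]; rewrite /majorant -/z z0E.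
  have h1 := @term_le_sum (fun i => lneg e (cmod (BA i z))) i (fun j => lneg_ge0 _ e0).
  have h2 := @sum_lneg_ge0 e (fun i => cmod (Bf (c i + z))) e0.
  have h3 := @lneg_ge0 R e (cmod (gf (c m + z))) e0.
  rewrite Bi0 cmod0 in h1; apply: le_trans h1 _.
  by move: h2 h3 K00; lra.
have [[i Bi0]|nBf] := pselect (exists i, Bf (c i + z) = 0).
  apply: (@zero_big (fun e => majorant e x)) => e /andP[e0 _]; rewrite /majorant -/z z0E.
  have h1 := @term_le_sum (fun i => lneg e (cmod (Bf (c i + z)))) i (fun j => lneg_ge0 _ e0).
  have h2 := @sum_lneg_ge0 e (fun i => cmod (BA i z)) e0.
  have h3 := @lneg_ge0 R e (cmod (gf (c m + z))) e0.
  rewrite Bi0 cmod0 in h1; apply: le_trans h1 _.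
  by move: h2 h3 K00; lra.
have [gf0|gfn0] := eqVneq (gf (c m + z)) 0.
  apply: (@zero_big (fun e => majorant e x)) => e /andP[e0 _]; rewrite /majorant -/z z0E gf0 cmod0.
  have h1 := @sum_lneg_ge0 e (fun i => cmod (BA i z)) e0.
  have h2 := @sum_lneg_ge0 e (fun i => cmod (Bf (c i + z))) e0.
  by move: h1 h2 K00; lra.
have npA i : ~ is_pole (A i) z.
  have [Hps _ _ _] := clA i; move=> /(pole_prod_eq0 (rA0 i) Hps (zrA' i)) E.
  by apply: nBA; exists i.
have [Hpsf goodf hgf gfE] := clf.
have npf i : ~ is_pole f (c i + z).
  move=> /(pole_prod_eq0 rf0 Hpsf (le_trans (shift_le i x) rf2)) E.
  by apply: nBf; exists i.
have eqz := eqn npA npf.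
have BAn i : BA i z != 0 by apply/eqP => E; apply: nBA; exists i.
have Bfn i : Bf (c i + z) != 0 by apply/eqP => E; apply: nBf; exists i.
have fm0 : f (c m + z) != 0.
  by apply: contraNneq gfn0 => E; rewrite gfE// E mul0r.
(* for e below mu none of the truncations is active *)
pose mu : R := Num.min (cmod (gf (c m + z)))
  (\big[Num.min/1]_i Num.min (cmod (BA i z)) (cmod (Bf (c i + z)))).
have mu0 : 0 < mu.
  rewrite lt_min cmod_gt0 gfn0 /=; elim/big_ind: _ => // [u v u0 v0|i _].
    by rewrite lt_min u0.
  by rewrite lt_min !cmod_gt0 BAn Bfn.
have [n _ Hn] := near_infty_natSinv_lt (PosNum mu0).
exists n; have {Hn} := Hn n (leqnn n); rewrite /=.
have e0 : 0 < n.+1%:R^-1 :> R by rewrite invr_gt0.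
move: (n.+1%:R^-1) e0 => e e0; rewrite lt_min => /andP[eg eB].
have eBi i : e <= cmod (BA i z) /\ e <= cmod (Bf (c i + z)).
  have : e <= Num.min (cmod (BA i z)) (cmod (Bf (c i + z))).
    apply: le_trans (ltW eB) _; rewrite (bigD1 i)//= ge_min lexx //.
  by rewrite le_min => /andP[].
have AmE : cmod (A m z) <=
    (\sum_(i | i != m) cmod (A i z) * cmod (f (c i + z))) * (1 / cmod (f (c m + z))).
  rewrite div1r ler_pdivlMr ?cmod_gt0// -cmodM.
  have -> : A m z * f (c m + z) = - \sum_(i | i != m) A i z * f (c i + z).
    by apply/eqP; rewrite -addr_eq0; apply/eqP; rewrite -[RHS]eqz [RHS](bigD1 m).
  rewrite cmodN; apply: le_trans (cmod_sum _ _ _) _.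
  by apply: ler_sum => i _; rewrite cmodM.
apply: le_trans (ler_lpos AmE) _.
apply: le_trans (lposM _ _) _.
- by apply: sumr_ge0 => i _; rewrite mulr_ge0 ?cmod_ge0.
- by rewrite divr_ge0 ?cmod_ge0.
have L1 : lpos (1 / cmod (f (c m + z))) <= lneg e (cmod (gf (c m + z))).
  have -> : 1 / cmod (f (c m + z)) = cmod (Bf (c m + z)) / cmod (gf (c m + z)).
    rewrite gfE// cmodM -/(Bf _); have := Bfn m; have := fm0; rewrite -!cmod_gt0.
    by move=> /gt_eqF f0 /gt_eqF b0; field; rewrite f0 b0.
  apply: le_trans (lpos_div (cmod_ge0 _) e0 (ltW eg)) _.
  rewrite /lpos (max_idPr _) ?ln1 ?add0r//.
  by apply: pole_prod_le1 rf0 Hpsf _; exact: le_trans (shift_le m x) rf2.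
have L2 i : lpos (cmod (A i z)) <= 3 * Nevanlinna_m (A i) (rA i) + lneg e (cmod (BA i z)).
  have [Hps goodA hgA gAE] := clA i.
  have -> : cmod (A i z) = cmod (gA i z) / cmod (BA i z).
    by rewrite gAE// cmodM mulfK// gt_eqF// cmod_gt0 BAn.
  apply: le_trans (lpos_div (cmod_ge0 _) e0 (eBi i).1) _; rewrite lerD2r.
  exact: (log_upper_cleared (mA i) (rA0 i) Hps goodA hgA gAE (zrA i)).
have L3 i : lpos (cmod (f (c i + z))) <=
    3 * Nevanlinna_m f rf + lneg e (cmod (Bf (c i + z))).
  have -> : cmod (f (c i + z)) = cmod (gf (c i + z)) / cmod (Bf (c i + z)).
    by rewrite gfE// cmodM mulfK// gt_eqF// cmod_gt0 Bfn.
  apply: le_trans (lpos_div (cmod_ge0 _) e0 (eBi i).2) _; rewrite lerD2r.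
  exact: (log_upper_cleared mf rf0 Hpsf goodf hgf gfE (shift_le i x)).
rewrite /majorant -/z z0E !addrA lerD//.
apply: le_trans (lpos_sum _ _ _) _ => [i|]; first by rewrite mulr_ge0 ?cmod_ge0.
apply: (@le_trans _ _ (K0 + (\sum_(i | i != m) lneg e (cmod (BA i z))
   + \sum_(i | i != m) lneg e (cmod (Bf (c i + z)))))).
  rewrite /K0 -!big_split /=; apply: ler_sum => i _.
  have := lposM (cmod_ge0 (A i z)) (cmod_ge0 (f (c i + z))).
  by move: (L2 i) (L3 i); lra.
rewrite addrA; apply: lerD; first rewrite lerD2l.
  by rewrite [leRHS](bigD1 m)//= lerDr lneg_ge0.
by rewrite [leRHS](bigD1 m)//= lerDr lneg_ge0.
Qed.

Lemma majorant_ge0 e x : 0 < e -> 0 <= majorant e x.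
Proof.
move=> e0; apply: addr_ge0; first exact: K0_ge0.
by do 2 (apply: addr_ge0; first exact: sum_lneg_ge0); exact: lneg_ge0.
Qed.

Lemma majorant_mono e e' x : 0 < e' -> e' <= e -> majorant e x <= majorant e' x.
Proof.
move=> e0 ee; rewrite /majorant lerD2l; apply: lerD.
  by apply: ler_sum => i _; exact: lneg_mono.
by apply: lerD; [apply: ler_sum => i _|]; exact: lneg_mono.
Qed.

Lemma pole_prod_circle_cont g' r ps e z : 0 < e ->
  icont (fun x => lneg e (cmod (pole_prod g' r ps (z + rho%:C%C * cis x)))) 0 (2 * pi).
Proof.
move=> e0; apply: continuous_icont.
apply: (@circle_continuous R (pole_prod g' r ps) z rho (lneg e)); first exact: ltW.
  exact: continuous_lneg.
by move=> y _; apply: holoT => v; exact: derivable_pole_prod.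
Qed.

Lemma gf_circle_cont e : 0 < e ->
  icont (fun x => lneg e (cmod (gf (c m + rho%:C%C * cis x)))) 0 (2 * pi).
Proof.
move=> e0; apply: continuous_icont.
apply: (@circle_continuous R gf (c m) rho (lneg e)); first exact: ltW.
  exact: continuous_lneg.
have [_ _ hgf _] := clf => y ym; apply: hgf.
rewrite -(subrK (c m) y); apply: le_trans (cmodD _ _) _.
by move: ym (crho m) rrf rho0; lra.
Qed.

Lemma majorant_integral e w : 0 < e <= 1 -> cmod (w - c m) <= rho / 2 -> gf w != 0 ->
  icont (majorant e) 0 (2 * pi) /\
  itg (majorant e) 0 (2 * pi) <= (K0
    + (\sum_i 3 * (poles_weight (A i) (psA i) * ln (2 * rA i / rho))
    + (\sum_(i in I) 3 * (poles_weight f psf * ln (2 * rf / rho))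
    + 3 * (9 * Nevanlinna_m f rf - ln (cmod (gf w)))))) * (2 * pi).
Proof.
move=> e01 wm gfw; have /andP[e0 e1] := e01.
have [c1 i1] := @itg_sum I (index_enum I)
  (fun i x => lneg e (cmod (BA i (0 + rho%:C%C * cis x)))) 0 (2 * pi)
  (fun i => @pole_prod_circle_cont (A i) (rA i) (psA i) e 0 e0).
have [c2 i2] := @itg_sum I (index_enum I)
  (fun i x => lneg e (cmod (Bf (c i + rho%:C%C * cis x)))) 0 (2 * pi)
  (fun i => @pole_prod_circle_cont f rf psf e (c i) e0).
have c3 := gf_circle_cont e0.
have c23 := icontD c2 c3; have c123 := icontD c1 c23.
have ck : icont (fun=> K0) 0 (2 * pi) by exact: icont_cst.
split; first exact: (icontD ck c123).
rewrite /majorant (itgD ck c123) (itgD c1 c23) (itgD c2 c3) itg_cst ?(ltW (two_pi_gt0 R))//.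
rewrite subr0 i1 i2 [leRHS]mulrDl lerD2l [leRHS]mulrDl; apply: lerD.
  rewrite mulr_suml; apply: ler_sum => i _; have [Hps _ _ _] := clA i.
  by have := pole_prod_lower rho0 (rho_rA i) Hps e01; rewrite -/(BA i _) mulrAC.
have [Hpsf goodf hgf gfE] := clf.
rewrite [leRHS]mulrDl; apply: lerD.
  rewrite mulr_suml; apply: ler_sum => i _.
  by have := pole_prod_lower rho0 (le_trans (shift_rf i) rf2) Hpsf e01; rewrite -/(Bf _) mulrAC.
rewrite mulrAC.
exact: (log_lower_cleared mf rf0 Hpsf goodf hgf gfE wm rho0 (shift_rf m) e01 gfw).
Qed.

Lemma mean_bound w : cmod (w - c m) <= rho / 2 -> gf w != 0 ->
  Nevanlinna_m (A m) rho <= K0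
    + (\sum_i 3 * (poles_weight (A i) (psA i) * ln (2 * rA i / rho))
    + (\sum_(i in I) 3 * (poles_weight f psf * ln (2 * rf / rho))
    + 3 * (9 * Nevanlinna_m f rf - ln (cmod (gf w))))).
Proof.
move=> wm gfw; rewrite -(ler_pM2r (two_pi_gt0 R)) -m_itg.
have en (n : nat) : 0 < (n.+1%:R^-1 : R) <= 1 by rewrite invr_gt0 ltr0n invf_le1// ler1n.
have en0 (n : nat) : 0 < n.+1%:R^-1 :> R by rewrite invr_gt0.
apply: (@itg_le_lim R _ (fun n => majorant n.+1%:R^-1)).
- by move=> t _; exact: lpos_ge0.
- by move=> n; have [] := majorant_integral (en n) wm gfw.
- by move=> n t; exact: majorant_ge0.
- move=> n p t np; apply: majorant_mono => //.
  by rewrite lef_pV2 ?posrE// ler_nat.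
- by move=> n; have [] := majorant_integral (en n) wm gfw.
- by move=> t _; exact: majorant_dominates.
Qed.

End Circle.

(** The reference point w, at which f neither vanishes nor has a pole, bounds the mean of
    log^- |f(z + c_m)| from above, as in Jensen's formula.  The radii around the poles are
    chosen between 4 rho and 8 rho, and the number of poles is bounded by N at twice that
    radius, whence the range up to 16 rho. *)
Lemma core_estimate w : ~ is_pole f w -> f w != 0 ->
  exists C rho0 : R, forall rho Phi, rho0 <= rho -> 0 <= Phi ->
    (forall i r, i != m -> 4 * rho <= r <= 16 * rho -> Nevanlinna_T (A i) r <= Phi) ->
    (forall r, 4 * rho <= r <= 16 * rho -> Nevanlinna_T f r <= Phi) ->
    (forall r, 4 * rho <= r <= 16 * rho -> Nevanlinna_N (A m) r <= Phi) ->
    Nevanlinna_m (A m) rho <= C * (Phi + 1).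
Proof.
move=> npw fw0; have [K K0 HK] := pole_prod_ref mf npw.
pose N : R := #|I|%:R; pose L := `|ln (cmod (f w))|.
(* the four contributions S1, ..., S4 below to the bound of [mean_bound] *)
pose C := N * 6 + N * ln 2 + N * 12 + N * 12 + 3 * (9 + K + L).
pose rho0 := 1 + \sum_i cmod (c i) + 2 * (cmod (w - c m) + cmod w).
exists C, rho0 => rho Phi rr Phi0 TA Tf NA.
have sc0 : 0 <= \sum_i cmod (c i) by apply: sumr_ge0 => i _; exact: cmod_ge0.
have wc0 := cmod_ge0 (w - c m); have w0 := cmod_ge0 w.
have rho1 : 1 <= rho by move: rr; rewrite /rho0; lra.
have rho_gt0 : 0 < rho := lt_le_trans ltr01 rho1.
have crho i : cmod (c i) <= rho.
  have : cmod (c i) <= \sum_j cmod (c j) by apply: (@term_le_sum (fun j => cmod (c j))) => j; exact: cmod_ge0.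
  by move: rr; rewrite /rho0; lra.
have wrho : cmod (w - c m) <= rho / 2 by rewrite ler_pdivlMr//; move: rr; rewrite /rho0; lra.
have [D HD] := choice (fun i => cleared_exists (mA i) rho_gt0).
have [[[rf psf] gf] /= [/andP[rf4 rf8] clf]] := cleared_exists mf rho_gt0.
pose rA i := (D i).1.1; pose psA i := (D i).1.2; pose gA i := (D i).2.
have rrA i : 4 * rho <= rA i by have [/andP[]] := HD i.
have rrA8 i : rA i <= 8 * rho by have [/andP[]] := HD i.
have clA i : cleared (A i) (rA i) (psA i) (gA i) by have [] := HD i.
have l2 : 0 < ln 2 :> R by exact: ln2_gt0.
have ln16 : ln 16 = 4 * ln 2 :> R.
  have -> : 16 = 2 ^+ 4 :> R by rewrite -natrX.
  by rewrite lnXn// mulr_natl.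
have lnr r : 4 * rho <= r -> r <= 8 * rho -> 0 <= ln (2 * r / rho) <= 4 * ln 2.
  move=> r4 r8; have r0 : 0 < r by apply: lt_le_trans r4; rewrite mulr_gt0.
  have q0 : 0 < 2 * r / rho by rewrite divr_gt0// mulr_gt0.
  rewrite ln_ge0 -?ln16 ?ler_ln ?posrE//=.
    by rewrite ler_pdivrMr//; move: r8; lra.
  by rewrite ler_pdivlMr//; move: r4 rho_gt0; lra.
have weight g ps r : meromorphic g -> 4 * rho <= r -> r <= 8 * rho -> poles_in g r ps ->
    Nevanlinna_N g (2 * r) <= Phi -> poles_weight g ps * ln (2 * r / rho) <= 4 * Phi.
  move=> mg r4 r8 Hps NPhi; have /andP[q0 q4] := lnr r r4 r8.
  have r1 : 1 <= r by move: r4 rho1; lra.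
  have h1 := poles_weight_le mg r1 Hps.
  have W0 : 0 <= poles_weight g ps by apply: sumr_ge0.
  apply: le_trans (ler_wpM2l W0 q4) _.
  by move: h1 NPhi; rewrite mulrCA; lra.
have NleT g r : Nevanlinna_N g r <= Nevanlinna_T g r by rewrite /Nevanlinna_T lerDr m_ge0.
have mleT g r : meromorphic g -> 1 <= r -> Nevanlinna_m g r <= Nevanlinna_T g r.
  by move=> mg r1; rewrite /Nevanlinna_T lerDl N_ge0.
have NA' i r : 4 * rho <= r <= 16 * rho -> Nevanlinna_N (A i) r <= Phi.
  have [->|im] := eqVneq i m; first exact: NA.
  by move=> rr'; apply: le_trans (NleT _ _) (TA _ _ im rr').
have mf' : Nevanlinna_m f rf <= Phi.
  apply: le_trans (mleT f rf mf _) (Tf _ _); first by move: rf4 rho1; lra.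
  by move: rf4 rf8 rho_gt0; lra.
have mA' i : i != m -> Nevanlinna_m (A i) (rA i) <= Phi.
  move=> im; apply: le_trans (mleT _ _ (mA i) _) (TA _ _ im _).
    by move: (rrA i) rho1; lra.
  by move: (rrA i) (rrA8 i) rho_gt0; lra.
have [Hpsf goodf hgf gfE] := clf.
have rf1 : 1 <= rf by move: rf4 rho1; lra.
have wrf : cmod w <= rf by move: rr rf4 rho_gt0; rewrite /rho0; lra.
have [Bw0 lnBw] := HK rf psf rf1 wrf Hpsf.
have gfw : gf w != 0 by rewrite gfE// mulf_neq0.
apply: le_trans (mean_bound rho_gt0 rrA rf4 clA clf crho wrho gfw) _.
have Nf : Nevanlinna_N f (2 * rf) <= Phi.
  apply: le_trans (NleT _ _) (Tf _ _); move: rf4 rf8 rho_gt0; lra.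
have cN (x : R) : \sum_(i in I) x = N * x by rewrite sumr_const mulr_natl.
have S1 : \sum_(i | i != m) (3 * Nevanlinna_m (A i) (rA i) + 3 * Nevanlinna_m f rf + ln 2)
    <= N * (6 * Phi + ln 2).
  rewrite -cN; apply: (@le_trans _ _ (\sum_(i | i != m) (6 * Phi + ln 2))).
    by apply: ler_sum => i /mA' h; move: h mf'; lra.
  rewrite [leRHS](bigD1 m)//= lerDr; move: Phi0 l2; lra.
have S2 : \sum_i 3 * (poles_weight (A i) (psA i) * ln (2 * rA i / rho)) <= N * (12 * Phi).
  rewrite -cN; apply: ler_sum => i _; have [Hps _ _ _] := clA i.
  have := weight (A i) (psA i) (rA i) (mA i) (rrA i) (rrA8 i) Hps.
  have h : 4 * rho <= 2 * rA i <= 16 * rho by move: (rrA i) (rrA8 i) rho_gt0; lra.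
  by move=> /(_ (NA' i _ h)); lra.
have S3 : \sum_(i in I) 3 * (poles_weight f psf * ln (2 * rf / rho)) <= N * (12 * Phi).
  rewrite cN; apply: ler_wpM2l => //.
  by have := weight f psf rf mf rf4 rf8 Hpsf Nf; lra.
have S4 : - ln (cmod (gf w)) <= L + K * Phi.
  rewrite gfE// cmodM lnM ?posrE ?cmod_gt0// opprD; apply: lerD.
    by rewrite /L -normrN ler_norm.
  by apply: le_trans lnBw _; apply: ler_wpM2l.
have N0 : 0 <= N := ler0n _ _.
have L0 : 0 <= L := normr_ge0 _.
apply: le_trans (lerD S1 (lerD S2 (lerD S3 (ler_wpM2l _ (lerD (ler_wpM2l _ mf') S4))))) _ => //.
rewrite /C; clear -N0 L0 K0 Phi0 l2.
move: (ln 2) l2 => l l2.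
have h1 := mulr_ge0 N0 Phi0; have h2 := mulr_ge0 N0 (ltW l2).
have h3 := mulr_ge0 h1 (ltW l2); have h4 := mulr_ge0 L0 Phi0.
lra.
Qed.

End Core.

(** * Growth of rational and nonrational functions *)

Section Rational.
Variable R : realType.
Implicit Types (t s x y d e r C : R) (a b z w : R[i]) (f g : R[i] -> R[i]) (P Q : {poly R[i]}).

Lemma poly_upper P : exists C, 0 <= C /\
  forall z, 1 <= cmod z -> cmod P.[z] <= C * cmod z ^+ size P.
Proof.
exists (\sum_(i < size P) cmod P`_i); split.
  by apply: sumr_ge0 => i _; exact: cmod_ge0.
move=> z z1; rewrite horner_coef mulr_suml.
apply: le_trans (cmod_sum _ _ _) _; apply: ler_sum => i _.
rewrite cmodM cmodX; apply: ler_wpM2l; first exact: cmod_ge0.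
by apply: ler_weXn2l => //; exact: ltnW.
Qed.

(** Beyond 1 + |a| for every root a, each linear factor has modulus at least 1. *)
Lemma poly_lower Q : Q != 0 -> exists c r, 0 < c /\
  forall z, r <= cmod z -> c <= cmod Q.[z].
Proof.
move=> Q0; have [u Qu] := closed_field_poly_normal Q.
exists (cmod (lead_coef Q)), (1 + \sum_(a <- u) cmod a); split.
  by rewrite cmod_gt0 lead_coef_eq0.
move=> z zr; rewrite {2}Qu hornerZ cmodM horner_prod cmod_prod.
rewrite ler_peMr ?cmod_ge0//.
elim: u zr {Qu} => [|a u IH] zr; first by rewrite big_nil.
have ca := cmod_ge0 a; have su : 0 <= \sum_(b <- u) cmod b by apply: sumr_ge0 => b _; exact: cmod_ge0.
rewrite big_cons in zr; rewrite big_cons; apply: mulr_ege1; last first.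
  by apply: IH; move: zr ca; clear; lra.
rewrite hornerXsubC; apply: le_trans (cmodB_ge z a).
by move: zr su; clear; lra.
Qed.

Lemma rational_bound f : rational_function f -> exists C r0 (n : nat),
  [/\ 0 <= C, 1 <= r0 & forall z, r0 <= cmod z -> cmod (f z) <= C * cmod z ^+ n].
Proof.
move=> [P [Q [Q0 fE]]]; have [C [C0 HC]] := poly_upper P.
have [c [r [c0 Hc]]] := poly_lower Q0.
exists (C / c), (Num.max 1 r), (size P); split.
- by rewrite divr_ge0// ltW.
- by rewrite le_max lexx.
move=> z; rewrite ge_max => /andP[z1 zr].
have Qz := Hc z zr; have Qz0 : 0 < cmod Q.[z] := lt_le_trans c0 Qz.
rewrite fE -?cmod_gt0// cmodM cmodV ler_pdivrMr//.
have hq : 1 <= cmod Q.[z] / c by rewrite ler_pdivlMr// mul1r.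
have hX : 0 <= C * cmod z ^+ size P by rewrite mulr_ge0// exprn_ge0// cmod_ge0.
apply: le_trans (HC z z1) _; rewrite -[leLHS]mulr1.
have -> : C / c * cmod z ^+ size P * cmod Q.[z] = C * cmod z ^+ size P * (cmod Q.[z] / c).
  by ring.
exact: ler_wpM2l.
Qed.

Lemma rational_far_poles f : rational_function f -> exists2 r0, 1 <= r0 &
  forall a, is_pole f a -> cmod a <= r0.
Proof.
move=> /rational_bound[C [r0 [n [C0 r1 HC]]]]; exists r0 => // a pa.
rewrite leNgt; apply/negP => ra.
have d0 : 0 < cmod a - r0 by rewrite subr_gt0.
apply: (@bounded_not_pole _ f a (C * (2 * cmod a) ^+ n) _ d0) pa => z /andP[_ zd].
have zr : r0 <= cmod z.
  have := cmodB_ge a z; rewrite cmod_distC => h; move: h zd; clear; lra.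
apply: le_trans (HC z zr) _; apply: ler_wpM2l => //.
apply: lerXn2r; rewrite ?nnegrE ?cmod_ge0 ?mulr_ge0 ?cmod_ge0//.
rewrite -(subrK a z); apply: le_trans (cmodD _ _) _.
by move: zd r1; clear; lra.
Qed.

Lemma m_le_bound f r M : (forall t, lpos (cmod (f (r%:C%C * cis t))) <= M) ->
  Nevanlinna_m f r <= M.
Proof.
move=> H; have p0 := two_pi_gt0 R; have M0 : 0 <= M := le_trans (lpos_ge0 _) (H 0).
rewrite -(ler_pM2r p0) -m_itg.
apply: (@itg_le_lim R _ (fun _ _ => M)) => //.
- by move=> t _; exact: lpos_ge0.
- by move=> _; exact: icont_cst.
- by move=> _; rewrite itg_cst ?(ltW p0)// subr0.
- by move=> t _; exists 0%N.
Qed.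

(** Outside a disc f has no pole and grows polynomially: m and N are both O(ln r). *)
Lemma rational_T f : meromorphic f -> rational_function f ->
  exists C r0, forall r, r0 <= r -> Nevanlinna_T f r <= C * ln r.
Proof.
move=> mf rf; have [C [r0 [n [C0 r01 HC]]]] := rational_bound rf.
have [r1 r11 Hr1] := rational_far_poles rf.
have r1_gt0 : 0 < r1 := lt_le_trans ltr01 r11.
have [ps ups Hps] := finite_poles mf r1_gt0.
have Hps' r : r1 <= r -> poles_in f r ps.
  move=> rr; split=> // a; split.
    by move=> /Hps[ar pa]; split => //; exact: le_trans rr.
  by move=> [_ pa]; apply/Hps; split => //; exact: Hr1.
pose W := poles_weight f ps; have W0 : 0 <= W by apply: sumr_ge0.
pose L := \sum_(a <- ps) (pole_mult f a)%:R * `|ln (pole_dist a)|.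
have L0 : 0 <= L by apply: sumr_ge0 => a _; rewrite mulr_ge0.
exists (lpos C + n%:R + W + L), (Num.max r0 (Num.max r1 (expR 1))) => r.
rewrite !ge_max => /and3P[rr0 rr1 re].
have r_gt0 : 0 < r := lt_le_trans ltr01 (le_trans r01 rr0).
have l1 : 1 <= ln r by rewrite -[1]expRK ler_ln ?posrE ?expR_gt0.
have l0 : 0 <= ln r := le_trans ler01 l1.
have hm : Nevanlinna_m f r <= lpos C + n%:R * ln r.
  apply: m_le_bound => t; have rE := cmod_circle t (ltW r_gt0).
  apply: le_trans (ler_lpos (HC _ _)) _; rewrite rE//.
  apply: le_trans (lposM C0 _) _; first by rewrite exprn_ge0// ltW.
  rewrite lerD2l mulr_natl -lnXn//; apply: (@le_trans _ _ (ln (Num.max (r ^+ n) 1))) => //.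
  rewrite (max_idPl _)//; apply: exprn_ege1; exact: le_trans r01 rr0.
have hN : Nevanlinna_N f r <= W * ln r + L.
  rewrite (N_formula r_gt0 (Hps' r rr1)) /W /L /poles_weight mulr_suml -big_split /=.
  apply: ler_sum => a _; rewrite -mulrDr; apply: ler_wpM2l; first exact: ler0n.
  by rewrite lerD2l lerNl; have := ler_norm (- ln (pole_dist a)); rewrite normrN lerNl.
have p0 := @lpos_ge0 R C; have n0 : 0 <= n%:R :> R := ler0n _ _.
have h1 : lpos C <= lpos C * ln r by rewrite ler_peMr.
have h2 : L <= L * ln r by rewrite ler_peMr.
rewrite /Nevanlinna_T; move: hm hN h1 h2; clear.
move: (Nevanlinna_m f r) (Nevanlinna_N f r) (lpos C) (n%:R : R) (ln r) => a b p k l; lra.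
Qed.

(** A single pole already makes N grow like ln r.  Without poles, (f z - f 0) / z is entire
    and not zero, so that by the maximum principle f grows at least linearly; the
    conclusion for m follows from the pointwise bound [log_upper_cleared]. *)
Lemma transcendental_T f : meromorphic f -> ~ rational_function f ->
  exists r0, forall r, r0 <= r -> ln r / 4 <= Nevanlinna_T f r.
Proof.
move=> mf nrf.
have large B : exists2 r0 : R, 1 <= r0 & forall r, r0 <= r -> B <= ln r.
  exists (expR `|B|) => [|r rB].
    by rewrite -expR0 ler_expR.
  apply: le_trans (ler_norm B) _.
  by rewrite -[`|B|]expRK ler_ln ?posrE ?expR_gt0// (lt_le_trans (expR_gt0 _) rB).
have [[a pa]|npole] := pselect (exists a, is_pole f a).
  have [r0 r01 Hr0] := large (4 * `|ln (pole_dist a)|).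
  exists (Num.max r0 (cmod a)) => r; rewrite ge_max => /andP[rr0 ra].
  have r1 : 1 <= r := le_trans r01 rr0; have r_gt0 := lt_le_trans ltr01 r1.
  have [ps ups Hps] := finite_poles mf r_gt0.
  have aps : a \in ps by apply/Hps.
  have hN : ln r - ln (pole_dist a) <= Nevanlinna_N f r.
    rewrite (N_formula r_gt0 (conj ups Hps)) (bigD1_seq a)//= -[leLHS]addr0.
    have rd0 : 0 <= ln r - ln (pole_dist a).
      by rewrite subr_ge0 ler_ln ?posrE ?pole_dist_gt0// pole_dist_le.
    apply: lerD; first by apply: ler_peMl => //; rewrite ler1n pole_mult_gt0.
    rewrite big_seq_cond; apply: sumr_ge0 => b /andP[/Hps[br _] _].
    by rewrite mulr_ge0// subr_ge0 ler_ln ?posrE ?pole_dist_gt0// pole_dist_le.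
  have := @m_ge0 R f r; have := Hr0 r rr0; have := ler_norm (ln (pole_dist a)).
  have := normr_ge0 (ln (pole_dist a)).
  rewrite /Nevanlinna_T; move: hN; clear.
  move: (Nevanlinna_N f r) (Nevanlinna_m f r) (ln r) (ln (pole_dist a)) `|_| => N m l p n; lra.
have np a : ~ is_pole f a by move=> pa; apply: npole; exists a.
have df a : derivable f a 1 by exact: meromorphic_derivable.
have [[z1 z1f]|cf] := pselect (exists z, f z != f 0); last first.
  exfalso; apply: nrf; exists (f 0)%:P, 1; split; first exact: oner_neq0.
  move=> z _; rewrite !hornerE divr1; apply: contrapT => zf.
  by apply: cf; exists z; exact/eqP.
have /derivableCP[phi cphi phiE] := df 0.
have z10 : z1 != 0 by apply: contraNneq z1f => ->.
have phi1 : 0 < cmod (phi z1).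
  rewrite cmod_gt0; apply: contraNneq z1f => p0.
  by rewrite phiE p0 mul0r addr0.
have dphi z : z != 0 -> derivable phi z 1.
  move=> z0; have d1 := @derivableCD _ f (fun=> - f 0) z (df z) (@derivableC_cst R (- f 0) z).
  have d2 := @derivableCV _ (fun z => z) z z0 (@derivableC_id R z).
  have d3 := @derivableCM _ (fun z => f z - f 0) (fun z => z^-1) z d1 d2.
  apply: derivableC_near_eq d3; apply/nbhsCP; exists (cmod z); first by rewrite cmod_gt0.
  move=> y yz; have y0 : y != 0.
    by apply: contraTneq yz => ->; rewrite sub0r cmodN ltxx.
  by rewrite {1}(phiE y) subr0 addrC addKr mulfK.
have hphi z : holo phi z.
  have [->|z0] := eqVneq z 0.
    split => //; apply/dnbhsCP; exists 1 => // y /andP[y0 _]; apply: dphi.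
    by rewrite -cmod_gt0 -[y]subr0.
  split; first exact: derivableC_continuous (dphi z z0).
  apply/dnbhsCP; exists (cmod z); first by rewrite cmod_gt0.
  move=> y /andP[_ yz]; apply: dphi.
  by apply: contraTneq yz => ->; rewrite sub0r cmodN ltxx.
(* the constant for which the maximum principle gives r <= B exp (3 m(r, f)) *)
pose B := 2 * (1 + cmod (f 0)) / cmod (phi z1).
have f00 := cmod_ge0 (f 0).
have B0 : 0 < B by rewrite divr_gt0// mulr_gt0// ltr_wpDr.
have [r0 r01 Hr0] := large (4 * `|ln B|).
exists (Num.max r0 (2 * cmod z1)) => r; rewrite ge_max => /andP[rr0 rz1].
have r1 : 1 <= r := le_trans r01 rr0; have r_gt0 := lt_le_trans ltr01 r1.
have r2 : 0 < r / 2 by rewrite divr_gt0.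
have Hps : poles_in f r [::] by split => // a; split => // -[_ /np].
have gE z : ~ is_pole f z -> f z = f z * pole_prod f r [::] z.
  by move=> _; rewrite /pole_prod big_nil mulr1.
have upper w : cmod w <= r / 2 -> lpos (cmod (f w)) <= 3 * Nevanlinna_m f r.
  apply: (log_upper_cleared mf r_gt0 Hps (fun z _ => np z) (fun z _ => holoT _ df) gE).
pose X := expR (3 * Nevanlinna_m f r).
have X1 : 1 <= X by rewrite -expR0 ler_expR mulr_ge0// m_ge0.
have bd t : 0 <= t <= 2 * pi -> cmod (phi ((r / 2)%:C%C * cis t)) <= X * (2 * (1 + cmod (f 0))) / r.
  move=> _; set y := _ * cis t; have yE : cmod y = r / 2 by rewrite cmod_circle// ltW.
  have : cmod (phi y * y) <= X + cmod (f 0).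
    have -> : phi y * y = f y - f 0 by rewrite (phiE y) subr0 addrC addKr.
    apply: le_trans (cmodB _ _) _; rewrite lerD2r.
    have := upper y; rewrite yE lexx => /(_ isT) u.
    apply: (@le_trans _ _ (Num.max (cmod (f y)) 1)); first by rewrite le_max lexx.
    by rewrite -[leLHS]lnK ?posrE ?lt_max ?ltr01 ?orbT// ler_expR.
  rewrite cmodM yE ler_pdivlMr// => h.
  have h2 : cmod (f 0) <= X * cmod (f 0) by rewrite ler_peMl.
  by move: h h2; clear; lra.
have := @maximum_principle R phi (r / 2) _ r2 (fun z _ => hphi z) bd z1.
have -> : cmod z1 <= r / 2 by rewrite ler_pdivlMr// mulrC.
move=> /(_ isT); rewrite ler_pdivlMr// => h.
have hX : r <= X * B.
  by rewrite /B mulrA ler_pdivlMr// mulrC.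
have hl : ln r <= 3 * Nevanlinna_m f r + ln B.
  have X0 : 0 < X := expR_gt0 _.
  rewrite -[3 * _]expRK -/X -lnM ?posrE// ler_ln ?posrE// mulr_gt0//.
have := N_ge0 mf r1; have := Hr0 r rr0; have := ler_norm (ln B).
have := normr_ge0 (ln B).
rewrite /Nevanlinna_T; move: hl; clear.
move: (Nevanlinna_N f r) (Nevanlinna_m f r) (ln r) (ln B) `|_| => N m l p n; lra.
Qed.

End Rational.

(** * Iterated logarithms and (p,q)-growth *)

Section Growth.
Variable R : realType.
Implicit Types (r s x y b C D X : R) (g : R -> R) (P Q : R -> Prop) (p q n : nat).

(** An explicit threshold is convenient because growth hypotheses are applied at all radii
    of an interval [4 rho, 16 rho]. *)
Definition for_large P := exists r0, forall r, r0 <= r -> P r.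

Lemma for_largeS P Q : (forall r, P r -> Q r) -> for_large P -> for_large Q.
Proof. by move=> PQ [r0 H]; exists r0 => r /H /PQ. Qed.

Lemma for_largeI P Q : for_large P -> for_large Q ->
  for_large (fun r => P r /\ Q r).
Proof.
move=> [r0 HP] [r1 HQ]; exists (Num.max r0 r1) => r.
by rewrite ge_max => /andP[/HP ? /HQ].
Qed.

Lemma for_large_ge X : for_large (fun r => X <= r).
Proof. by exists X. Qed.

Lemma for_large_forall (I : finType) (P : I -> R -> Prop) :
  (forall i, for_large (P i)) -> for_large (fun r => forall i, P i r).
Proof.
move=> H; pose r0 i := sval (cid (H i)).
exists (\sum_i `|r0 i|) => r rr i; apply: (svalP (cid (H i))).
apply: le_trans rr; apply: le_trans (ler_norm _) _.
by rewrite (bigD1 i)//= lerDl; apply: sumr_ge0.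
Qed.

Definition iter_exp n x := iter n (@expR R) x.

Lemma iter_expSr n x : iter_exp n.+1 x = iter_exp n (expR x).
Proof. exact: iterSr. Qed.

Lemma ler_iter_exp n x y : x <= y -> iter_exp n x <= iter_exp n y.
Proof. by move=> xy; elim: n => //= n IH; rewrite ler_expR. Qed.

Lemma expR_ge x : x <= expR x.
Proof. by have := expR_ge1Dx x; lra. Qed.

Lemma iter_exp_ge n x : x <= iter_exp n x.
Proof. by elim: n => //= n IH; apply: le_trans IH (expR_ge _). Qed.

Lemma iter_exp_mono p q x : (q <= p)%N -> iter_exp q x <= iter_exp p x.
Proof.
by move=> qp; rewrite -(subnK qp) [leRHS]iterD; exact: iter_exp_ge.
Qed.

(** This direction holds for every x because ln vanishes on nonpositive arguments. *)
Lemma iter_ln_le_exp n x y : iter_ln n x <= y -> x <= iter_exp n y.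
Proof.
elim: n x y => // n IH x y; rewrite iter_expSr /iter_ln iterS -/(iter_ln n x) => h.
apply: IH; have [l0|l0] := leP (iter_ln n x) 0.
  exact: le_trans (ltW (expR_gt0 _)).
by rewrite -[leLHS]lnK ?posrE// ler_expR.
Qed.

Lemma le_exp_iter_ln n x y : 0 <= y -> x <= iter_exp n y -> iter_ln n x <= y.
Proof.
elim: n x y => // n IH x y y0; rewrite iter_expSr /iter_ln iterS -/(iter_ln n x) => h.
have {}h := IH _ _ (ltW (expR_gt0 y)) h; have [l0|l0] := leP (iter_ln n x) 0.
  by rewrite ln0.
by rewrite -[leRHS]expRK ler_ln ?posrE// expR_gt0.
Qed.

Lemma exp_le_iter_ln n x y : iter_exp n y <= x -> y <= iter_ln n x.
Proof.
elim: n x y => // n IH x y; rewrite iter_expSr /iter_ln iterS -/(iter_ln n x) => h.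
have {}h := IH _ _ h; rewrite -[leLHS]expRK ler_ln ?posrE ?expR_gt0//.
exact: lt_le_trans (expR_gt0 y) h.
Qed.

(** Above the threshold all the intermediate logarithms are positive. *)
Lemma iter_lnK n x : iter_exp n 0 <= x -> iter_exp n (iter_ln n x) = x.
Proof.
elim: n x => // n IH x; rewrite iter_expSr expR0 => h.
have l1 := exp_le_iter_ln h.
rewrite iter_expSr /iter_ln iterS -/(iter_ln n x) lnK ?posrE ?(lt_le_trans ltr01 l1)//.
by apply: IH; apply: le_trans h; exact: ler_iter_exp.
Qed.

Lemma iter_ln_large n P : for_large P -> for_large (fun r => P (iter_ln n r)).
Proof.
move=> [r0 H]; exists (iter_exp n r0) => r /exp_le_iter_ln; exact: H.
Qed.

Lemma ler_iter_ln n x y : iter_exp n 0 <= y -> x <= y -> iter_ln n x <= iter_ln n y.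
Proof.
move=> h xy; apply: le_exp_iter_ln; first exact: exp_le_iter_ln.
by rewrite iter_lnK.
Qed.

(** A constant factor is absorbed by an arbitrarily small increase of the rate. *)
Lemma mul_iter_exp p C b b' : (0 < p)%N -> 0 < b < b' ->
  for_large (fun x => C * iter_exp p (b * x) <= iter_exp p (b' * x)).
Proof.
move=> + /andP[b0 bb]; elim: p C => // p IH C _.
pose K := ln (Num.max C 1).
have CK : C <= expR K.
  by rewrite lnK ?le_max ?lexx// posrE lt_max ltr01 orbT.
have expC u v : K + u <= v -> C * expR u <= expR v.
  move=> h; apply: (@le_trans _ _ (expR K * expR u)).
    by rewrite ler_wpM2r// expR_ge0.
  by rewrite -expRD ler_expR.
have [->|p0] := posnP p.
  exists (K / (b' - b)) => x; rewrite ler_pdivrMr ?subr_gt0// => h.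
  by apply: expC; move: h; clear; lra.
apply: for_largeS (for_largeI (IH 2 p0) (for_large_ge (K / b))) => x [h1].
rewrite ler_pdivrMr// mulrC => h2; apply: expC.
change (K + iter_exp p (b * x) <= iter_exp p (b' * x)).
have := iter_exp_ge p (b * x); move: h1 h2; clear.
move: (iter_exp p (b * x)) (iter_exp p (b' * x)) => u v; lra.
Qed.

Lemma linear_le_exp C b : 0 < b -> for_large (fun x => C * x <= expR (b * x)).
Proof.
move=> b0; exists (2 * `|C| / b ^+ 2) => x; rewrite ler_pdivrMr ?exprn_gt0// => h.
have x0 : 0 <= x.
  by rewrite -(pmulr_lge0 x (exprn_gt0 2 b0)); apply: le_trans h; rewrite mulr_ge0.
have bx0 : 0 <= b * x by rewrite mulr_ge0// ltW.
apply: le_trans (expR_ge1Dxn 1 bx0); rewrite -[(2`!)%N]/2%N.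
have h1 : C * x <= `|C| * x by apply: ler_wpM2r => //; exact: ler_norm.
have h2 : 2 * `|C| * x <= x * b ^+ 2 * x by apply: ler_wpM2r.
have -> : (b * x) ^+ 2 = x * b ^+ 2 * x by ring.
by move: h1 h2; clear; move: (x * b ^+ 2 * x) (C * x) => u v; lra.
Qed.

(** The growth rate of ln r in the (p,q)-scale: rational functions grow at no larger rate,
    and the other meromorphic functions at no smaller one. *)
Definition pq_floor p q : R := if (q <= p)%N then 0 else 1.

Definition pq_indices p q := (1 <= q <= p)%N \/ ((2 <= q)%N /\ q = p.+1).

(** With x = log_q r, ln r is the (q-1)-fold exponential of x, which is compared with the
    p-fold exponential of b x. *)
Lemma mul_ln_le p q C b : pq_indices p q -> pq_floor p q < b ->
  for_large (fun r => C * ln r <= iter_exp p (b * iter_ln q r)).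
Proof.
move=> pq fb.
have main : for_large (fun x => C * iter_exp q.-1 x <= iter_exp p (b * x)).
  case: pq fb => [/andP[q0 qp]|[q2 qE]]; rewrite /pq_floor; last first.
    rewrite qE ltnn => b1; have p0 : (0 < p)%N by rewrite -ltnS -qE.
    apply: for_largeS (@mul_iter_exp p C 1 b p0 _) => [x|]; last by rewrite ltr01.
    by rewrite mul1r.
  rewrite qp => b0; have p0 : (0 < p)%N := leq_trans q0 qp.
  have [p1|p1] := posnP p.-1.
    have pE : p = 1%N by rewrite -(prednK p0) p1.
    have qE : q = 1%N by apply/eqP; rewrite eqn_leq q0 andbT -pE.
    rewrite pE qE.
    exact: linear_le_exp.
  have h := @mul_iter_exp p.-1 (Num.max C 0) 1 2 p1.
  have {}h : for_large (fun x => Num.max C 0 * iter_exp p.-1 (1 * x) <= iter_exp p.-1 (2 * x)).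
    by apply: h; lra.
  apply: for_largeS (for_largeI h (for_largeI (linear_le_exp 2 b0) (for_large_ge 0))).
  move=> x [h1 [h2 x0]].
  have -> : iter_exp p (b * x) = iter_exp p.-1 (expR (b * x)).
    by rewrite -iter_expSr prednK.
  apply: le_trans (ler_iter_exp _ h2); apply: le_trans h1; rewrite mul1r.
  apply: (@le_trans _ _ (Num.max C 0 * iter_exp q.-1 x)).
    apply: ler_wpM2r; last by rewrite le_max lexx.
    exact: le_trans (iter_exp_ge _ _).
  apply: ler_wpM2l; first by rewrite le_max lexx orbT.
  by apply: iter_exp_mono; rewrite -!subn1 leq_sub2r.
have q0 : (0 < q)%N by case: pq => [/andP[]|[/ltnW]].
apply: for_largeS (for_largeI (iter_ln_large q main) (for_large_ge (iter_exp q 0))).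
move=> r [h1 h2]; apply: le_trans h1; rewrite le_eqVlt; apply/orP; left; apply/eqP.
congr (_ * _); rewrite -{1}(iter_lnK h2) -{1}(prednK q0) /iter_exp iterS.
exact: expRK.
Qed.

(** Multiplying the radius by a constant does not change the (p,q)-order. *)
Lemma iter_ln_scale q C b : (0 < q)%N -> 1 < b ->
  for_large (fun r => iter_ln q (C * r) <= b * iter_ln q r).
Proof.
move=> q0 b1; have h := @mul_iter_exp q C 1 b q0.
have {}h : for_large (fun x => C * iter_exp q (1 * x) <= iter_exp q (b * x)).
  by apply: h; rewrite ltr01.
apply: for_largeS (for_largeI (iter_ln_large q h) (for_large_ge (iter_exp q 0))).
move=> r [h1 h2]; apply: le_exp_iter_ln.
  by rewrite mulr_ge0 ?exp_le_iter_ln//; lra.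
by move: h1; rewrite mul1r iter_lnK.
Qed.

Lemma growth_lt p q g b : (pq_growth p q g < b%:E)%E ->
  for_large (fun r => g r <= iter_exp p (b * iter_ln q r)).
Proof.
move=> /ereal_inf_lt[_ [V [M [_ MV]] <-] supV].
apply: for_largeS (for_largeI (iter_ln_large q (for_large_ge 1)) (for_large_ge (M + 1))).
move=> r [l1 Mr]; have l0 : 0 < iter_ln q r := lt_le_trans ltr01 l1.
apply: iter_ln_le_exp; rewrite -ler_pdivrMr// -lee_fin; apply/ltW.
apply: le_lt_trans supV; apply: ereal_sup_ubound; exists r => //.
by apply: MV; rewrite (lt_le_trans _ Mr)// ltrDl.
Qed.

Lemma growth_le p q g b : 0 <= b ->
  for_large (fun r => g r <= iter_exp p (b * iter_ln q r)) ->
  (pq_growth p q g <= b%:E)%E.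
Proof.
move=> b0 h; have [r0 H] := for_largeI h (iter_ln_large q (for_large_ge 1)).
apply: (@le_trans _ _ (ereal_sup ((fun r => (iter_ln p (g r) / iter_ln q r)%:E) @` [set r | r0 <= r]))).
  apply: ereal_inf_lbound; exists [set r | r0 <= r] => //.
  by exists r0; split; [exact: num_real|move=> x /ltW].
apply: ge_ereal_sup => _ [r /= /H[gr l1] <-]; have l0 := lt_le_trans ltr01 l1.
rewrite lee_fin ler_pdivrMr//; apply: le_exp_iter_ln gr.
by rewrite mulr_ge0// ltW.
Qed.

Lemma growth_ge p q g b :
  for_large (fun r => iter_exp p (b * iter_ln q r) <= g r) ->
  (b%:E <= pq_growth p q g)%E.
Proof.
move=> h; have [r0 H] := for_largeI h (iter_ln_large q (for_large_ge 1)).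
apply: le_ereal_inf_tmp => _ [V [M [_ MV]] <-].
have [Mr rr] : M < Num.max r0 (M + 1) /\ r0 <= Num.max r0 (M + 1).
  by rewrite lt_max ltrDl ltr01 orbT le_max lexx.
apply: le_ereal_sup_tmp; eexists; first by exists (Num.max r0 (M + 1)); [exact: MV|reflexivity].
have [/exp_le_iter_ln gr l1] := H _ rr; have l0 := lt_le_trans ltr01 l1.
by rewrite lee_fin ler_pdivlMr.
Qed.

Implicit Types f : R[i] -> R[i].

Lemma order_lt p q f b : pq_indices p q -> meromorphic f -> pq_floor p q < b ->
  (pq_order p q f < b%:E)%E ->
  for_large (fun r => Nevanlinna_T f r <= iter_exp p (b * iter_ln q r)).
Proof.
move=> pq mf fb; rewrite /pq_order; case: asboolP => rf; last exact: growth_lt.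
move=> _; have [C hC] := rational_T mf rf.
apply: for_largeS (for_largeI hC (mul_ln_le C pq fb)) => r [h1 h2].
exact: le_trans h2.
Qed.

Lemma order_ge p q f b : meromorphic f -> ~ rational_function f ->
  (0 < q)%N -> for_large (fun x => iter_exp p (b * x) <= iter_exp q.-1 x / 4) ->
  (b%:E <= pq_order p q f)%E.
Proof.
move=> mf rf q0 h; rewrite /pq_order; case: asboolP => // _; apply: growth_ge.
apply: for_largeS (for_largeI (transcendental_T mf rf)
  (for_largeI (iter_ln_large q h) (for_large_ge (iter_exp q 0)))) => r [h1 [h2 h3]].
apply: le_trans h2 _; apply: le_trans h1; rewrite ler_pM2r ?invr_gt0//.
rewrite -{2}(iter_lnK h3) -{3}(prednK q0) /iter_exp iterS.
by rewrite expRK.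
Qed.

Lemma order_ge0 p q f : (0 < q)%N -> meromorphic f -> (0 <= pq_order p q f)%E.
Proof.
move=> q0 mf; have [rf|rf] := pselect (rational_function f).
  by rewrite /pq_order asboolT.
apply: order_ge => //; exists (4 * iter_exp p 0) => x h.
rewrite mul0r ler_pdivlMr// mulrC; apply: le_trans h _; exact: iter_exp_ge.
Qed.

(** For q = p + 1 an order below 1 would mean T(r) = o(ln r). *)
Lemma order_lt1_rational p f : (0 < p)%N -> meromorphic f ->
  (pq_order p p.+1 f < 1%:E)%E -> rational_function f.
Proof.
move=> p0 mf of1; apply: contrapT => rf.
have o0 := order_ge0 p (ltn0Sn p) mf.
suff: (1%:E <= pq_order p p.+1 f)%E by rewrite leNgt of1.
move: of1; case: (pq_order _ _ _) (fun b => @order_ge p p.+1 f b mf rf isT) o0 => // o H.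
rewrite !lee_fin !lte_fin => o0 o1; pose b := (o + 1) / 2.
suff: (b%:E <= o%:E)%E by rewrite lee_fin /b; lra.
apply: H; have h : 0 < b < 1 by rewrite /b; lra.
apply: for_largeS (mul_iter_exp 4 p0 h) => x; rewrite mul1r ler_pdivlMr//.
by rewrite mulrC.
Qed.

End Growth.

(** * Rational functions and generic points *)

Section Generic.
Variable R : realType.
Implicit Types (a b z w : R[i]) (f g h : R[i] -> R[i]) (P Q : {poly R[i]}).
Implicit Types S : R[i] -> Prop.

(** Rational expressions are valid off the roots of a nonzero polynomial, and such
    properties are stable under finite conjunctions and translations. *)
Definition generic S := exists2 Q, Q != 0 & forall z, Q.[z] != 0 -> S z.

Lemma genericS S S' : (forall z, S z -> S' z) -> generic S -> generic S'.
Proof. by move=> SS [Q Q0 H]; exists Q => // z /H /SS. Qed.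

Lemma genericI S S' : generic S -> generic S' -> generic (fun z => S z /\ S' z).
Proof.
move=> [Q Q0 H] [Q' Q'0 H']; exists (Q * Q'); first exact: mulf_neq0.
by move=> z; rewrite hornerM mulf_eq0 negb_or => /andP[/H ? /H'].
Qed.

Lemma generic_forall (I : finType) (S : I -> R[i] -> Prop) :
  (forall i, generic (S i)) -> generic (fun z => forall i, S i z).
Proof.
move=> H; pose Q i := s2val (cid2 (H i)).
exists (\prod_i Q i).
  by apply/prodf_neq0 => i _; exact: (s2valP (cid2 (H i))).
move=> z; rewrite horner_prod => /prodf_neq0 h i.
exact: (s2valP' (cid2 (H i))) (h i isT).
Qed.

Lemma generic_shift S b : generic S -> generic (fun z => S (b + z)).
Proof.
move=> [Q Q0 H]; exists (Q \Po ('X + b%:P)).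
  by rewrite comp_poly2_eq0// size_XaddC.
by move=> z; rewrite horner_comp !hornerE addrC => /H.
Qed.

Lemma generic_rational f P Q : Q != 0 ->
  generic (fun z => Q.[z] != 0 -> f z = P.[z] / Q.[z]) -> rational_function f.
Proof.
move=> Q0 [Q' Q'0 H]; exists (P * Q'), (Q * Q'); split; first exact: mulf_neq0.
move=> z; rewrite !hornerM mulf_eq0 negb_or => /andP[Qz Q'z].
by rewrite H// -mulf_div divff// mulr1.
Qed.

Lemma rational_cst a : rational_function (fun=> a).
Proof.
exists a%:P, 1; split; first exact: oner_neq0.
by move=> z _; rewrite !hornerE divr1.
Qed.

Lemma rational_add f g : rational_function f -> rational_function g ->
  rational_function (fun z => f z + g z).
Proof.
move=> [P [Q [Q0 fE]]] [P' [Q' [Q'0 gE]]].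
exists (P * Q' + P' * Q), (Q * Q'); split; first exact: mulf_neq0.
move=> z; rewrite hornerD !hornerM mulf_eq0 negb_or => /andP[Qz Q'z].
by rewrite fE// gE// addf_div.
Qed.

Lemma rational_mul f g : rational_function f -> rational_function g ->
  rational_function (fun z => f z * g z).
Proof.
move=> [P [Q [Q0 fE]]] [P' [Q' [Q'0 gE]]].
exists (P * P'), (Q * Q'); split; first exact: mulf_neq0.
move=> z; rewrite !hornerM mulf_eq0 negb_or => /andP[Qz Q'z].
by rewrite fE// gE// mulf_div.
Qed.

Lemma rational_sum (I : Type) (s : seq I) (D : pred I) (F : I -> R[i] -> R[i]) :
  (forall i, D i -> rational_function (F i)) ->
  rational_function (fun z => \sum_(i <- s | D i) F i z).
Proof.
move=> H; elim: s => [|i s IH].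
  rewrite (_ : (fun z => _) = fun=> 0); first exact: rational_cst.
  by apply/funext => z; rewrite big_nil.
have [Di|Di] := boolP (D i); last first.
  rewrite (_ : (fun z => _) = (fun z => \sum_(j <- s | D j) F j z))//.
  by apply/funext => z; rewrite big_cons (negbTE Di).
rewrite (_ : (fun z => _) = (fun z => F i z + \sum_(j <- s | D j) F j z)).
  by apply: rational_add => //; exact: H.
by apply/funext => z; rewrite big_cons Di.
Qed.

Lemma rational_shift f b : rational_function f ->
  rational_function (fun z => f (b + z)).
Proof.
move=> [P [Q [Q0 fE]]]; exists (P \Po ('X + b%:P)), (Q \Po ('X + b%:P)); split.
  by rewrite comp_poly2_eq0// size_XaddC.
by move=> z; rewrite !horner_comp !hornerE [z + b]addrC; exact: fE.
Qed.

Lemma ccont_horner P a : ccont (horner P) a.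
Proof.
elim/poly_ind: P => [|P b IH].
  by apply: ccont_near (ccont_cst 0 a); exists 1 => // z _; rewrite horner0.
apply: (@ccont_near _ (fun z => P.[z] * z + b)).
  by exists 1 => // z _; rewrite hornerMXaddC.
apply: (@ccontD _ (fun z => P.[z] * z) (fun=> b)); last exact: ccont_cst.
by apply: (@ccontM _ (horner P) id) => //; exact: ccont_id.
Qed.

Lemma ccont_neq0 g a : ccont g a -> g a != 0 ->
  exists2 d : R, 0 < d & forall z, cmod (z - a) < d -> g z != 0.
Proof.
move=> cg ga; have [|d d0 H] := cg (cmod (g a)); first by rewrite cmod_gt0.
exists d => // z /H; apply: contraTneq => ->.
by rewrite sub0r cmodN ltxx.
Qed.

(** A rational expression is bounded around any point where its denominator does not
    vanish. *)
Lemma eq_rational_not_pole f P Q a d : Q.[a] != 0 -> 0 < d ->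
  (forall z, 0 < cmod (z - a) < d -> Q.[z] != 0 -> f z = P.[z] / Q.[z]) ->
  ~ is_pole f a.
Proof.
move=> Qa d0 fE; have cQ := ccont_horner Q a.
have [e e0 He] := ccont_neq0 cQ Qa.
have cg : ccont (fun z => P.[z] * (Q.[z])^-1) a.
  by apply: (@ccontM _ (horner P)); [exact: ccont_horner|exact: ccontV].
have [e' e'0 He'] := cg 1 ltr01.
apply: (@bounded_not_pole _ f a (cmod (P.[a] / Q.[a]) + 1) (Num.min d (Num.min e e'))).
  by rewrite !lt_min d0 e0.
move=> z /andP[z0]; rewrite !lt_min => /and3P[zd /He Qz /He' h].
rewrite fE ?z0// -(subrK (P.[a] / Q.[a]) (P.[z] / Q.[z])).
by apply: le_trans (cmodD _ _) _; rewrite addrC lerD2l ltW.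
Qed.

Lemma rational_generic f : rational_function f -> generic (fun z => ~ is_pole f z).
Proof.
move=> [P [Q [Q0 fE]]]; exists Q => // z Qz.
by apply: (@eq_rational_not_pole f P Q z 1) => // y _; exact: fE.
Qed.

Lemma poly_nonroot_near Q a (d : R) : Q != 0 -> 0 < d ->
  exists2 z, 0 < cmod (z - a) < d & Q.[z] != 0.
Proof.
move=> Q0 d0; apply: contrapT => H.
pose u n := a + (d / n.+2%:R)%:C%C.
have u0 n : 0 < d / n.+2%:R by rewrite divr_gt0// ltr0n.
have ud n : 0 < cmod (u n - a) < d.
  rewrite /u addrC addKr cmodC ger0_norm ?ltW// u0.
  by rewrite ltr_pdivrMr ?ltr0n// ltr_pMr// ltr1n.
have uinj : injective u.
  move=> n n' /addrI/complexI/(mulfI (lt0r_neq0 d0))/invr_inj/eqP.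
  by rewrite eqr_nat !eqSS => /eqP.
have roots : all (root Q) [seq u n | n <- iota 0 (size Q)].
  apply/allP => _ /mapP[n _ ->]; rewrite /root.
  by apply/negPn/negP => h; apply: H; exists (u n).
have := max_poly_roots Q0 roots.
by rewrite size_map size_iota ltnn map_inj_uniq// iota_uniq => /(_ isT).
Qed.

Lemma rational_inv f : meromorphic f -> not_identically_zero f ->
  rational_function f ->
  rational_function (fun z => (f z)^-1) /\ generic (fun z => f z != 0).
Proof.
move=> mf [w npw fw] [P [Q [Q0 fE]]].
have P0 : P != 0.
  apply/negP => /eqP P0; have cf := derivableC_continuous (meromorphic_derivable mf npw).
  have [d d0 Hd] := ccont_neq0 cf fw.
  have [z /andP[_ /Hd fz] Qz] := poly_nonroot_near w Q0 d0.
  by move: fz; rewrite fE// P0 horner0 mul0r eqxx.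
split.
  exists (Q * Q), (P * Q); split; first exact: mulf_neq0.
  move=> z; rewrite !hornerM mulf_eq0 negb_or => /andP[Pz Qz].
  by rewrite fE// invf_div -mulf_div divff// mulr1.
exists (P * Q); first exact: mulf_neq0.
move=> z; rewrite hornerM mulf_eq0 negb_or => /andP[Pz Qz].
by rewrite fE// mulf_neq0// invr_neq0.
Qed.

(** The equation is solved for A_m.  It says nothing at the poles of A_m, but off the
    exceptional set there are none by [eq_rational_not_pole], applied around a point where
    the equation holds in a punctured neighbourhood. *)
Lemma coefficient_rational (I : finType) (A : I -> R[i] -> R[i])
    (c : I -> R[i]) f (m : I) :
  (forall i, meromorphic (A i)) -> meromorphic f -> not_identically_zero f ->
  (forall z, (forall i, ~ is_pole (A i) z) -> (forall i, ~ is_pole f (c i + z)) ->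
    \sum_i A i z * f (c i + z) = 0) ->
  (forall i, i != m -> rational_function (A i)) -> rational_function f ->
  rational_function (A m).
Proof.
move=> mA mf f0 eqn rA rf.
have [rfV fneq0] := rational_inv mf f0 rf.
pose h z := - 1 * ((\sum_(i | i != m) A i z * f (c i + z)) * (f (c m + z))^-1).
have rh : rational_function h.
  apply: rational_mul; first exact: rational_cst.
  apply: rational_mul; last exact: (rational_shift (c m) rfV).
  apply: rational_sum => i im; apply: rational_mul; first exact: rA.
  exact: rational_shift.
have [P [Q [Q0 hE]]] := rh.
have good : generic (fun z => [/\ Q.[z] != 0, forall i, i != m -> ~ is_pole (A i) z,
    forall i, ~ is_pole f (c i + z) & f (c m + z) != 0]).
  have g1 : generic (fun z => Q.[z] != 0) by exists Q.
  have g2 : generic (fun z => forall i, i != m -> ~ is_pole (A i) z).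
    apply: generic_forall => i; have [->|im] := eqVneq i m.
      by exists 1; [exact: oner_neq0|].
    by apply: genericS (rational_generic (rA i im)) => z.
  have g3 : generic (fun z => forall i, ~ is_pole f (c i + z)).
    by apply: generic_forall => i; exact: (generic_shift (c i) (rational_generic rf)).
  have g4 := generic_shift (c m) fneq0.
  by apply: genericS (genericI g1 (genericI g2 (genericI g3 g4))) => z [? [? [? ?]]].
have AmE z : Q.[z] != 0 -> (forall i, i != m -> ~ is_pole (A i) z) ->
    (forall i, ~ is_pole f (c i + z)) -> f (c m + z) != 0 -> ~ is_pole (A m) z ->
    A m z = P.[z] / Q.[z].
  move=> Qz npA npf fz npm; rewrite -hE// /h.
  have : \sum_i A i z * f (c i + z) = 0.
    apply: eqn; last exact: npf.
    by move=> i; have [->|im] := eqVneq i m; [exact: npm|exact: npA].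
  rewrite (bigD1 m)//= => /eqP; rewrite addrC addr_eq0 => /eqP ->.
  by rewrite mulNr mul1r mulNr opprK mulfK.
apply: (@generic_rational (A m) P Q Q0).
have [S S0 HS] := good; exists S => // z Sz _.
have [Qz npA npf fz] := HS z Sz; apply: (AmE z Qz npA npf fz).
have [e e0 He] := ccont_neq0 (ccont_horner S z) Sz.
have [d d0 Hd] := poles_isolated z (mA m).
apply: (@eq_rational_not_pole (A m) P Q z (Num.min d e)) => //.
  by rewrite lt_min d0.
move=> y /andP[y0]; rewrite lt_min => /andP[yd /He /HS[Qy npAy npfy fy]] _.
by apply: AmE => //; apply: derivable_not_pole; apply: Hd; rewrite y0.
Qed.

End Generic.

(** * Comparison of the orders *)

Section Main.
Variable R : realType.
Implicit Types (f : R[i] -> R[i]) (p q : nat).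

Lemma iter_exp_ge1 p (y : R) : (0 < p)%N -> 0 <= y -> 1 <= iter_exp p y.
Proof.
move=> p0 y0; rewrite -(prednK p0) iter_expSr.
apply: le_trans (iter_exp_ge _ _); rewrite -expR0 ler_expR; exact: y0.
Qed.

Lemma lt_real_between (x : \bar R) (r s : R) : (x < r%:E)%E -> s < r ->
  exists b : R, [/\ s < b, b < r & (x < b%:E)%E].
Proof.
case: x => [t| |] //= xr sr; last first.
  by exists ((s + r) / 2); rewrite ltNyr; split => //; move: sr; clear; lra.
rewrite lte_fin in xr; have tr : Num.max t s < r by rewrite gt_max xr.
have tm : t <= Num.max t s by rewrite le_max lexx.
have sm : s <= Num.max t s by rewrite le_max lexx orbT.
exists ((Num.max t s + r) / 2); rewrite lte_fin.
by split; move: (Num.max t s) tr tm sm => u; clear; lra.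
Qed.

Section Orders.
Variables (p q : nat) (I : finType) (A : I -> R[i] -> R[i]) (c : I -> R[i]).
Variables (f : R[i] -> R[i]) (m : I).
Hypotheses (pq : pq_indices p q) (mA : forall i, meromorphic (A i)).
Hypotheses (mf : meromorphic f) (f0 : not_identically_zero f).
Hypothesis eqn : forall z, (forall i, ~ is_pole (A i) z) ->
  (forall i, ~ is_pole f (c i + z)) -> \sum_i A i z * f (c i + z) = 0.

Let p0 : (0 < p)%N.
Proof. by case: pq => [/andP[q1 qp]|[q2 qE]]; [exact: leq_trans q1 qp|rewrite -ltnS -qE]. Qed.

Let q0 : (0 < q)%N.
Proof. by case: pq => [/andP[]|[/ltnW]]. Qed.

(** For q = p + 1, if the order of A_m were at most 1, then f and all the other
    coefficients would have order less than 1, hence be rational, and then A_m would be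
    rational too, of order 0. *)
Lemma floor_lt_order (j : I) : j != m ->
  (forall i, i != m -> (pq_order p q (A i) < pq_order p q (A m))%E) ->
  (pq_order p q f < pq_order p q (A m))%E ->
  ((pq_floor R p q)%:E < pq_order p q (A m))%E.
Proof.
move=> jm dom domf.
have o0 : (0 < pq_order p q (A m))%E by apply: le_lt_trans (dom j jm); exact: order_ge0.
have nr : ~ rational_function (A m).
  by move=> rm; move: o0; rewrite /pq_order asboolT// ltxx.
case: pq => [/andP[_ qp]|[_ qE]]; rewrite /pq_floor; first by rewrite qp.
rewrite qE ltnn -qE ltNge; apply/negP => o1; apply: nr.
have small g : meromorphic g -> (pq_order p q g < pq_order p q (A m))%E -> rational_function g.
  move=> mg /lt_le_trans/(_ o1); rewrite qE; exact: order_lt1_rational.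
apply: (coefficient_rational mA mf f0 eqn) => [i im|]; last exact: small.
by apply: small (dom i im).
Qed.

(** N(r, A_m) is small by the hypothesis on the poles, m(r, A_m) by [core_estimate]; the
    constants and the enlarged radius are absorbed between the rates b and b'. *)
Lemma dominant_growth_le (b b' : R) : pq_floor R p q < b -> b < b' ->
  (forall i, i != m -> (pq_order p q (A i) < b%:E)%E) ->
  (pq_order p q f < b%:E)%E -> (pq_pole_exponent p q (A m) < b%:E)%E ->
  (pq_growth p q (Nevanlinna_T (A m)) <= b'%:E)%E.
Proof.
move=> fb bb' oA of_ lA.
have b0 : 0 < b by apply: le_lt_trans fb; rewrite /pq_floor; case: ifP.
have b'0 := lt_trans b0 bb'.
have [w npw fw] := f0.
have [C [rho0 core]] := core_estimate m mA mf eqn npw fw.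
have TA : for_large (fun r => forall i, i != m ->
    Nevanlinna_T (A i) r <= iter_exp p (b * iter_ln q r)).
  apply: for_large_forall => i; have [->|im] := eqVneq i m; first by exists 0.
  by apply: for_largeS (order_lt pq (mA i) fb (oA i im)) => r h _.
have [r1 Hr1] := for_largeI TA (for_largeI (order_lt pq mf fb of_)
  (for_largeI (growth_lt lA) (for_large_ge (iter_exp q 0)))).
(* b k is halfway between b and b' *)
pose k := (b + b') / (2 * b).
have k1 : 1 < k by rewrite /k ltr_pdivlMr ?mulr_gt0//; move: bb'; lra.
have kE : b * k = (b + b') / 2 by rewrite /k; field; rewrite gt_eqF.
have kb : 0 < b * k < b'.
  by rewrite kE; move: b0 bb'; lra.
apply: growth_le; first exact: ltW.
have h1 := iter_ln_scale 16 q0 k1.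
have h2 := iter_ln_large q (mul_iter_exp (2 * `|C| + 1) p0 kb).
apply: for_largeS (for_largeI (for_largeI h1 h2)
  (for_largeI (for_large_ge (Num.max 1 (Num.max rho0 r1))) (for_large_ge 0))).
move=> rho [[l16 hC] [+ _]]; rewrite !ge_max => /and3P[rho1 rr0 rr1].
set Phi := iter_exp p (b * iter_ln q (16 * rho)).
have rr : rho <= 16 * rho by move: rho1; lra.
have fl := (Hr1 rho rr1).2.2.2.
have l0 : 0 <= iter_ln q (16 * rho).
  by apply: exp_le_iter_ln; apply: le_trans rr.
have Phi1 : 1 <= Phi by apply: iter_exp_ge1 => //; rewrite mulr_ge0// ltW.
have bound r : rho <= r -> r <= 16 * rho ->
    iter_exp p (b * iter_ln q r) <= Phi.
  move=> rl ru; apply: ler_iter_exp; rewrite ler_pM2l//.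
  by apply: ler_iter_ln => //; apply: le_trans rr.
have four r : 4 * rho <= r -> rho <= r.
  by move: rho1; lra.
have hm : Nevanlinna_m (A m) rho <= C * (Phi + 1).
  apply: core => //.
  - exact: le_trans ler01 Phi1.
  - move=> i r im /andP[/four rl ru]; apply: le_trans (bound r rl ru).
    exact: (Hr1 r (le_trans rr1 rl)).1.
  - move=> r /andP[/four rl ru]; apply: le_trans (bound r rl ru).
    exact: (Hr1 r (le_trans rr1 rl)).2.1.
  - move=> r /andP[/four rl ru]; apply: le_trans (bound r rl ru).
    exact: (Hr1 r (le_trans rr1 rl)).2.2.1.
have hN : Nevanlinna_N (A m) rho <= Phi.
  by apply: le_trans (bound rho _ rr) => //; exact: (Hr1 rho rr1).2.2.1.
apply: le_trans hC.
have PhiE : Phi <= iter_exp p (b * k * iter_ln q rho).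
  by apply: ler_iter_exp; rewrite -mulrA ler_pM2l.
apply: (@le_trans _ _ ((2 * `|C| + 1) * Phi)); last first.
  by rewrite ler_pM2l// ltr_wpDl// mulr_ge0.
have hC1 : C * (Phi + 1) <= `|C| * (Phi + 1).
  by apply: ler_wpM2r (ler_norm C); move: Phi1; lra.
have hC2 : `|C| <= `|C| * Phi by rewrite ler_peMr.
rewrite /Nevanlinna_T; move: hm hN hC1 hC2.
move: (Nevanlinna_m _ _) (Nevanlinna_N _ _) (C * (Phi + 1)) => M N X.
by lra.
Qed.

End Orders.
End Main.

Theorem theorem21 (R : realType) (p q : nat)
  (hpq : (1 <= q <= p)%N \/ ((2 <= q)%N /\ q = p.+1))
  (k : nat) (hk : (2 <= k)%N)
  (A : 'I_k.+1 -> R[i] -> R[i])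
  (hA : forall j, meromorphic (A j))
  (hA0 : forall j, not_identically_zero (A j))
  (c : 'I_k -> R[i])
  (hc : injective c)
  (hc0 : forall j, c j != 0)
  (m : 'I_k.+1)
  (hlambda : (pq_pole_exponent p q (A m) < pq_order p q (A m))%E)
  (hfin : (pq_order p q (A m) < +oo)%E)
  (hmax : (\big[Order.max/-oo]_(j < k.+1 | j != m) pq_order p q (A j)
           < pq_order p q (A m))%E)
  (f : R[i] -> R[i])
  (hf : meromorphic f)
  (hf0 : not_identically_zero f)
  (hsol : solves_difference_equation A c f) :
  (pq_order p q (A m) <= pq_order p q f)%E.
Proof.
rewrite leNgt; apply/negP => hfm.
(* the unshifted term A_0 f is treated as a translate by 0 *)
pose c' (i : 'I_k.+1) : R[i] := if unlift ord0 i is Some j then c j else 0.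
have eqn z : (forall i, ~ is_pole (A i) z) -> (forall i, ~ is_pole f (c' i + z)) ->
    \sum_i A i z * f (c' i + z) = 0.
  move=> npA npf; rewrite big_ord_recl /c' unlift_none add0r.
  under eq_bigr => j _ do rewrite liftK addrC.
  rewrite addrC; apply: hsol => //.
    by have := npf ord0; rewrite /c' unlift_none add0r.
  by move=> j; have := npf (lift ord0 j); rewrite /c' liftK addrC.
have [_ dom] := bigmax_ltP _ _ _ _ hmax.
have [j jm] : exists j : 'I_k.+1, j != m.
  have [->|m0] := eqVneq m ord0; last by exists ord0; rewrite eq_sym.
  by exists ord_max; rewrite -val_eqE /= -lt0n ltnW.
have := floor_lt_order hpq hA hf hf0 eqn jm dom hfm.
case rhoE : (pq_order p q (A m)) hfin => [rho| |] // _; rewrite lte_fin => fl.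
pose mu := Order.max (\big[Order.max/-oo%E]_(j < k.+1 | j != m) pq_order p q (A j))
  (Order.max (pq_order p q f) (pq_pole_exponent p q (A m))).
have mu_lt : (mu < rho%:E)%E by rewrite !gt_max -rhoE hmax hfm.
have [b [fb brho]] := lt_real_between mu_lt fl.
rewrite !gt_max => /and3P[bmax bf bl].
have [_ bA] := bigmax_ltP _ _ _ _ bmax.
have nr : ~ rational_function (A m).
  move=> rm; move: rhoE; rewrite /pq_order asboolT// => -[rhoE].
  by move: fl; rewrite -rhoE /pq_floor; case: ifP; rewrite ?ltxx ?ltr10.
have bb' : b < (b + rho) / 2 by move: brho; clear; lra.
have := dominant_growth_le hpq hA hf hf0 eqn fb bb' bA bf bl.
rewrite -[pq_growth _ _ _]/(if false then 0%E else _).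
move: rhoE; rewrite /pq_order asboolF// => ->; rewrite lee_fin.
by move: brho; clear; lra.
Qed.
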